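(* Let $b$ be a nonextreme function in the unit ball of $H^\infty$. Then the restriction of the shift operator (multiplication by $z$ on $H^2$) to the de Branges–Rovnyak space $\mathcal{H}(b)$ is completely hyperexpansive if and only if there exist $c,\gamma,\beta\in\mathbb{C}$ with $|\beta|<1$ such that $$b(z)=\frac{c+\gamma z}{1-\beta z}\qquad (z\in\mathbb{D}).$$
   Context: $\mathbb{D}$ is the open unit disk in $\mathbb{C}$, $H^2$ the Hardy space of analytic functions on $\mathbb{D}$ with square-summable Taylor coefficients, and $H^\infty$ the space of bounded analytic functions on $\mathbb{D}$ with the sup norm. ''Nonextreme'' means that $b$ (with $\|b\|_\infty\le 1$) is not an extreme point of the closed unit ball of $H^\infty$. De Branges–Rovnyak space: for $b\in H^\infty$ with $\|b\|_\infty\le1$, let $T_b$ be the Toeplitz operator on $H^2$ with symbol $b$ (multiplication by $b$) and $T_{\overline b}=T_b^*$. Then $\mathcal{H}(b)$ is the image of $H^2$ under $(I-T_bT_{\overline b})^{1/2}$, with inner product $\langle (I-T_bT_{\overline b})^{1/2}f,(I-T_bT_{\overline b})^{1/2}g\rangle_b=\langle f,g\rangle_{H^2}$ for $f,g\in \ker((I-T_bT_{\overline b})^{1/2})^\perp$. When $b$ is nonextreme, multiplication by $z$ leaves $\mathcal{H}(b)$ invariant and restricts to a bounded operator on $\mathcal{H}(b)$. A bounded operator $T$ on a complex Hilbert space is completely hyperexpansive if $\sum_{i=0}^{n}(-1)^i\binom{n}{i}T^{*i}T^{i}\le 0$ for all integers $n\ge1$. Adjoints of the restricted shift are taken in $\mathcal{H}(b)$.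 *)

(* Defs.v *)
From HB Require Import structures.
From mathcomp Require Import all_boot all_order all_algebra.
From mathcomp Require Import complex.
From mathcomp Require Import all_classical all_reals all_analysis.
Set Implicit Arguments.
Unset Strict Implicit.
Unset Printing Implicit Defensive.
Import Order.TTheory GRing.Theory Num.Theory numFieldNormedType.Exports.
Local Open Scope classical_set_scope.
Local Open Scope ring_scope.

(* A complex Hilbert space is given here as a linear subspace [carrier] of an
   ambient vector space [X] together with an inner product, linear in its first
   argument.  Only the values of [ip] on [carrier] are meaningful, and operators
   on the space are functions [X -> X] considered on [carrier] only. *)
Record innerSpace (R : realType) (X : lmodType R[i]) := InnerSpace {
  carrier : set X;
  ip : X -> X -> R[i] }.

Section Operators.
Context {R : realType} {X : lmodType R[i]}.
Implicit Types (H : innerSpace X) (T Q A : X -> X).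

Definition ipnorm H (x : X) : R := Num.sqrt (complex.Re (ip H x x)).

Definition bounded_operator H T : Prop :=
  [/\ forall x, carrier H x -> carrier H (T x),
      forall (a : R[i]) x y, carrier H x -> carrier H y ->
        T (a *: x + y) = a *: T x + T y
    & exists M : R, forall x, carrier H x -> ipnorm H (T x) <= M * ipnorm H x].

(* As [0 <= w] in [R[i]] means that [w] is real and nonnegative, this is
   positivity of an operator on a complex Hilbert space. *)
Definition positive_operator H T : Prop :=
  forall x, carrier H x -> 0 <= ip H (T x) x.

Definition negative_operator H T : Prop :=
  forall x, carrier H x -> ip H (T x) x <= 0.

Definition is_adjoint H T T' : Prop :=
  bounded_operator H T' /\
  forall x y, carrier H x -> carrier H y -> ip H (T x) y = ip H x (T' y).

(* The values of [adjoint] and [psqrt] on [carrier H] are uniquely determined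
   when [H] is a Hilbert space and [T] is bounded, resp. [A] is bounded and
   positive. *)
Definition adjoint H T : X -> X := @xget (X -> X) id [set T' | is_adjoint H T T'].

Definition is_psqrt H A Q : Prop :=
  [/\ bounded_operator H Q, positive_operator H Q
    & forall x, carrier H x -> Q (Q x) = A x].

Definition psqrt H A : X -> X := @xget (X -> X) id [set Q | is_psqrt H A Q].

Definition orth_ker H Q : set X :=
  [set x | carrier H x /\
           forall k, carrier H k -> Q k = 0 -> ip H x k = 0].

(* The image of [Q] with the inner product making [Q] a coisometry from [H]
   onto it: [ip (Q f) (Q g) = ip H f g] for [f, g] orthogonal to [ker Q]. *)
Definition range_space H Q : innerSpace X :=
  let lift x := xget 0 [set f | orth_ker H Q f /\ Q f = x] in
  InnerSpace (Q @` carrier H) (fun x y => ip H (lift x) (lift y)).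

Definition hyperexpansivity_defect H T (n : nat) (x : X) : X :=
  \sum_(i < n.+1)
     ((-1) ^+ i * 'C(n, i)%:R : R[i]) *: iter i (adjoint H T) (iter i T x).

Definition completely_hyperexpansive H T : Prop :=
  bounded_operator H T /\
  forall n, (1 <= n)%N -> negative_operator H (hyperexpansivity_defect H T n).

Definition extreme_point (K : set X) (x : X) : Prop :=
  K x /\
  forall (y z : X) (t : R), K y -> K z -> 0 < t < 1 ->
    x = t%:C%C *: y + (1 - t)%:C%C *: z -> y = x /\ z = x.

End Operators.

Definition disc (R : realType) : Type := {z : R[i] | `|z| < 1}.

Section Hardy.
Context {R : realType}.
Implicit Types (f g b : disc R -> R[i]) (a : nat -> R[i]).

(* An analytic function on the disc is the sum of its Taylor series at 0 there,
   and [a] is the sequence of its Taylor coefficients.  [R[i]^o] is [R[i]] with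
   the topology of its norm. *)
Definition taylor_expansion f a : Prop :=
  forall z : disc R,
    series (fun n => a n * val z ^+ n : R[i]^o) @ \oo --> (f z : R[i]^o).

Definition analytic_on_disc f : Prop := exists a, taylor_expansion f a.

Definition taylor f : nat -> R[i] := xget (fun=> 0) [set a | taylor_expansion f a].

Definition hardy2 : innerSpace (disc R -> R[i]) :=
  InnerSpace
    [set f | analytic_on_disc f /\
             cvgn (series (fun n => Normc.normc (taylor f n) ^+ 2 : R))]
    (fun f g =>
       limn (series (fun n => taylor f n * Num.conj (taylor g n) : R[i]^o))).

Definition hardy_inf : set (disc R -> R[i]) :=
  [set f | analytic_on_disc f /\
           exists M : R, forall z, Normc.normc (f z) <= M].

Definition supnorm f : R := sup [set Normc.normc (f z) | z in [set: disc R]].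

Definition hardy_inf_ball : set (disc R -> R[i]) :=
  [set f | hardy_inf f /\ supnorm f <= 1].

Definition nonextreme b : Prop := ~ extreme_point hardy_inf_ball b.

Definition toeplitz b : (disc R -> R[i]) -> disc R -> R[i] :=
  fun f z => b z * f z.

Definition de_branges_rovnyak b : innerSpace (disc R -> R[i]) :=
  range_space hardy2
    (psqrt hardy2 (fun f => f - toeplitz b (adjoint hardy2 (toeplitz b) f))).

Definition mulz : (disc R -> R[i]) -> disc R -> R[i] :=
  fun f z => val z * f z.

End Hardy.

(* Main.v *)
Require Import Defs.
From HB Require Import structures.
From mathcomp Require Import all_boot all_order all_algebra.
From mathcomp Require Import complex ring lra.
From mathcomp Require Import cyclic separable cyclotomic.
From mathcomp Require Import all_classical all_reals all_analysis.
Set Implicit Arguments.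
Unset Strict Implicit.
Unset Printing Implicit Defensive.
Import Order.TTheory GRing.Theory Num.Theory numFieldNormedType.Exports.
Local Open Scope classical_set_scope.
Local Open Scope ring_scope.

(* Let [w] be the backward shift of [b].  Nonextremality gives a nonzero bounded
   analytic [h] with [|b f|^2 + |h f|^2 <= |f|^2] on [H^2]; hence [|(T_b^* g)(0)|^2]
   is at most a multiple of [|g|^2 - |T_b^* g|^2], which says that [b] lies in
   [H(b)].  The adjoint in [H(b)] of the backward shift [B] is then
   [f |-> z f - <f, w>_b b], and consequently
     [|z f|_b^2 = |f|_b^2 + (1 + |b|_b^2) |<f, w>_b|^2],
     [<z f, w>_b = <f, B w + <w, b>_b w>_b].
   The hyperexpansivity inequality of order two reads [|<z f, w>_b| <= |<f, w>_b|],
   and it forces [B w] to be a multiple of [w]: the Taylor coefficients of [b] are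
   geometric from the first one on, so [b] is linear fractional.
   Conversely, for such [b] one has [<z^n f, w>_b = kappa^n <f, w>_b] up to
   conjugation, and all the inequalities hold as soon as [|kappa| <= 1].  For this,
   a Fejer-Riesz factorisation provides [a = (r + s z) / (1 - beta z)] with
   [|s| <= |r|] and [|a|^2 + |b|^2 = 1] on the unit circle.  If
   [T_b^* f = T_a^* u] then [|f|_b^2 <= |f|^2 + |u|^2]; for
   [f = z^n / (1 - beta z)] this grows at most linearly in [n]. *)

(** * Complex numbers and inner product spaces *)

(** The circle is accessible only through Taylor coefficients: averages over roots of unity stand
    for integrals, and |a|^2 + |b|^2 = 1 appears as the norm inequality [T_mate] on H^2.
    Nonextremality is used as it is defined: if b = t y + (1 - t) x with y <> x in the ball, the
    parallelogram identity leaves the surplus t (1 - t) |(y - x) f|^2, so h is a multiple of y - x.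
    The obstacle in the converse is that kappa = beta + <w, b>_b contains an inner product of H(b)
    with no explicit value. It is bounded indirectly: with k = 1 / (1 - beta z), the modulus of <z^n
    k, w>_b is |kappa|^n |<k, w>_b|, whereas Cauchy-Schwarz and the linear bound on |z^n k|_b^2
    exclude exponential growth. The linear bound is where |s| <= |r| enters: the function u paired
    with z^n k is shifted and corrected by a constant at each step, and consecutive constants have
    ratio -conj (s / r). *)

Section ComplexNumbers.
Context {R : realType}.
Implicit Types (x y z : R[i]) (k : R).

Lemma conjD x y : (x + y)^* = x^* + y^*.
Proof. exact: rmorphD. Qed.

Lemma conjM x y : (x * y)^* = x^* * y^*.
Proof. exact: rmorphM. Qed.

Lemma conjN x : (- x)^* = - x^*.
Proof. exact: rmorphN. Qed.

Lemma conj0 : (0 : R[i])^* = 0.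
Proof. exact: rmorph0. Qed.

Lemma conj_real k : (k%:C%C)^* = k%:C%C.
Proof. exact: conjc_real. Qed.

Lemma conj_sum n (u : nat -> R[i]) : (\sum_(i < n) u i)^* = \sum_(i < n) (u i)^*.
Proof. exact: raddf_sum. Qed.

Lemma conjMn x n : (x *+ n)^* = x^* *+ n.
Proof. exact: rmorphMn. Qed.

Lemma conj_nat n : (n%:R : R[i])^* = n%:R.
Proof. exact: rmorph_nat. Qed.

Lemma cReD x y : complex.Re (x + y) = complex.Re x + complex.Re y.
Proof. by case: x; case: y. Qed.

Lemma cReN x : complex.Re (- x) = - complex.Re x.
Proof. by case: x. Qed.

Lemma cReB x y : complex.Re (x - y) = complex.Re x - complex.Re y.
Proof. by rewrite cReD cReN. Qed.

Lemma cReJ x : complex.Re x^* = complex.Re x.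
Proof. by case: x. Qed.

Lemma cReM k x : complex.Re (k%:C%C * x) = k * complex.Re x.
Proof. by case: x => a b /=; rewrite mul0r subr0. Qed.

Lemma normc_ge0 z : 0 <= Normc.normc z.
Proof. by case: z => a b; exact: sqrtr_ge0. Qed.

Lemma sqr_normcE z : Normc.normc z ^+ 2 = complex.Re z ^+ 2 + complex.Im z ^+ 2.
Proof. by case: z => a b /=; rewrite sqr_sqrtr// addr_ge0// sqr_ge0. Qed.

Lemma mulcJ z : z * z^* = (Normc.normc z ^+ 2)%:C%C.
Proof.
apply/eqP; rewrite eq_complex sqr_normcE; case: z => a b /=.
apply/andP; split; apply/eqP; ring.
Qed.

Lemma normcJr z : Normc.normc z^* = Normc.normc z.
Proof. by case: z => a b /=; rewrite sqrrN. Qed.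

Lemma normc_opp z : Normc.normc (- z) = Normc.normc z.
Proof. by case: z => a b /=; rewrite !sqrrN. Qed.

Lemma normcRe z : complex.Re z <= Normc.normc z.
Proof.
apply: le_trans (ler_norm _) _; rewrite -(@ler_pXn2r _ 2) ?nnegrE ?normc_ge0//.
by rewrite real_normK ?num_real// sqr_normcE lerDl sqr_ge0.
Qed.

Lemma normc_real k : Normc.normc k%:C%C = `|k|.
Proof. by rewrite /= expr0n addr0 sqrtr_sqr. Qed.

Lemma normcX z n : Normc.normc (z ^+ n) = Normc.normc z ^+ n.
Proof.
elim: n => [|n ih]; first by rewrite !expr0 Normc.normc1.
by rewrite !exprS Normc.normcM ih.
Qed.

Lemma norm_normc z : `|z| = (Normc.normc z)%:C%C.
Proof. by case: z. Qed.

End ComplexNumbers.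

Section InnerSpaces.
Context {R : realType} {X : lmodType R[i]}.
Implicit Types (H : innerSpace X) (T : X -> X).

Definition nsq H (x : X) : R := complex.Re (ip H x x).

Definition vcvg H (u : nat -> X) (x : X) : Prop :=
  (fun n => ipnorm H (u n - x)) @ \oo --> (0 : R).

(** An [innerSpace] carries no axioms of its own; they are imposed here, relative to [carrier],
    because [ip] is meaningless elsewhere. *)
Record prehilbert H : Prop := Prehilbert {
  carrier0 : carrier H 0;
  carrier_lin : forall a x y, carrier H x -> carrier H y ->
    carrier H (a *: x + y);
  ip_lin : forall a x y z, carrier H x -> carrier H y -> carrier H z ->
    ip H (a *: x + y) z = a * ip H x z + ip H y z;
  ipC : forall x y, carrier H x -> carrier H y -> ip H x y = (ip H y x)^*;
  ip_ge0 : forall x, carrier H x -> 0 <= ip H x x;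
  ip_eq0 : forall x, carrier H x -> ip H x x = 0 -> x = 0 }.

Definition cauchy_in H (u : nat -> X) : Prop :=
  forall e : R, 0 < e -> exists N, forall m n, (N <= m)%N -> (N <= n)%N ->
    nsq H (u m - u n) < e.

Record hilbert H : Prop := Hilbert {
  hilbert_pre :> prehilbert H;
  hilbert_complete : forall u, (forall n, carrier H (u n)) ->
    cauchy_in H u -> exists2 x, carrier H x & vcvg H u x }.

End InnerSpaces.

Section PreHilbert.
Context {R : realType} {X : lmodType R[i]} (H : innerSpace X).
Hypothesis hH : prehilbert H.
Implicit Types (x y z : X) (a : R[i]).

Let c0 := carrier0 hH.

Lemma carrierZ a x : carrier H x -> carrier H (a *: x).
Proof. by move=> hx; rewrite -[_ *: _]addr0; exact: carrier_lin. Qed.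

Lemma carrierD x y : carrier H x -> carrier H y -> carrier H (x + y).
Proof. by move=> hx hy; rewrite -[x]scale1r; exact: carrier_lin. Qed.

Lemma carrierN x : carrier H x -> carrier H (- x).
Proof. by rewrite -scaleN1r; exact: carrierZ. Qed.

Lemma carrierB x y : carrier H x -> carrier H y -> carrier H (x - y).
Proof. by move=> hx hy; apply: carrierD => //; exact: carrierN. Qed.

Lemma carrier_sum n (u : nat -> X) :
  (forall i, carrier H (u i)) -> carrier H (\sum_(i < n) u i).
Proof.
move=> hu; elim: n => [|n ih]; first by rewrite big_ord0.
by rewrite big_ord_recr; exact: carrierD.
Qed.

Ltac in_carrier := match goal with
  | h : carrier ?H ?x |- carrier ?H ?x => exact: h
  | |- carrier _ (@Algebra.zero _) => exact: c0
  | |- carrier _ (@Algebra.opp _ _) => apply: carrierN; in_carrier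
  | |- carrier _ (@GRing.scale _ _ _ _) => apply: carrierZ; in_carrier
  | |- carrier _ (@Algebra.add _ _ _) => apply: carrierD; in_carrier
  | h : forall i, carrier _ (?u i) |- carrier _ (?u _) => exact: h
  end.
#[local] Hint Extern 0 (carrier _ _) => in_carrier : core.

Lemma ipDl x y z : carrier H x -> carrier H y -> carrier H z ->
  ip H (x + y) z = ip H x z + ip H y z.
Proof. by move=> *; rewrite -{1}[x]scale1r (ip_lin hH)// mul1r. Qed.

Lemma ip0l z : carrier H z -> ip H 0 z = 0.
Proof.
move=> hz; have := ipDl c0 c0 hz.
by rewrite addr0 => /eqP; rewrite -subr_eq0 opprD addrA subrr add0r oppr_eq0 => /eqP.
Qed.

Lemma ipZl a x z : carrier H x -> carrier H z -> ip H (a *: x) z = a * ip H x z.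
Proof. by move=> *; rewrite -[a *: x]addr0 (ip_lin hH)// ip0l// addr0. Qed.

Lemma ipNl x z : carrier H x -> carrier H z -> ip H (- x) z = - ip H x z.
Proof. by move=> *; rewrite -scaleN1r ipZl// mulN1r. Qed.

Lemma ipBl x y z : carrier H x -> carrier H y -> carrier H z ->
  ip H (x - y) z = ip H x z - ip H y z.
Proof. by move=> *; rewrite ipDl// ipNl. Qed.

Lemma ipDr x y z : carrier H x -> carrier H y -> carrier H z ->
  ip H z (x + y) = ip H z x + ip H z y.
Proof. by move=> *; rewrite (ipC hH)// ipDl// conjD -!(ipC hH). Qed.

Lemma ip0r z : carrier H z -> ip H z 0 = 0.
Proof. by move=> hz; rewrite (ipC hH)// ip0l// conj0. Qed.

Lemma ipZr a x z : carrier H x -> carrier H z -> ip H z (a *: x) = a^* * ip H z x.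
Proof. by move=> *; rewrite (ipC hH)// ipZl// conjM -(ipC hH). Qed.

Lemma ipNr x z : carrier H x -> carrier H z -> ip H z (- x) = - ip H z x.
Proof. by move=> *; rewrite (ipC hH)// ipNl// conjN -(ipC hH). Qed.

Lemma ipBr x y z : carrier H x -> carrier H y -> carrier H z ->
  ip H z (x - y) = ip H z x - ip H z y.
Proof. by move=> *; rewrite ipDr// ipNr. Qed.

Lemma ip_suml n (u : nat -> X) z : (forall i, carrier H (u i)) -> carrier H z ->
  ip H (\sum_(i < n) u i) z = \sum_(i < n) ip H (u i) z.
Proof.
move=> hu hz; elim: n => [|n ih]; first by rewrite !big_ord0 ip0l.
by rewrite !big_ord_recr /= ipDl// ?ih//; exact: carrier_sum.
Qed.

Lemma ipxx x : carrier H x -> ip H x x = (nsq H x)%:C%C.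
Proof.
move=> hx; have := ip_ge0 hH hx; rewrite /nsq; case: (ip H x x) => a b.
by rewrite lecE /= => /andP[/eqP-> _].
Qed.

Lemma nsq_ge0 x : carrier H x -> 0 <= nsq H x.
Proof. by move=> hx; have := ip_ge0 hH hx; rewrite ipxx// ler0c. Qed.

Lemma nsq_eq0 x : carrier H x -> nsq H x = 0 -> x = 0.
Proof. by move=> hx h; apply: (ip_eq0 hH hx); rewrite ipxx// h. Qed.

Lemma nsq_gt0 x : carrier H x -> x <> 0 -> 0 < nsq H x.
Proof.
by move=> hx h; rewrite lt_def nsq_ge0// andbT; apply/eqP => /nsq_eq0; auto.
Qed.

Lemma nsq0 : nsq H 0 = 0.
Proof. by rewrite /nsq ip0l. Qed.

Lemma nsqZ a x : carrier H x -> nsq H (a *: x) = Normc.normc a ^+ 2 * nsq H x.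
Proof. by move=> hx; rewrite /nsq ipZl// ipZr// mulrA mulcJ cReM. Qed.

Lemma nsqN x : carrier H x -> nsq H (- x) = nsq H x.
Proof. by move=> hx; rewrite /nsq ipNl// ipNr// opprK. Qed.

Lemma nsqD x y : carrier H x -> carrier H y ->
  nsq H (x + y) = nsq H x + nsq H y + 2 * complex.Re (ip H x y).
Proof.
move=> hx hy; rewrite /nsq ipDl// !ipDr// (ipC hH hy hx) !cReD cReJ; ring.
Qed.

Lemma nsqB x y : carrier H x -> carrier H y ->
  nsq H (x - y) = nsq H x + nsq H y - 2 * complex.Re (ip H x y).
Proof. by move=> hx hy; rewrite nsqD// nsqN// ipNr// cReN mulrN. Qed.

Lemma nsqBC x y : carrier H x -> carrier H y -> nsq H (x - y) = nsq H (y - x).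
Proof. by move=> hx hy; rewrite -nsqN// opprB. Qed.

Lemma cauchy_schwarz x y : carrier H x -> carrier H y ->
  Normc.normc (ip H x y) ^+ 2 <= nsq H x * nsq H y.
Proof.
move=> hx hy; have hy0 := nsq_ge0 hy.
have [hy1|hy1] := eqVneq (nsq H y) 0.
  by rewrite (nsq_eq0 hy hy1) ip0r// Normc.normc0 nsq0 mulr0 expr0n.
have {}hy1 : 0 < nsq H y by rewrite lt_def hy1.
(* With p = |x|^2, q = |y|^2 and t = |<x, y>|^2, this vector has squared norm q (p q - t). *)
have := @nsq_ge0 ((nsq H y)%:C%C *: x - ip H x y *: y).
move=> /(_ ltac:(in_carrier)).
rewrite nsqB// !nsqZ// ipZl// ipZr// normc_real cReM [_^* * _]mulrC mulcJ /=.
rewrite real_normK ?num_real//; set p := nsq H x; set q := nsq H y.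
set t := Normc.normc _ ^+ 2 => h.
have : 0 <= q * (p * q - t) by lra.
by rewrite pmulr_rge0// subr_ge0.
Qed.

Lemma ipnorm_ge0 x : 0 <= ipnorm H x.
Proof. exact: sqrtr_ge0. Qed.

Lemma sqr_ipnorm x : carrier H x -> ipnorm H x ^+ 2 = nsq H x.
Proof. by move=> hx; rewrite sqr_sqrtr// -/(nsq H x) nsq_ge0. Qed.

Lemma ipnorm_le x (k : R) : carrier H x -> 0 <= k ->
  (ipnorm H x <= k) = (nsq H x <= k ^+ 2).
Proof.
by move=> hx hk; rewrite -sqr_ipnorm// ler_pXn2r// nnegrE ipnorm_ge0.
Qed.

Lemma normc_ip x y : carrier H x -> carrier H y ->
  Normc.normc (ip H x y) <= ipnorm H x * ipnorm H y.
Proof.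
move=> hx hy; rewrite -(@ler_pXn2r _ 2) ?nnegrE ?normc_ge0//.
  by rewrite exprMn !sqr_ipnorm// cauchy_schwarz.
by rewrite mulr_ge0 ?ipnorm_ge0.
Qed.

Lemma Re_ip x y : carrier H x -> carrier H y ->
  complex.Re (ip H x y) <= ipnorm H x * ipnorm H y.
Proof. by move=> hx hy; exact: le_trans (normcRe _) (normc_ip hx hy). Qed.

Lemma ipnorm0 : ipnorm H 0 = 0.
Proof. by rewrite /ipnorm ip0l// sqrtr0. Qed.

Lemma ipnorm_eq0 x : carrier H x -> ipnorm H x = 0 -> x = 0.
Proof.
by move=> hx h; apply: nsq_eq0 => //; rewrite -sqr_ipnorm// h expr0n.
Qed.

Lemma ipnormD x y : carrier H x -> carrier H y ->
  ipnorm H (x + y) <= ipnorm H x + ipnorm H y.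
Proof.
move=> hx hy; have := Re_ip hx hy => h.
rewrite ipnorm_le ?addr_ge0 ?ipnorm_ge0// nsqD// -!sqr_ipnorm//; nra.
Qed.

Lemma ipnormZ a x : carrier H x -> ipnorm H (a *: x) = Normc.normc a * ipnorm H x.
Proof.
move=> hx; rewrite {1}/ipnorm -/(nsq H _) nsqZ// sqrtrM ?sqr_ge0//.
by rewrite sqrtr_sqr ger0_norm ?normc_ge0.
Qed.

Lemma ipnormN x : carrier H x -> ipnorm H (- x) = ipnorm H x.
Proof. by move=> hx; rewrite /ipnorm -!/(nsq H _) nsqN. Qed.

Lemma ipnormBC x y : carrier H x -> carrier H y ->
  ipnorm H (x - y) = ipnorm H (y - x).
Proof. by move=> hx hy; rewrite -ipnormN// opprB. Qed.

Lemma ipnorm_tri x y z : carrier H x -> carrier H y -> carrier H z ->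
  ipnorm H (x - z) <= ipnorm H (x - y) + ipnorm H (y - z).
Proof. by move=> *; rewrite -(subrKA y) ipnormD. Qed.

Lemma eq_ip x y : carrier H x -> carrier H y ->
  (forall z, carrier H z -> ip H z x = ip H z y) -> x = y.
Proof.
move=> hx hy h; apply/eqP; rewrite -subr_eq0; apply/eqP.
by apply: (ip_eq0 hH) => //; rewrite ipBr// h// subrr.
Qed.

End PreHilbert.

(** * Convergence of vectors *)

Lemma bounded_carrier (R : realType) (X : lmodType R[i]) (H : innerSpace X) T x :
  bounded_operator H T -> carrier H x -> carrier H (T x).
Proof. by case=> h _ _; exact: h. Qed.

Ltac is_prehilbert := solve [assumption | apply: hilbert_pre; assumption].
Ltac in_carrier := match goal with
  | h : carrier ?H ?x |- carrier ?H ?x => exact: h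
  | |- carrier _ (@Algebra.zero _) => apply: carrier0; is_prehilbert
  | |- carrier _ (@Algebra.opp _ _) => apply: carrierN; [is_prehilbert | in_carrier]
  | |- carrier _ (@GRing.scale _ _ _ _) => apply: carrierZ; [is_prehilbert | in_carrier]
  | |- carrier _ (@Algebra.add _ _ _) =>
      apply: carrierD; [is_prehilbert | in_carrier | in_carrier]
  | h : forall i, carrier _ (?u i) |- carrier _ (?u _) => exact: h
  | h : bounded_operator ?H ?T |- carrier ?H (?T _) =>
      apply: (bounded_carrier h); in_carrier
  | h : forall i, _ -> carrier ?H (?T i) |- carrier ?H (?T _) => apply: h; in_carrier
  | h : forall n i, _ -> carrier ?H (?T n i) |- carrier ?H (?T _ _) => apply: h; in_carrier
  | |- _ => solve [auto]
  end.

Section Limits.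
Context {R : realType}.

Lemma cvg0P (a : nat -> R) : (forall n, 0 <= a n) ->
  (forall e, 0 < e -> exists N, forall n, (N <= n)%N -> a n < e) <->
  a @ \oo --> (0 : R).
Proof.
move=> a0; split=> [h|h e e0].
  apply/cvgrPdist_lt => e e0; have [N hN] := h e e0; exists N => // n /= hn.
  by rewrite sub0r normrN ger0_norm ?a0// hN.
move/cvgrPdist_lt: h => /(_ e e0) [N _ hN]; exists N => n hn.
by have := hN n hn; rewrite /= sub0r normrN ger0_norm ?a0.
Qed.

Lemma cvg0_le (a b : nat -> R) : (forall n, 0 <= a n <= b n) ->
  b @ \oo --> (0 : R) -> a @ \oo --> (0 : R).
Proof.
move=> h hb; apply: (@squeeze_cvgr _ _ _ _ (fun=> 0) b _ _ _ (cvg_cst _) hb).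
by near=> n; exact: h.
Unshelve. all: by end_near. Qed.

Lemma cvg0_sqr (a : nat -> R) :
  (fun n => a n ^+ 2) @ \oo --> (0 : R) -> a @ \oo --> (0 : R).
Proof.
move=> h; apply/cvgrPdist_lt => e e0.
have e2 : 0 < e ^+ 2 by rewrite exprn_gt0.
move/cvgrPdist_lt: h => /(_ _ e2) [N _ hN]; exists N => // n /= hn.
have := hN n hn; rewrite /= !sub0r !normrN normrX.
by rewrite ltr_pXn2r// nnegrE ltW.
Qed.

Lemma cvg0D (a b : nat -> R) : a @ \oo --> (0 : R) -> b @ \oo --> (0 : R) ->
  (fun n => a n + b n) @ \oo --> (0 : R).
Proof. by move=> ha hb; rewrite -[X in _ --> X](addr0 0); exact: cvgD. Qed.

Lemma cvg0Z (a : nat -> R) k : a @ \oo --> (0 : R) ->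
  (fun n => k * a n) @ \oo --> (0 : R).
Proof. by move=> ha; rewrite -[X in _ --> X](mulr0 k); exact: cvgMr. Qed.

Lemma cvg0B (u : nat -> R) l : u @ \oo --> l ->
  (fun n => l - u n) @ \oo --> (0 : R).
Proof. by move=> h; rewrite -(subrr l); apply: cvgB => //; exact: cvg_cst. Qed.

End Limits.

Section VectorLimits.
#[local] Hint Extern 0 (carrier _ _) => in_carrier : core.
#[local] Hint Extern 0 (prehilbert _) => is_prehilbert : core.
Context {R : realType} {X : lmodType R[i]} (H : innerSpace X).
Hypothesis hH : prehilbert H.
Implicit Types (x y z : X) (u v : nat -> X).

Lemma vcvgP u x : (forall n, carrier H (u n)) -> carrier H x ->
  vcvg H u x <-> (fun n => nsq H (u n - x)) @ \oo --> (0 : R).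
Proof.
move=> hu hx.
have -> : (fun n => nsq H (u n - x)) = (fun n => ipnorm H (u n - x) ^+ 2).
  by apply/funext => n; rewrite (sqr_ipnorm hH).
split=> h; last exact: cvg0_sqr.
have -> : (0 : R) = 0 ^+ 2 by rewrite expr0n.
rewrite (_ : (fun n => _) = (fun n => ipnorm H (u n - x) * ipnorm H (u n - x))).
  by rewrite expr2; exact: cvgM.
by apply/funext => n; rewrite expr2.
Qed.

Lemma vcvgD u v x y :
  (forall n, carrier H (u n)) -> (forall n, carrier H (v n)) ->
  carrier H x -> carrier H y ->
  vcvg H u x -> vcvg H v y -> vcvg H (fun n => u n + v n) (x + y).
Proof.
move=> hu hv hx hy ux vy; have h := cvg0D ux vy; rewrite /vcvg.
apply: cvg0_le h => n; rewrite ipnorm_ge0/= opprD addrACA.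
exact: ipnormD.
Qed.

Lemma vcvgZ u x (a : R[i]) : (forall n, carrier H (u n)) -> carrier H x ->
  vcvg H u x -> vcvg H (fun n => a *: u n) (a *: x).
Proof.
move=> hu hx ux; rewrite /vcvg.
have -> : (fun n => ipnorm H (a *: u n - a *: x)) =
          (fun n => Normc.normc a * ipnorm H (u n - x)).
  by apply/funext => n; rewrite -scalerBr (ipnormZ hH).
exact: cvg0Z.
Qed.

Lemma vcvg_unique u x y : (forall n, carrier H (u n)) ->
  carrier H x -> carrier H y -> vcvg H u x -> vcvg H u y -> x = y.
Proof.
move=> hu hx hy ux uy; apply/eqP; rewrite -subr_eq0; apply/eqP.
apply: (ipnorm_eq0 hH) => //; have h := cvg0D ux uy.
have h0 : (fun=> ipnorm H (x - y)) @ \oo --> (0 : R).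
  apply: cvg0_le h => n; rewrite ipnorm_ge0/= (ipnormBC hH (hu n) hx).
  exact: ipnorm_tri.
have h1 : (fun n : nat => ipnorm H (x - y)) @ \oo --> ipnorm H (x - y).
  exact: cvg_cst.
exact: (cvg_unique _ h1 h0).
Qed.

Lemma vcvg_ip u x z : (forall n, carrier H (u n)) -> carrier H x -> carrier H z ->
  vcvg H u x -> (fun n => Normc.normc (ip H (u n) z - ip H x z)) @ \oo --> (0 : R).
Proof.
move=> hu hx hz ux.
apply: cvg0_le (cvg0Z (ipnorm H z) ux) => n.
rewrite normc_ge0/= -(ipBl hH)// mulrC; exact: normc_ip.
Qed.

Lemma vcvg_ip_eq u x z (c : R[i]) :
  (forall n, carrier H (u n)) -> carrier H x -> carrier H z ->
  vcvg H u x -> (forall n, ip H (u n) z = c) -> ip H x z = c.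
Proof.
move=> hu hx hz /(vcvg_ip hu hx hz) h hc.
have h1 : (fun n : nat => Normc.normc (c - ip H x z)) @ \oo --> Normc.normc (c - ip H x z).
  exact: cvg_cst.
have e : (fun n => Normc.normc (ip H (u n) z - ip H x z)) =
         (fun n : nat => Normc.normc (c - ip H x z)).
  by apply/funext => n; rewrite hc.
rewrite e in h.
have : Normc.normc (c - ip H x z) = 0 by exact: (cvg_unique _ h1 h).
by move/Normc.eq0_normc/eqP; rewrite subr_eq0 => /eqP.
Qed.

Lemma vcvg_nsq_le u x (M : R) : (forall n, carrier H (u n)) -> carrier H x ->
  vcvg H u x -> (forall n, ipnorm H (u n) <= M) -> ipnorm H x <= M.
Proof.
move=> hu hx ux hM; apply/ler_addgt0Pr => e e0.
have [N hN] := iffRL (cvg0P (fun n => ipnorm_ge0 H _)) ux e e0.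
have := ipnormD hH (hu N) (carrierB hH hx (hu N)).
rewrite addrC subrK (ipnormBC hH)//.
by have := hN N (leqnn _); have := hM N; lra.
Qed.

End VectorLimits.

(** * Riesz representation and adjoints *)

Lemma le_cvg0 (R : realType) (a b : R) (e : nat -> R) :
  (forall n, a <= b + e n) -> e @ \oo --> (0 : R) -> a <= b.
Proof.
move=> h /cvgrPdist_lt he; apply/ler_addgt0Pr => d d0.
have [N _ hN] := he d d0; have := hN N (leqnn N); rewrite /= sub0r normrN.
by have := ler_norm (e N); have := h N; lra.
Qed.

Section Riesz.
#[local] Hint Extern 0 (carrier _ _) => in_carrier : core.
#[local] Hint Extern 0 (prehilbert _) => is_prehilbert : core.
Context {R : realType} {X X' : lmodType R[i]} (H : innerSpace X).
Hypothesis hH : hilbert H.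
(** The functional is bounded by |L x| rather than by |x|. With L the identity this is the usual
    Riesz theorem; with L = Q it produces elements of the range space of Q. *)
Variables (V : set X') (L : X' -> X) (phi : X' -> R[i]) (M : R).
Hypothesis V0 : V 0.
Hypothesis Vlin : forall a x y, V x -> V y -> V (a *: x + y).
Hypothesis HL : forall x, V x -> carrier H (L x).
Hypothesis Llin : forall a x y, V x -> V y -> L (a *: x + y) = a *: L x + L y.
Hypothesis philin :
  forall a x y, V x -> V y -> phi (a *: x + y) = a * phi x + phi y.
Hypothesis M0 : 0 <= M.
Hypothesis phiM : forall x, V x -> Normc.normc (phi x) ^+ 2 <= M * nsq H (L x).

(* [y] minimises the distance functional; the last clause says that it lies in
   the closure of [L V]. *)
Lemma riesz : exists y, [/\ carrier H y,
  forall x, V x -> phi x = ip H (L x) y, nsq H y <= M &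
  forall z, carrier H z -> (forall x, V x -> ip H (L x) z = 0) -> ip H y z = 0].
Proof.
pose J x := nsq H (L x) - 2 * complex.Re (phi x).
pose E := [set J x | x in V].
have JM x : V x -> - M <= J x.
  move=> Vx; have := phiM Vx; have := nsq_ge0 hH (HL Vx).
  have := normcRe (phi x); have := normc_ge0 (phi x); rewrite /J.
  set p : R := Normc.normc _; set q : R := nsq _ _; set r : R := complex.Re _ => h1 h2 h3 h4.
  have : 0 <= (q - M) ^+ 2 by exact: sqr_ge0.
  have [|] := leP (2 * r) (q + M); first lra.
  move=> h _; have {}h : q + M < 2 * r := h.
  have h5 : q + M < 2 * p by lra.
  have h6 : 0 <= q + M by exact: addr_ge0.
  have : (q + M) ^+ 2 < (2 * p) ^+ 2 by nra.
  have := sqr_ge0 (q - M); lra.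
have hE : has_inf E.
  split; first by exists (J 0); exists 0.
  by exists (- M) => _ [x Vx <-]; exact: JM.
pose m := inf E.
have mJ x : V x -> m <= J x.
  by move=> Vx; apply: ge_inf; [exact: (proj2 hE) | exists x].
have /choice[g hg] : forall n : nat, exists x, V x /\ J x < m + harmonic n.
  move=> n; have n0 : 0 < (harmonic n : R) by exact: harmonic_gt0.
  by have [_ [x Vx <-] hx] := inf_adherent n0 hE; exists x.
have Vg n : V (g n) := (hg n).1.
have HLg n : carrier H (L (g n)) := HL (Vg n).
have h0 : (harmonic : nat -> R) @ \oo --> (0 : R) by exact: cvg_harmonic.
(* Parallelogram law: |L x - L y|^2 = 2 J x + 2 J y - 4 J ((x + y) / 2), and J is at least m at the
   midpoint. Minimising sequences are therefore Cauchy. *)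
have hmid x y : V x -> V y ->
    nsq H (L x - L y) <= 2 * (J x - m) + 2 * (J y - m).
  move=> Vx Vy; have Hx := HL Vx; have Hy := HL Vy.
  have Vxy : V (-1 *: y + x) by exact: Vlin.
  have /mJ : V ((2^-1 : R)%:C%C *: (-1 *: y + x) + y) by exact: Vlin.
  have [D eD] : exists D, D = L x - L y by exists (L x - L y).
  have HD : carrier H D by rewrite eD.
  have eL : -1 *: L y + L x = D by rewrite scaleN1r addrC eD.
  have eLx : L x = D + L y by rewrite eD subrK.
  rewrite /J !(Llin, philin)// -eD eL eLx.
  rewrite !(nsqD hH)// (nsqZ hH)// (ipZl hH)// normc_real mulN1r !(cReD, cReM, cReN).
  rewrite real_normK ?num_real//.
  lra.
have [y Hy gy] : exists2 y, carrier H y & vcvg H (fun n => L (g n)) y.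
  apply: (hilbert_complete hH) => // e e0.
  have e4 : 0 < e / 4 by lra.
  have [N hN] := iffRL (cvg0P (fun n => ltW (harmonic_gt0 n))) h0 _ e4.
  exists N => i j hi hj; apply: le_lt_trans (hmid _ _ (Vg i) (Vg j)) _.
  have := hN i hi; have := hN j hj; have := (hg i).2; have := (hg j).2; lra.
have hphi x : V x -> phi x = ip H (L x) y.
  move=> Vx; have Hx := HL Vx.
  pose d := ip H (L x) y - phi x; pose N := nsq H (L x).
  have N0 : 0 <= N by exact: nsq_ge0.
  (* Stationarity at the minimum: [g n] is moved by -s conj(d) x and n tends to infinity, which
     yields [key]. Since s N <= 1, [key] forces d = 0. *)
  pose s : R := (N + 1)^-1; have s0 : 0 < s by rewrite invr_gt0; lra.
  pose p := Normc.normc d.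
  have p0 : 0 <= p by exact: normc_ge0.
  have key : 2 * s * p ^+ 2 <= s ^+ 2 * p ^+ 2 * N.
    have h1 := cvg0D h0 (cvg0Z (2 * s * p) (vcvg_ip hH HLg Hy Hx gy)).
    apply: le_cvg0 h1 => n.
    have /mJ : V ((- s)%:C%C *: (d^* *: x) + g n).
      by apply: Vlin => //; rewrite -[_ *: x]addr0; apply: Vlin.
    have Vdx : V (d^* *: x) by rewrite -[_ *: x]addr0; apply: Vlin.
    have L0 : L 0 = 0.
      have := Llin (-1) V0 V0.
      by rewrite !scaleN1r !addNr.
    have phi0 : phi 0 = 0.
      have := philin (-1) V0 V0.
      by rewrite scaleN1r mulN1r !addNr.
    have eL : L (d^* *: x) = d^* *: L x.
      by rewrite -[_ *: x]addr0 Llin// L0 addr0.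
    have ep : phi (d^* *: x) = d^* * phi x.
      by rewrite -[_ *: x]addr0 philin// phi0 addr0.
    rewrite /J Llin// philin// eL ep (nsqD hH)// !(nsqZ hH)// !(ipZl hH)//.
    rewrite !(cReD, cReM) normcJr normc_real -/N -/p real_normK ?num_real//.
    set Q := ip H (L x) (L (g n)).
    have eQ : complex.Re (d^* * (Q - phi x)) =
              p ^+ 2 + complex.Re (d^* * (Q - ip H (L x) y)).
      have -> : Q - phi x = d + (Q - ip H (L x) y) by rewrite /d; ring.
      by rewrite mulrDr cReD [d^* * d]mulrC mulcJ.
    have hE1 := normcRe (- (d^* * (Q - ip H (L x) y))).
    have eE1 : Normc.normc (- (d^* * (Q - ip H (L x) y))) =
        p * Normc.normc (ip H (L (g n)) (L x) - ip H y (L x)).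
      rewrite normc_opp Normc.normcM normcJr -/p.
      by rewrite -[in RHS]normcJr conjD conjN -!(ipC hH).
    rewrite {}eE1 cReN in hE1.
    move: eQ hE1; rewrite mulrBr cReB.
    set a : R := complex.Re (d^* * (Q - _)).
    set b : R := Normc.normc (_ - _).
    set u : R := complex.Re (d^* * Q); set v : R := complex.Re (d^* * phi x).
    move=> eQ hE1.
    have h2 : s * (- a) <= s * (p * b) by rewrite ler_pM2l.
    have h3 : s * u - s * v = s * p ^+ 2 + s * a by rewrite -mulrBr eQ mulrDr.
    have := (hg n).2; rewrite /J; lra.
  have : p ^+ 2 <= 0.
    have sN : s * N <= 1 by rewrite mulrC ler_pdivrMr; lra.
    have : s * (p ^+ 2) * (s * N) <= s * p ^+ 2.
      by rewrite ler_piMr// mulr_ge0 ?sqr_ge0 // ltW.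
    have -> : s * p ^+ 2 * (s * N) = s ^+ 2 * p ^+ 2 * N by ring.
    move=> h; have : s * p ^+ 2 <= 0 by lra.
    by rewrite pmulr_rle0.
  move=> h; have : p = 0.
    by apply/eqP; rewrite -sqrf_eq0 eq_le h sqr_ge0.
  by move/Normc.eq0_normc/eqP; rewrite subr_eq0 eq_sym => /eqP.
exists y; split=> //.
(* |y|^2 is the limit of the real parts of [phi (g n)], which are at most sqrt M |L (g n)|; hence
   q^2 <= sqrt M q. *)
- pose q := ipnorm H y; have q0 : 0 <= q by exact: ipnorm_ge0.
  have sM0 : 0 <= Num.sqrt M by exact: sqrtr_ge0.
  have hq : q ^+ 2 <= Num.sqrt M * q.
    apply: le_cvg0 (cvg0Z (Num.sqrt M + q) gy) => n; rewrite /q.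
    have h1 : Normc.normc (phi (g n)) <= Num.sqrt M * ipnorm H (L (g n)).
      rewrite -(@ler_pXn2r _ 2) ?nnegrE ?normc_ge0 ?mulr_ge0 ?ipnorm_ge0//.
      by rewrite exprMn sqr_sqrtr// (sqr_ipnorm hH)// phiM.
    have h2 : ipnorm H (L (g n)) <= ipnorm H (L (g n) - y) + q.
      by have := ipnormD hH (carrierB hH (HLg n) Hy) Hy; rewrite subrK.
    have := Re_ip hH (carrierB hH Hy (HLg n)) Hy.
    rewrite (ipBl hH)// cReB -hphi// -/(nsq H y) -(sqr_ipnorm hH)// -/q.
    rewrite (ipnormBC hH)//; have := normcRe (phi (g n)).
    set e := ipnorm H (_ - _) in h2 *.
    have : Num.sqrt M * ipnorm H (L (g n)) <= Num.sqrt M * (e + q) by rewrite ler_wpM2l.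
    lra.
  rewrite -(sqr_ipnorm hH)// -/q -(sqr_sqrtr M0).
  rewrite ler_pXn2r ?nnegrE//; have [->//|qn0] := eqVneq q 0.
  by rewrite -(@ler_pM2r _ q) ?lt_def ?qn0// -expr2.
- move=> z Hz hz; apply: (vcvg_ip_eq hH HLg Hy Hz gy) => n; exact: hz.
Qed.
End Riesz.

(** * Bounded operators, adjoints and self-adjointness *)

Section Operators.
#[local] Hint Extern 0 (carrier _ _) => in_carrier : core.
#[local] Hint Extern 0 (prehilbert _) => is_prehilbert : core.
Context {R : realType} {X : lmodType R[i]} (H : innerSpace X).
Implicit Types (T Q A B : X -> X).

Lemma ipnorm_le_nsq (hH : prehilbert H) (k : R) x y : 0 <= k ->
  carrier H x -> carrier H y ->
  nsq H x <= k * nsq H y -> ipnorm H x <= Num.sqrt k * ipnorm H y.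
Proof.
move=> k0 hx hy h; rewrite (ipnorm_le hH)//.
  by rewrite exprMn sqr_sqrtr// (sqr_ipnorm hH).
by rewrite mulr_ge0 ?sqrtr_ge0 ?ipnorm_ge0.
Qed.

Lemma bounded_nsq (hH : prehilbert H) T :
  (forall x, carrier H x -> carrier H (T x)) ->
  (forall a x y, carrier H x -> carrier H y -> T (a *: x + y) = a *: T x + T y) ->
  (exists2 k : R, 0 <= k & forall x, carrier H x -> nsq H (T x) <= k * nsq H x) ->
  bounded_operator H T.
Proof.
move=> h1 h2 [k k0 hk]; split=> //; exists (Num.sqrt k) => x hx.
by apply: ipnorm_le_nsq => //; auto.
Qed.

Lemma bounded_nsqP (hH : prehilbert H) T : bounded_operator H T ->
  exists2 k : R, 0 <= k & forall x, carrier H x -> nsq H (T x) <= k * nsq H x.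
Proof.
move=> [h1 h2 [M hM]]; exists (M ^+ 2) => [|x hx]; first exact: sqr_ge0.
rewrite -!(sqr_ipnorm hH)//.
rewrite -exprMn ler_pXn2r ?nnegrE ?ipnorm_ge0//; first exact: hM.
by apply: le_trans (hM x hx); exact: ipnorm_ge0.
Qed.

Section LinearOnCarrier.
Hypothesis hH : prehilbert H.
Variable T : X -> X.
Hypothesis Tlin :
  forall a x y, carrier H x -> carrier H y -> T (a *: x + y) = a *: T x + T y.

Lemma op0 : T 0 = 0.
Proof.
by have := Tlin (-1) (carrier0 hH) (carrier0 hH); rewrite !scaleN1r !addNr.
Qed.

Lemma opZ a x : carrier H x -> T (a *: x) = a *: T x.
Proof.
by move=> hx; rewrite -[a *: x]addr0 Tlin// ?op0 ?addr0//; exact: carrier0.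
Qed.

Lemma opD x y : carrier H x -> carrier H y -> T (x + y) = T x + T y.
Proof. by move=> hx hy; rewrite -{1}[x]scale1r Tlin// scale1r. Qed.

Lemma opB x y : carrier H x -> carrier H y -> T (x - y) = T x - T y.
Proof. by move=> hx hy; rewrite opD// -scaleN1r opZ// scaleN1r. Qed.

End LinearOnCarrier.

Lemma bounded_lin T : bounded_operator H T ->
  forall a x y, carrier H x -> carrier H y -> T (a *: x + y) = a *: T x + T y.
Proof. by case. Qed.

(** [riesz] represents x |-> <T x, y> for each y; its norm estimate is what makes the chosen map
    bounded, and uniqueness of the representing vector makes it linear. *)
Lemma adjointP (hH : hilbert H) T : bounded_operator H T ->
  is_adjoint H T (adjoint H T).
Proof.
move=> hT; have Tlin := bounded_lin hT.
suff h : exists T', is_adjoint H T T'.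
  by have := @xgetPex (X -> X) id [set T' | is_adjoint H T T'] h.
have [k k0 hk] := bounded_nsqP hH hT.
have /choice[T' hT'] : forall y, exists z, carrier H y ->
    [/\ carrier H z, forall x, carrier H x -> ip H (T x) y = ip H x z &
        nsq H z <= k * nsq H y].
  move=> y; have [hy|] := pselect (carrier H y); last by exists 0.
  have := @riesz _ X X H hH (carrier H) id (fun x => ip H (T x) y) (k * nsq H y).
  case=> [||//|//||||z [h1 h2 h3 _]]; last by exists z.
  - exact: carrier0.
  - by move=> a x z hx hz; exact: (carrier_lin hH).
  - by move=> a x z hx hz; rewrite Tlin// (ip_lin hH).
  - by rewrite mulr_ge0// (nsq_ge0 hH).
  - move=> x hx; apply: le_trans (cauchy_schwarz hH _ hy) _ => //.
    have := hk x hx; have := nsq_ge0 hH hy => h1 h2.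
    by rewrite mulrAC ler_wpM2r.
exists T'; split; last by move=> x y hx /hT'[]; auto.
apply: (bounded_nsq hH) => [x /hT'[]//|a x y hx hy|]; last first.
  by exists k => // x /hT'[].
have [h1 h2 _] := hT' _ hx; have [h3 h4 _] := hT' _ hy.
have hxy : carrier H (a *: x + y) by [].
have [h5 h6 _] := hT' _ hxy.
apply: (eq_ip hH) => // z hz.
by rewrite -h6// !(ipDr hH)// !(ipZr hH)// h2// h4.
Qed.

Lemma adjoint_bounded (hH : hilbert H) T : bounded_operator H T ->
  bounded_operator H (adjoint H T).
Proof. by move=> hT; case: (adjointP hH hT). Qed.

Lemma adjointE (hH : hilbert H) T x y : bounded_operator H T ->
  carrier H x -> carrier H y -> ip H (T x) y = ip H x (adjoint H T y).
Proof. by move=> hT hx hy; case: (adjointP hH hT) => _; exact. Qed.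

Lemma adjointEr (hH : hilbert H) T x y : bounded_operator H T ->
  carrier H x -> carrier H y -> ip H (adjoint H T x) y = ip H x (T y).
Proof.
move=> hT hx hy; have hT' := adjoint_bounded hH hT.
by rewrite (ipC hH)// -(adjointE hH)// -(ipC hH).
Qed.

(** Polarisation over the complex numbers: that <T v, v> is real at v = x + y equates the imaginary
    parts of <T x, y> and <x, T y>; replacing x by i x equates the real parts. *)
Lemma positive_selfadj (hH : prehilbert H) T : bounded_operator H T ->
  positive_operator H T ->
  forall x y, carrier H x -> carrier H y -> ip H (T x) y = ip H x (T y).
Proof.
move=> hT hpos; have Tlin := bounded_lin hT.
have hIm x : carrier H x -> complex.Im (ip H (T x) x) = 0.
  by move=> /hpos; rewrite lecE => /andP[/eqP].
have key x y : carrier H x -> carrier H y ->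
    complex.Im (ip H (T x) y) = complex.Im (ip H x (T y)).
  move=> hx hy; have := hIm _ (carrierD hH hx hy).
  have HTy : carrier H (T y) by [].
  rewrite (opD Tlin)// !(ipDl hH)// !(ipDr hH)// (ipC hH HTy hx).
  have := hIm x hx; have := hIm y hy.
  case: (ip H (T x) x) => ? ?; case: (ip H (T y) y) => ? ?.
  case: (ip H (T x) y) => ? ?; case: (ip H x (T y)) => ? ? /=; lra.
move=> x y hx hy; have h1 := key x y hx hy.
have := key ('i%C *: x) y (carrierZ hH _ hx) hy.
rewrite (opZ hH Tlin)// !(ipZl hH)//; move: h1.
case: (ip H (T x) y) => a b; case: (ip H x (T y)) => c d /= <-.
by rewrite !mul0r !add0r !mul1r => ->.
Qed.

End Operators.

(** * Square roots *)

(* The iteration [Y' = (B + Y^2) / 2] converges to [1 - sqrt (1 - B)].  Since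
   [Y''^2 - Y'^2 = Y'' (Y'' - Y') + (Y'' - Y') Y'], its norms and increments are
   dominated by those of the same iteration started with the number [1]
   in place of [B]. *)
Section SquareRoot.
#[local] Hint Extern 0 (carrier _ _) => in_carrier : core.
#[local] Hint Extern 0 (prehilbert _) => is_prehilbert : core.
Context {R : realType} {X : lmodType R[i]} (H : innerSpace X).
Hypothesis hH : hilbert H.
Variable B : X -> X.
Hypothesis HB : forall x, carrier H x -> carrier H (B x).
Hypothesis Blin :
  forall a x y, carrier H x -> carrier H y -> B (a *: x + y) = a *: B x + B y.
Hypothesis Bcontr : forall x, carrier H x -> ipnorm H (B x) <= ipnorm H x.
Hypothesis Bsa :
  forall x y, carrier H x -> carrier H y -> ip H (B x) y = ip H x (B y).

Let half : R[i] := (2^-1 : R)%:C%C.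

Fixpoint sqrt_iter n (x : X) : X :=
  if n is m.+1 then half *: (B x + sqrt_iter m (sqrt_iter m x)) else 0.

Fixpoint sqrt_bound n : R :=
  if n is m.+1 then 2^-1 * (1 + sqrt_bound m ^+ 2) else 0.

Local Notation Y := sqrt_iter.
Local Notation e := sqrt_bound.

Lemma sqrt_bound_itv n : 0 <= e n <= 1.
Proof. by elim: n => [|n] /=; nra. Qed.

Lemma sqrt_bound_le n : e n <= e n.+1.
Proof.
elim: n => [|n ih] /=; first by nra.
by have := sqrt_bound_itv n; have := sqrt_bound_itv n.+1; move: ih => /=; nra.
Qed.

Lemma sqrt_iter_carrier n x : carrier H x -> carrier H (Y n x).
Proof.
by elim: n x => [|n ih] x hx /=; [exact: carrier0 | exact: carrierZ].
Qed.

Let HY := sqrt_iter_carrier.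

Lemma sqrt_iter_lin n a x y : carrier H x -> carrier H y ->
  Y n (a *: x + y) = a *: Y n x + Y n y.
Proof.
elim: n a x y => [|n ih] a x y hx hy /=; first by rewrite scaler0 addr0.
by rewrite ih// ih ?Blin//; try exact: HY;
  rewrite addrACA -scalerDr [RHS]addrC scalerA mulrC -scalerA -scalerDr addrC.
Qed.

Lemma normc_half : Normc.normc half = 2^-1.
Proof. by rewrite normc_real ger0_norm. Qed.

Lemma sqrt_iter_norm n x : carrier H x -> ipnorm H (Y n x) <= e n * ipnorm H x.
Proof.
elim: n x => [|n ih] x hx /=; first by rewrite (ipnorm0 hH) mul0r.
rewrite (ipnormZ hH)// normc_half -mulrA ler_pM2l ?invr_gt0//.
apply: le_trans (ipnormD hH _ _) _ => //.
have := Bcontr hx; have := ih _ hx; have := ih _ (HY n hx).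
have /andP[e0 _] := sqrt_bound_itv n => h1 h2 h3.
have : e n * ipnorm H (Y n x) <= e n * (e n * ipnorm H x) by rewrite ler_wpM2l.
lra.
Qed.

Lemma sqrt_iter_diff n x : carrier H x ->
  ipnorm H (Y n.+1 x - Y n x) <= (e n.+1 - e n) * ipnorm H x.
Proof.
elim: n x => [|n ih] x hx.
  rewrite /= !subr0 expr0n !addr0 mulr1 (ipnormZ hH)// normc_half.
  by rewrite ler_pM2l ?invr_gt0// Bcontr.
have e1 : Y n.+2 x - Y n.+1 x = half *:
    (Y n.+1 (Y n.+1 x - Y n x) + (Y n.+1 (Y n x) - Y n (Y n x))).
  rewrite (opB hH (@sqrt_iter_lin n.+1))// subrKA.
  transitivity (half *: (B x + Y n.+1 (Y n.+1 x)) - half *: (B x + Y n (Y n x))).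
    by [].
  by rewrite -scalerBr opprD addrACA subrr add0r.
rewrite e1 (ipnormZ hH)// normc_half.
have h1 := sqrt_iter_norm n.+1 (carrierB hH (HY n.+1 hx) (HY n hx)).
have h2 := ih _ (HY n hx); have h3 := ih _ hx; have h4 := sqrt_iter_norm n hx.
have h5 := ipnormD hH (HY n.+1 (carrierB hH (HY n.+1 hx) (HY n hx)))
   (carrierB hH (HY n.+1 (HY n hx)) (HY n (HY n hx))).
have /andP[a0 _] := sqrt_bound_itv n; have /andP[b0 _] := sqrt_bound_itv n.+1.
have h6 := sqrt_bound_le n.
have e2 : e n.+2 - e n.+1 = 2^-1 * (e n.+1 ^+ 2 - e n ^+ 2).
  have E k : e k.+1 = 2^-1 * (1 + e k ^+ 2) by [].
  by have := E n.+1; have := E n; lra.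
rewrite e2; set a := e n in a0 h2 h3 h4 h6 *; set b := e n.+1 in b0 h1 h2 h3 h6 *.
have h7 := le_trans h1 (ler_wpM2l b0 h3).
have h8 : (b - a) * ipnorm H (Y n x) <= (b - a) * (a * ipnorm H x).
  by rewrite ler_wpM2l// subr_ge0.
rewrite -mulrA ler_pM2l ?invr_gt0//.
apply: le_trans h5 _; lra.
Qed.

Lemma sqrt_iter_dist m n x : carrier H x -> (n <= m)%N ->
  ipnorm H (Y m x - Y n x) <= (e m - e n) * ipnorm H x.
Proof.
move=> hx; elim: m => [|m ih].
  by rewrite leqn0 => /eqP ->; rewrite !subrr (ipnorm0 hH) mul0r.
rewrite leq_eqVlt => /orP[/eqP ->|]; first by rewrite !subrr (ipnorm0 hH) mul0r.
rewrite ltnS => /ih h.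
have := ipnorm_tri hH (HY m.+1 hx) (HY m hx) (HY n hx).
by have := sqrt_iter_diff m hx; lra.
Qed.

Lemma sqrt_iter_sa n x y : carrier H x -> carrier H y ->
  ip H (Y n x) y = ip H x (Y n y).
Proof.
elim: n x y => [|n ih] x y hx hy /=; first by rewrite (ip0l hH)// (ip0r hH).
rewrite (ipZl hH)// (ipZr hH)// (ipDl hH)// (ipDr hH)// Bsa// !ih//.
by rewrite conj_real.
Qed.

Lemma sqrt_iter_cvg x : carrier H x ->
  exists2 y, carrier H y & vcvg H (Y^~ x) y.
Proof.
move=> hx; apply: (hilbert_complete hH) => [n|d d0]; first exact: HY.
have [l el] : exists l, e @ \oo --> (l : R).
  have h : cvgn e.
    apply: nondecreasing_is_cvgn; first by apply/nondecreasing_seqP; exact: sqrt_bound_le.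
    by exists 1 => _ [n _ <-]; case/andP: (sqrt_bound_itv n).
  by exists (limn e).
have lel n : e n <= l.
  have <- : limn e = l by exact: (cvg_lim _ el).
  apply: nondecreasing_cvgn_le; last by apply/cvg_ex; exists l.
  by apply/nondecreasing_seqP; exact: sqrt_bound_le.
have hl : (fun n => ipnorm H x * (l - e n)) @ \oo --> (0 : R).
  by apply: cvg0Z; rewrite -[X in _ --> X](subrr l); apply: cvgB => //; exact: cvg_cst.
have a0 n : 0 <= ipnorm H x * (l - e n).
  by rewrite mulr_ge0 ?ipnorm_ge0// subr_ge0.
have d1 : 0 < Num.sqrt d by rewrite sqrtr_gt0.
have [N hN] := iffRL (cvg0P a0) hl _ d1.
have key m n : (N <= n)%N -> (n <= m)%N -> nsq H (Y m x - Y n x) < d.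
  move=> hn hm; rewrite -(sqr_ipnorm hH)// -[ltRHS](sqr_sqrtr (ltW d0)).
  rewrite ltr_pXn2r ?nnegrE ?ipnorm_ge0 ?ltW//.
  apply: le_lt_trans (hN n hn); apply: le_trans (sqrt_iter_dist hx hm) _.
  by rewrite mulrC ler_wpM2l ?ipnorm_ge0// lerB.
exists N => m n hm hn; case/orP: (leq_total n m); first exact: key.
by rewrite (nsqBC hH)//; exact: key.
Qed.

Lemma sqrt_exists : exists Q, is_psqrt H (fun x => x - B x) Q.
Proof.
have /choice[Z hZ] : forall x, exists z, carrier H x ->
    carrier H z /\ vcvg H (Y^~ x) z.
  move=> x; have [hx|hx] := pselect (carrier H x); last by exists 0.
  by have [z hz hz'] := sqrt_iter_cvg hx; exists z.
have HZ x (hx : carrier H x) : carrier H (Z x) := (hZ x hx).1.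
have vZ x (hx : carrier H x) : vcvg H (Y^~ x) (Z x) := (hZ x hx).2.
have e01 n : 0 <= e n by case/andP: (sqrt_bound_itv n).
have e11 n : e n <= 1 by case/andP: (sqrt_bound_itv n).
have Y1 n x : carrier H x -> ipnorm H (Y n x) <= ipnorm H x.
  move=> hx; apply: le_trans (sqrt_iter_norm n hx) _.
  by rewrite ler_piMl// ipnorm_ge0.
have Zlin a x y : carrier H x -> carrier H y -> Z (a *: x + y) = a *: Z x + Z y.
  move=> hx hy; have hxy : carrier H (a *: x + y) by [].
  have HYn z (hz : carrier H z) n : carrier H (Y n z) by [].
  apply: (vcvg_unique hH (HYn _ hxy) _ _ (vZ _ hxy)) => //.
  have -> : Y^~ (a *: x + y) = (fun n => a *: Y n x + Y n y).
    by apply/funext => n; rewrite sqrt_iter_lin.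
  by apply: (vcvgD hH) => //; [apply: (vcvgZ hH) => //; exact: vZ | exact: vZ].
have Z1 x : carrier H x -> ipnorm H (Z x) <= ipnorm H x.
  move=> hx; apply: (vcvg_nsq_le hH (fun n => HY n hx) (HZ x hx) (vZ x hx)).
  by move=> n; exact: Y1.
have Zsa x y : carrier H x -> carrier H y -> ip H (Z x) y = ip H x (Z y).
  move=> hx hy; apply/eqP; rewrite -subr_eq0; apply/eqP/Normc.eq0_normc.
  apply/eqP; rewrite eq_le normc_ge0 andbT.
  have h1 := vcvg_ip hH (fun n => HY n hx) (HZ x hx) hy (vZ x hx).
  have h2 := vcvg_ip hH (fun n => HY n hy) (HZ y hy) hx (vZ y hy).
  apply: le_cvg0 (cvg0D h1 h2) => n; rewrite add0r.
  have -> : Normc.normc (ip H (Y n y) x - ip H (Z y) x) =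
            Normc.normc (ip H (Y n x) y - ip H x (Z y)).
    by rewrite -normcJr conjD conjN -!(ipC hH)// sqrt_iter_sa.
  have -> : ip H (Z x) y - ip H x (Z y) =
      (ip H (Y n x) y - ip H x (Z y)) - (ip H (Y n x) y - ip H (Z x) y).
    ring.
  by rewrite addrC; apply: le_trans (le_normcD _ _) _; rewrite normc_opp.
(* The recursion 2 Y' = B + Y^2 in the limit; it says exactly that (1 - Z)^2 = 1 - B. *)
have ZZ x : carrier H x -> Z (Z x) = Z x + Z x - B x.
  move=> hx; have HYn z (hz : carrier H z) n : carrier H (Y n z) by [].
  apply: (@vcvg_unique _ _ H hH (fun n => Y n (Y n x))) => //.
    have h := cvg0D (vZ x hx) (vZ _ (HZ x hx)).
    rewrite /vcvg; apply: cvg0_le h => n; rewrite ipnorm_ge0/=.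
    apply: le_trans (ipnorm_tri hH _ (_ : carrier H (Y n (Z x))) _) _ => //.
    by rewrite lerD2r -(opB hH (@sqrt_iter_lin n))// Y1.
  have h := cvg0Z 2 (vZ x hx); rewrite -(cvg_shiftS _) in h.
  rewrite /vcvg; apply: cvg0_le h => n; rewrite ipnorm_ge0/=.
  have -> : Y n (Y n x) - (Z x + Z x - B x) = (2 : R)%:C%C *: (Y n.+1 x - Z x).
    rewrite scalerBr /= scalerA -rmorphM mulfV// scale1r.
    have -> : (2 : R)%:C%C *: Z x = Z x + Z x.
      by rewrite -[2]/(1 + 1) rmorphD scalerDl scale1r.
    by rewrite opprB addrA [Y n _ + B x]addrC.
  by rewrite (ipnormZ hH)// normc_real ger0_norm.
exists (fun x => x - Z x); split.
- apply: (bounded_nsq hH) => [x hx|a x y hx hy|].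
  + by [].
  + by rewrite Zlin// scalerBr opprD addrACA.
  + exists 4 => // x hx; rewrite -!(sqr_ipnorm hH)//.
    have := ipnormD hH hx (carrierN hH (HZ x hx)); rewrite (ipnormN hH)//.
    have := Z1 x hx; have := ipnorm_ge0 H x; have := ipnorm_ge0 H (x - Z x).
    nra.
- move=> x hx; rewrite (ipBl hH)// lecE; apply/andP; split.
    have : (ip H (Z x) x)^* = ip H (Z x) x by rewrite -(ipC hH)// -Zsa.
    rewrite (ipxx hH)//; case: (ip H (Z x) x) => a b /= [] h.
    by apply/eqP; lra.
  rewrite cReB -/(nsq H x) -(sqr_ipnorm hH)// /=.
  have := Re_ip hH (HZ x hx) hx; have := Z1 x hx; have := ipnorm_ge0 H x.
  nra.
- move=> x hx /=.
  have hZ2 : Z (x - Z x) = Z x - Z (Z x) by rewrite (opB hH Zlin).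
  rewrite hZ2 ZZ// (opprB (Z x)) [_ - B x - _]addrAC addrK.
  exact: subrKA.
Qed.

Lemma psqrtP : is_psqrt H (fun x => x - B x) (psqrt H (fun x => x - B x)).
Proof.
exact: (@xgetPex (X -> X) id [set Q | is_psqrt H (fun x => x - B x) Q] sqrt_exists).
Qed.

End SquareRoot.

(** * Range spaces *)

Section RangeSpace.
#[local] Hint Extern 0 (carrier _ _) => in_carrier : core.
#[local] Hint Extern 0 (prehilbert _) => is_prehilbert : core.
Context {R : realType} {X : lmodType R[i]} (H : innerSpace X).
Hypothesis hH : hilbert H.
Variable Q : X -> X.
Hypothesis hQ : bounded_operator H Q.
Hypothesis Qsa :
  forall x y, carrier H x -> carrier H y -> ip H (Q x) y = ip H x (Q y).

Local Notation K := (range_space H Q).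
Let Qlin := bounded_lin hQ.

(** The local [lift] of [range_space], given a name: the preimage under Q that is orthogonal to the
    kernel. *)
Definition range_lift (x : X) : X := xget 0 [set f | orth_ker H Q f /\ Q f = x].

Lemma range_carrier x : carrier K x -> carrier H x.
Proof. by case=> f hf <-. Qed.

Lemma carrier_range f : carrier H f -> carrier K (Q f).
Proof. by move=> hf; exists f. Qed.

(** [riesz] with L = Q. The representing vector lies in the closure of the range of Q, which is
    orthogonal to the kernel because Q is self-adjoint; so the bound on y is a bound on the norm of
    [Q y] in the range space. *)
Lemma riesz_range (phi : X -> R[i]) (M : R) :
  (forall a x y, carrier H x -> carrier H y ->
     phi (a *: x + y) = a * phi x + phi y) -> 0 <= M ->
  (forall x, carrier H x -> Normc.normc (phi x) ^+ 2 <= M * nsq H (Q x)) ->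
  exists y, [/\ orth_ker H Q y, nsq H y <= M &
    forall x, carrier H x -> phi x = ip H x (Q y)].
Proof.
move=> h1 h2 h3.
have [||||||//|y [hy1 hy2 hy3 hy4]] := @riesz _ X X H hH (carrier H) Q phi M.
- exact: carrier0.
- by move=> a x z hx hz; exact: (carrier_lin hH).
- by move=> x hx.
- exact: Qlin.
- by [].
- by [].
exists y; split=> //; last by move=> x hx; rewrite hy2// Qsa.
by split=> // k hk Qk; apply: hy4 => // x hx; rewrite Qsa// Qk (ip0r hH).
Qed.

(** The projection of f onto the complement of the kernel, found by representing g |-> <Q g, f>. *)
Lemma range_lift_exists f : carrier H f ->
  exists g, orth_ker H Q g /\ Q g = Q f.
Proof.
move=> hf; have [|||y [hy _ hyQ]] :=
  @riesz_range (fun g => ip H (Q g) f) (nsq H f).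
- by move=> a x y hx hy; rewrite Qlin// (ip_lin hH).
- exact: (nsq_ge0 hH).
- by move=> x hx; rewrite mulrC; apply: cauchy_schwarz.
exists y; split=> //; have hy' := hy.1.
by apply: (eq_ip hH) => // z hz; rewrite -hyQ// Qsa.
Qed.

Lemma range_liftP x : carrier K x ->
  orth_ker H Q (range_lift x) /\ Q (range_lift x) = x.
Proof.
case=> f hf <-; have h := range_lift_exists hf.
exact: (@xgetPex X 0 [set g | orth_ker H Q g /\ Q g = Q f] h).
Qed.

Lemma range_lift_carrier x : carrier K x -> carrier H (range_lift x).
Proof. by move/range_liftP => [[]]. Qed.
Let HL := range_lift_carrier.

Lemma orth_ker_ip f g h : orth_ker H Q f -> carrier H g -> carrier H h ->
  Q g = Q h -> ip H f g = ip H f h.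
Proof.
move=> [hf kf] hg hh e; apply/eqP; rewrite -subr_eq0 -(ipBr hH)//; apply/eqP.
by apply: kf; rewrite // (opB hH Qlin)// e subrr.
Qed.

Lemma range_liftK f : orth_ker H Q f -> range_lift (Q f) = f.
Proof.
move=> kf; have hf := kf.1; have hg := carrier_range hf.
have [kg eg] := range_liftP hg; have hlg := kg.1.
apply/eqP; rewrite -subr_eq0; apply/eqP; apply: (ip_eq0 hH) => //.
rewrite (ipBl hH)//; apply/eqP; rewrite subr_eq0; apply/eqP.
have e : Q (range_lift (Q f) - f) = 0 by rewrite (opB hH Qlin)// eg subrr.
by rewrite (kg.2 _ _ e)// (kf.2 _ _ e).
Qed.

Lemma range_ip f g : orth_ker H Q f -> carrier H g ->
  ip K (Q f) (Q g) = ip H f g.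
Proof.
move=> kf hg; rewrite -[LHS]/(ip H (range_lift (Q f)) (range_lift (Q g))).
have hg' := carrier_range hg; rewrite range_liftK//; apply: orth_ker_ip => //.
exact: (range_liftP hg').2.
Qed.

Lemma orth_ker_lin a f g : orth_ker H Q f -> orth_ker H Q g ->
  orth_ker H Q (a *: f + g).
Proof.
move=> [hf kf] [hg kg]; split=> // k hk Qk.
by rewrite (ip_lin hH)// kf// kg// mulr0 addr0.
Qed.

Lemma range_lift_lin a x y : carrier K x -> carrier K y ->
  range_lift (a *: x + y) = a *: range_lift x + range_lift y.
Proof.
move=> hx hy; have [kx ex] := range_liftP hx; have [ky ey] := range_liftP hy.
have hkx := kx.1; have hky := ky.1.
by rewrite -{1}ex -{1}ey -Qlin// range_liftK//; exact: orth_ker_lin.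
Qed.

Lemma range_prehilbert : prehilbert K.
Proof.
have lin a x y : carrier K x -> carrier K y -> carrier K (a *: x + y).
  move=> [f hf <-] [g hg <-]; exists (a *: f + g); first by [].
  by rewrite Qlin.
split; [|exact: lin|..].
- by exists 0; [exact: carrier0 | exact: (op0 hH Qlin)].
- move=> a x y z hx hy hz; have := HL hx; have := HL hy; have := HL hz => *.
  by rewrite -[LHS]/(ip H (range_lift _) (range_lift _)) range_lift_lin// (ip_lin hH).
- move=> x y hx hy; have := HL hx; have := HL hy => *.
  by rewrite -[LHS]/(ip H (range_lift x) (range_lift y)) (ipC hH).
- by move=> x hx; have := HL hx => h; exact: (ip_ge0 hH h).
- move=> x hx h; have hx' := HL hx.
  have e : range_lift x = 0 by exact: (ip_eq0 hH hx' h).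
  by rewrite -(range_liftP hx).2 e (op0 hH Qlin).
Qed.

(** Lifting is isometric onto the complement of the kernel, and this complement is closed. *)
Lemma range_hilbert : hilbert K.
Proof.
have hK := range_prehilbert; split=> // u hu cu.
have hl n : carrier H (range_lift (u n)) by exact: HL.
have [f hf cf] : exists2 f, carrier H f & vcvg H (fun n => range_lift (u n)) f.
  apply: (hilbert_complete hH) => // d d0; have [N hN] := cu d d0.
  exists N => m n hm hn; have := hN m n hm hn.
  have -> : u m - u n = -1 *: u n + u m by rewrite scaleN1r addrC.
  rewrite /nsq -[ip K _ _]/(ip H (range_lift _) (range_lift _)).
  by rewrite range_lift_lin// scaleN1r addrC.
have kf : orth_ker H Q f.
  split=> // k hk Qk; apply: (vcvg_ip_eq hH hl hf hk cf) => n.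
  by have [[_ h] _] := range_liftP (hu n); exact: h.
exists (Q f); first exact: carrier_range.
have hQf := carrier_range hf.
suff e : (fun n => ipnorm K (u n - Q f)) = (fun n => ipnorm H (range_lift (u n) - f)).
  by rewrite /vcvg e.
apply/funext => n; rewrite -[u n - _]addrC -scaleN1r.
rewrite /ipnorm -[ip K _ _]/(ip H (range_lift _) (range_lift _)).
by rewrite range_lift_lin// range_liftK// scaleN1r addrC.
Qed.

Lemma orth_ker_range v : carrier H v -> orth_ker H Q (Q v).
Proof. by move=> hv; split=> // k hk Qk; rewrite Qsa// Qk (ip0r hH). Qed.

(** Pairing with vectors Q (Q v) turns products of K into products of H. The square root itself has
    no formula, but Q Q does, so this is how inner products in K are computed. *)
Lemma range_ipQQ v g : carrier H v -> carrier K g ->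
  ip K (Q (Q v)) g = ip H v g.
Proof.
move=> hv [h hh <-]; rewrite range_ip// ?Qsa//; exact: orth_ker_range.
Qed.

(** Together with [range_le], a dual description of the range space: the squared norm of x in K is
    the least M in this inequality. Membership in K and norm bounds are always proved this way. *)
Lemma range_mem x (M : R) : carrier H x -> 0 <= M ->
  (forall g, carrier H g -> Normc.normc (ip H x g) ^+ 2 <= M * nsq H (Q g)) ->
  carrier K x /\ nsq K x <= M.
Proof.
move=> hx M0 hM; have [|//||y [ky hy2 hy3]] := @riesz_range (fun g => ip H g x) M.
- by move=> a z y hz hy; rewrite (ip_lin hH).
- by move=> g hg; rewrite (ipC hH)// normcJr hM.
have hy := ky.1.
have e : x = Q y by apply: (eq_ip hH).
rewrite e /nsq (range_ip ky hy).
by split; [exact: carrier_range | exact: hy2].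
Qed.

Lemma range_le x g : carrier K x -> carrier H g ->
  Normc.normc (ip H x g) ^+ 2 <= nsq K x * nsq H (Q g).
Proof.
move=> hx hg; have [[hf kf] e] := range_liftP hx.
have -> : nsq K x = nsq H (range_lift x) by [].
by rewrite -{1}e Qsa//; exact: cauchy_schwarz.
Qed.

End RangeSpace.

(** * Complex series *)

Section ComplexSums.
Context {R : realType}.
Implicit Types (a b : nat -> R[i]) (s t z : R[i]).

(** Convergence is stated through the real sequence of errors, so that all limits are limits of real
    numbers; [csumP] identifies it with the topological notion of the definitions. *)
Definition csum a s : Prop :=
  (fun n => Normc.normc (\sum_(i < n) a i - s)) @ \oo --> (0 : R).

Lemma ccvgP (u : nat -> R[i]) s :
  (u : nat -> R[i]^o) @ \oo --> (s : R[i]^o) <->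
  (fun n => Normc.normc (u n - s)) @ \oo --> (0 : R).
Proof.
split=> [h|h].
  apply/cvg0P => [n|e e0]; first exact: normc_ge0.
  have eC : (0 : R[i]) < e%:C%C by rewrite ltcE /= eqxx.
  move/cvgrPdist_lt: h => /(_ _ eC) [N _ hN].
  exists N => n hn; have := hN n hn.
  by rewrite /= distrC norm_normc ltcR.
apply/cvgrPdist_lt => e e0; have [d de] : exists d : R, e = d%:C%C.
  by exists (complex.Re e); rewrite RRe_real// gtr0_real.
move: e0; rewrite de ltcE /= eqxx /= => d0.
have [N hN] := iffRL (cvg0P (fun n => normc_ge0 _)) h _ d0.
by exists N => // n /hN; rewrite /= distrC norm_normc ltcR.
Qed.

Lemma csumP a s :
  (series (a : nat -> R[i]^o) : nat -> R[i]^o) @ \oo --> (s : R[i]^o) <-> csum a s.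
Proof.
by rewrite ccvgP /csum; under [X in X @ _]eq_fun do rewrite /series/= big_mkord.
Qed.

Lemma csum_unique a s t : csum a s -> csum a t -> s = t.
Proof.
move=> h1 h2; apply/eqP; rewrite -subr_eq0; apply/eqP/Normc.eq0_normc/eqP.
rewrite eq_le normc_ge0 andbT; apply: le_cvg0 (cvg0D h1 h2) => n; rewrite add0r.
rewrite -(subrKA (\sum_(i < n) a i)); apply: le_trans (le_normcD _ _) _.
by rewrite -opprB normc_opp.
Qed.

Lemma csum_lin a b s t z : csum a s -> csum b t ->
  csum (fun n => z * a n + b n) (z * s + t).
Proof.
move=> h1 h2; rewrite /csum; apply: cvg0_le (cvg0D (cvg0Z (Normc.normc z) h1) h2).
move=> n; rewrite normc_ge0/= big_split/= -mulr_sumr -Normc.normcM.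
by apply: le_trans (le_normcD _ _); rewrite mulrBr opprD addrACA.
Qed.

Lemma csum_ext a b s : a =1 b -> csum a s -> csum b s.
Proof. by move=> /funext ->. Qed.

Lemma csum_finite a N : (forall n, (N <= n)%N -> a n = 0) -> csum a (\sum_(i < N) a i).
Proof.
move=> h; apply/cvg0P => [n|e e0]; first exact: normc_ge0.
exists N => n hn; have -> : \sum_(i < n) a i = \sum_(i < N) a i.
  rewrite -(subnKC hn) big_split_ord /= [X in _ + X]big1 ?addr0// => i _.
  by rewrite h// leq_addr.
by rewrite subrr Normc.normc0.
Qed.

Lemma csum_le a s (M : R) : (forall n, Normc.normc (\sum_(i < n) a i) <= M) ->
  csum a s -> Normc.normc s <= M.
Proof.
move=> h1 h2; apply: le_cvg0 h2 => n.
apply: le_trans (lerD (h1 n) (lexx _)); rewrite -[s in leLHS](subKr (\sum_(i < n) a i)).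
by apply: le_trans (le_normcD _ _) _; rewrite normc_opp.
Qed.

Lemma normc_sum n a : Normc.normc (\sum_(i < n) a i) <= \sum_(i < n) Normc.normc (a i).
Proof.
elim: n => [|n ih]; first by rewrite !big_ord0 Normc.normc0.
by rewrite !big_ord_recr /=; apply: le_trans (le_normcD _ _) _; rewrite lerD2r.
Qed.

Lemma bounded_series_cvg (u : nat -> R) (M : R) : (forall n, 0 <= u n) ->
  (forall n, \sum_(i < n) u i <= M) -> cvgn (series u).
Proof.
move=> u0 uM; apply: nondecreasing_is_cvgn.
  by apply/nondecreasing_seqP => n; rewrite /series/= big_nat_recr//= lerDl.
by exists M => _ [n _ <-]; rewrite /series/= big_mkord.
Qed.

Lemma partial_sum_le_lim (u : nat -> R) : (forall n, 0 <= u n) ->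
  cvgn (series u) -> forall n, \sum_(i < n) u i <= limn (series u).
Proof.
move=> u0 cu n; rewrite -(big_mkord xpredT u).
apply: (nondecreasing_cvgn_le _ cu); apply/nondecreasing_seqP => m.
by rewrite /series/= big_nat_recr//= lerDl.
Qed.

Lemma normc_le_ReIm z : Normc.normc z <= `|complex.Re z| + `|complex.Im z|.
Proof.
case: z => x y; rewrite (_ : (x +i* y)%C = x%:C%C + (0 +i* y)%C); last first.
  by apply/eqP; rewrite eq_complex /= addr0 add0r !eqxx.
apply: le_trans (le_normcD _ _) _.
by rewrite /= !expr0n /= addr0 !add0r addr0 !sqrtr_sqr.
Qed.

Lemma cvg_ReIm (u : nat -> R[i]) s :
  (fun n => complex.Re (u n)) @ \oo --> complex.Re s ->
  (fun n => complex.Im (u n)) @ \oo --> complex.Im s ->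
  (fun n => Normc.normc (u n - s)) @ \oo --> (0 : R).
Proof.
move=> hx hy.
have h0 (v : nat -> R) l : v @ \oo --> l -> (fun n => `|v n - l|) @ \oo --> (0 : R).
  move=> h; rewrite -(normr0 R); apply: cvg_norm.
  by rewrite -(subrr l); apply: cvgB => //; exact: cvg_cst.
apply: cvg0_le (cvg0D (h0 _ _ hx) (h0 _ _ hy)) => n; rewrite normc_ge0/=.
apply: le_trans (normc_le_ReIm _) _.
by case: (u n) => p q; case: s {hx hy}.
Qed.

Lemma normr_Re z : `|complex.Re z| <= Normc.normc z.
Proof.
by rewrite ler_norml normcRe andbT lerNl -cReN -(normc_opp z) normcRe.
Qed.

Lemma normr_Im z : `|complex.Im z| <= Normc.normc z.
Proof.
have -> : complex.Im z = complex.Re (z * (0 -i* 1)%C).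
  by case: z => x y /=; ring.
apply: le_trans (normr_Re _) _; rewrite Normc.normcM /=.
by rewrite sqrrN expr0n expr1n add0r sqrtr1 mulr1.
Qed.

Lemma csum_exists a (M : R) : (forall n, \sum_(i < n) Normc.normc (a i) <= M) ->
  exists s, csum a s.
Proof.
move=> hM.
have cR (p : R[i] -> R) : (forall x y, p (x + y) = p x + p y) -> p 0 = 0 ->
    (forall z, `|p z| <= Normc.normc z) ->
    exists l, (fun n => p (\sum_(i < n) a i)) @ \oo --> (l : R).
  move=> pD p0 pn.
  have cvp : cvgn (series (p \o a)).
    apply: normed_cvg; apply: (@bounded_series_cvg _ M) => n.
      exact: normr_ge0.
    by apply: le_trans (hM n); apply: ler_sum => i _; exact: pn.
  exists (limn (series (p \o a))).
  rewrite (_ : (fun n => _) = series (p \o a))//; apply/funext => n.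
  rewrite /series /= big_mkord; elim: n => [|n ih]; first by rewrite !big_ord0.
  by rewrite !big_ord_recr/= pD ih.
have [x hx] := cR _ cReD erefl normr_Re.
have [|y hy] := cR (@complex.Im R) _ erefl normr_Im.
  by case=> ? ? [].
by exists (x +i* y)%C; exact: cvg_ReIm.
Qed.

Lemma ccauchy_cvg (u : nat -> R[i]) :
  (forall e, 0 < e -> exists N, forall m n, (N <= m)%N -> (N <= n)%N ->
     Normc.normc (u m - u n) < e) ->
  exists s, (fun n => Normc.normc (u n - s)) @ \oo --> (0 : R).
Proof.
move=> cu.
have cR (p : R[i] -> R) : (forall x y, p (x - y) = p x - p y) ->
    (forall z, `|p z| <= Normc.normc z) ->
    exists l, (fun n => p (u n)) @ \oo --> (l : R).
  move=> pB pn; suff h : cvg ((fun n => p (u n)) @ \oo) by eexists; exact: h.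
  apply/cauchy_cvgP/cauchy_exP => e e0; have [N hN] := cu e e0.
  exists (p (u N)); exists N => // n /= hn.
  by rewrite /ball /= -pB; apply: le_lt_trans (pn _) _; exact: hN.
have [x hx] := cR _ cReB normr_Re.
have [|y hy] := cR (@complex.Im R) _ normr_Im.
  by case=> ? ? [].
by exists (x +i* y)%C; exact: cvg_ReIm.
Qed.

End ComplexSums.

(** * Averages over roots of unity *)

Section RootsOfUnity.
Context {R : realType}.
Implicit Types (z : R[i]).

(** X^n - 1 splits over an algebraically closed field and is separable in characteristic zero, so it
    has n distinct roots. *)
Lemma prim_root_exists n : (0 < n)%N -> exists z : R[i], n.-primitive_root z.
Proof.
move=> n0; pose p : {poly R[i]} := 'X^n - 1.
have [r Dp] := closed_field_poly_normal p.
move: Dp; rewrite lead_coefDl ?size_polyXn ?size_polyN ?size_poly1 ?ltnS//.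
rewrite lead_coefXn scale1r => Dp.
have rn1 : all n.-unity_root r by apply/allP=> z; rewrite -root_prod_XsubC -Dp.
have sz_r : (n < (size r).+1)%N.
  by rewrite -(size_prod_XsubC r id) -Dp size_XnsubC.
have [|z] := hasP (has_prim_root n0 rn1 _ sz_r); last by exists z.
rewrite -separable_prod_XsubC -Dp separable_Xn_sub_1 // pnatr_eq0.
by rewrite -lt0n.
Qed.

Lemma prim_root_norm n z : n.-primitive_root z -> Normc.normc z = 1.
Proof.
move=> hz; have n0 := prim_order_gt0 hz.
have : Normc.normc z ^+ n = 1 by rewrite -normcX (prim_expr_order hz) Normc.normc1.
by move/eqP; rewrite pexpr_eq1 ?normc_ge0// => /eqP.
Qed.

Lemma sum_root n z k : n.-primitive_root z -> (0 < k < n)%N ->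
  \sum_(j < n) (z ^+ k) ^+ j = 0.
Proof.
move=> hz /andP[k0 kn].
have zk : z ^+ k != 1.
  rewrite -(expr0 z) (eq_prim_root_expr hz) mod0n modn_small//.
  by rewrite -lt0n.
have := subrX1 (z ^+ k) n; rewrite exprAC (prim_expr_order hz) expr1n subrr.
by move/esym/eqP; rewrite mulf_eq0 subr_eq0 (negPf zk) => /eqP.
Qed.

(** Orthogonality of the characters of the cyclic group of order n; a discrete substitute for
    integration over the circle. *)
Lemma parseval_root n z (a : nat -> R[i]) : n.-primitive_root z ->
  \sum_(k < n) Normc.normc (\sum_(i < n) a i * (z ^+ k) ^+ i) ^+ 2 =
  n%:R * \sum_(i < n) Normc.normc (a i) ^+ 2.
Proof.
move=> hz; have n0 := prim_order_gt0 hz; have zn := prim_root_norm hz.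
have zJ : z * z^* = 1 by rewrite mulcJ zn expr1n.
have zkJ k : (z ^+ k)^* = (z^*) ^+ k by exact: rmorphXn.
have orth i j : (i < n)%N -> (j < n)%N ->
    \sum_(k < n) (z ^+ k) ^+ i * ((z ^+ k) ^+ j)^* = (n%:R *+ (i == j) : R[i]).
  have aux (l m : nat) : (l + m < n)%N ->
     \sum_(k < n) (z ^+ k) ^+ (l + m) * ((z ^+ k) ^+ l)^* = (n%:R *+ (m == 0%N) : R[i]).
    move=> lm; transitivity (\sum_(k < n) (z ^+ m) ^+ k).
      apply: eq_bigr => k _; rewrite exprD mulrAC.
      have -> : (z ^+ k) ^+ l * ((z ^+ k) ^+ l)^* = 1.
        by rewrite mulcJ !normcX zn !expr1n.
      by rewrite mul1r exprAC.
    have [->|m0] := eqVneq m 0%N.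
      by rewrite (eq_bigr (fun=> 1)) ?sumr_const ?card_ord// => k _; rewrite expr0 expr1n.
    rewrite sum_root// lt0n m0/=; apply: leq_ltn_trans lm; exact: leq_addl.
  move=> hi hj; have [ij|/ltnW ij] := leqP j i.
    by have := aux j (i - j)%N; rewrite subnKC// => ->//; rewrite subn_eq0 eqn_leq ij andbT.
  have := aux i (j - i)%N; rewrite subnKC// => /(_ hj) h.
  have : (\sum_(k < n) (z ^+ k) ^+ j * ((z ^+ k) ^+ i)^*)^* = (n%:R *+ (j - i == 0)%N)^*.
    by rewrite h.
  rewrite (conj_sum _ (fun k => (z ^+ k) ^+ j * ((z ^+ k) ^+ i)^*)) conjMn conj_nat.
  rewrite subn_eq0 eqn_leq ij /= => <-.
  by apply: eq_bigr => k _; rewrite conjM conjCK mulrC.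
apply: complexI; rewrite rmorph_sum rmorphM rmorph_nat rmorph_sum /=.
transitivity (\sum_(k < n) \sum_(i < n) \sum_(j < n)
   a i * (a j)^* * ((z ^+ k) ^+ i * ((z ^+ k) ^+ j)^*)).
  apply: eq_bigr => k _; rewrite -mulcJ.
  rewrite (conj_sum _ (fun i => a i * (z ^+ k) ^+ i)) mulr_suml.
  apply: eq_bigr => i _.
  rewrite mulr_sumr; apply: eq_bigr => j _; rewrite conjM; ring.
rewrite exchange_big mulr_sumr /=; apply: eq_bigr => i _.
rewrite exchange_big /= (bigD1 i)//= [X in _ + X]big1 ?addr0 => [|j ji].
  by rewrite -mulr_sumr orth// eqxx mulcJ mulrC.
rewrite -mulr_sumr orth// [_ == _ :> nat]eq_sym -[_ == _ :> nat]/(j == i).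
by rewrite (negPf ji) mulr0n mulr0.
Qed.

End RootsOfUnity.

(** * Taylor coefficients *)

Section Taylor.
Context {R : realType}.
Implicit Types (f g : disc R -> R[i]) (a b : nat -> R[i]) (z : disc R).

Lemma disc_norm z : Normc.normc (val z) < 1.
Proof. by have := valP z; rewrite norm_normc ltcE => /andP[]. Qed.

Lemma in_disc (x : R[i]) : Normc.normc x < 1 -> exists z : disc R, val z = x.
Proof.
move=> hx; have h : `|x| < 1 by rewrite norm_normc ltcE /= eqxx.
by exists (exist _ x h).
Qed.

Lemma taylorP f a : taylor_expansion f a <->
  forall z, csum (fun n => a n * val z ^+ n) (f z).
Proof. by split=> h z; apply/csumP; exact: h. Qed.

Lemma taylor_lin f g a b (c : R[i]) :
  taylor_expansion f a -> taylor_expansion g b ->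
  taylor_expansion (c *: f + g) (fun n => c * a n + b n).
Proof.
move=> /taylorP h1 /taylorP h2; apply/taylorP => z.
by apply: csum_ext (csum_lin c (h1 z) (h2 z)) => n /=; ring.
Qed.

Lemma csum_shift (a : nat -> R[i]) s N : csum a s ->
  csum (fun i => a (N + i)%N) (s - \sum_(i < N) a i).
Proof.
move=> h; apply/cvg0P => [n|e e0]; first exact: normc_ge0.
have [M hM] := iffRL (cvg0P (fun n => normc_ge0 _)) h _ e0.
exists M => n hn; have := hM (N + n)%N (leq_trans hn (leq_addl _ _)).
by rewrite big_split_ord /= opprB addrCA addrA.
Qed.

Lemma csum_unshift (a : nat -> R[i]) s :
  csum (fun i => a i.+1) s -> csum a (a 0%N + s).
Proof.
move=> h; apply/cvg0P => [n|e e0]; first exact: normc_ge0.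
have [M hM] := iffRL (cvg0P (fun n => normc_ge0 _)) h _ e0.
exists M.+1 => -[//|n] hn; have := hM n hn.
by rewrite big_ord_recl /= opprD addrACA subrr add0r.
Qed.

Lemma csumZ (a : nat -> R[i]) s c : csum a s -> csum (fun n => c * a n) (c * s).
Proof.
move=> h; apply: cvg0_le (cvg0Z (Normc.normc c) h) => n.
by rewrite normc_ge0/= -mulr_sumr -mulrBr Normc.normcM.
Qed.

Definition coef_shift a : nat -> R[i] := fun n => if n is m.+1 then a m else 0.

Lemma taylor_mulz f a : taylor_expansion f a -> taylor_expansion (mulz f) (coef_shift a).
Proof.
move=> /taylorP h; apply/taylorP => z; rewrite /mulz.
rewrite -[val z * f z]add0r -[X in X + _](mul0r (val z ^+ 0)).
apply: (@csum_unshift (fun n => coef_shift a n * val z ^+ n)) => /=.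
by apply: csum_ext (csumZ (val z) (h z)) => n; rewrite /= exprS mulrCA.
Qed.

Lemma taylor_at0 f a z : taylor_expansion f a -> val z = 0 -> f z = a 0%N.
Proof.
move=> /taylorP h z0; apply: (csum_unique (h z)).
have := @csum_finite _ (fun n => a n * val z ^+ n) 1; rewrite big_ord1 expr0 mulr1.
by apply=> -[//|n] _; rewrite z0 expr0n mulr0.
Qed.

Lemma geo_sum (t : R) n : 0 <= t < 1 -> \sum_(i < n) t ^+ i <= (1 - t)^-1.
Proof.
move=> /andP[t0 t1].
have e : (\sum_(i < n) t ^+ i) * (1 - t) = 1 - t ^+ n.
  elim: n => [|n ih]; first by rewrite big_ord0 mul0r expr0 subrr.
  by rewrite big_ord_recr /= mulrDl ih exprS; ring.
have t1' : 0 < 1 - t by rewrite subr_gt0.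
by rewrite -[leRHS]mul1r ler_pdivlMr// e gerBl exprn_ge0.
Qed.

Lemma cvg0_bounded (u : nat -> R) : (forall n, 0 <= u n) -> u @ \oo --> (0 : R) ->
  exists2 K, 0 <= K & forall n, u n <= K.
Proof.
move=> u0 hu; have [N hN] := iffRL (cvg0P u0) hu _ ltr01.
have s0 : 0 <= \sum_(i < N) u i by rewrite sumr_ge0.
exists (1 + \sum_(i < N) u i) => [|n]; first by rewrite addr_ge0.
have [hn|hn] := leqP N n; first by have := hN n hn; lra.
rewrite (bigD1 (Ordinal hn))//=.
have : 0 <= \sum_(i < N | i != Ordinal hn) u i by rewrite sumr_ge0.
lra.
Qed.

Lemma taylor_bounded f a (r : R) : taylor_expansion f a -> 0 <= r < 1 ->
  exists2 K, 0 <= K & forall n, Normc.normc (a n) * r ^+ n <= K.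
Proof.
move=> /taylorP h /andP[r0 r1].
have [|z hz] := in_disc (_ : Normc.normc (r%:C%C) < 1).
  by rewrite normc_real ger0_norm.
have [K K0 hK] := cvg0_bounded (fun n => normc_ge0 _) (h z).
exists (K + K) => [|n]; first by rewrite addr_ge0.
have -> : Normc.normc (a n) * r ^+ n = Normc.normc (a n * val z ^+ n).
  by rewrite hz Normc.normcM normcX normc_real ger0_norm.
have := hK n; have := hK n.+1; rewrite big_ord_recr /=.
set x := \sum_(i < n) _; set y := a n * _ => h1 h2.
rewrite (_ : y = (x + y - f z) - (x - f z)); last by ring.
apply: le_trans (le_normcD _ _) _; rewrite normc_opp; exact: lerD.
Qed.

Lemma cvg0_geo (t : R) : 0 <= t < 1 -> (fun n => t ^+ n) @ \oo --> (0 : R).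
Proof. by move=> /andP[t0 t1]; apply: cvg_expr; rewrite ger0_norm. Qed.

Lemma taylor_tail f a (r : R) : taylor_expansion f a -> 0 <= r < 1 ->
  exists2 e : nat -> R, e @ \oo --> (0 : R) &
    forall N z, Normc.normc (val z) <= r ->
      Normc.normc (\sum_(i < N) a i * val z ^+ i - f z) <= e N.
Proof.
(* p lies strictly between r and 1: the terms of the series are bounded at radius p, so on |z| <= r
   the tails are dominated by a geometric series of ratio t = r / p. *)
move=> fa /andP[r0 r1]; pose p := (1 + r) / 2.
have p0 : 0 < p by rewrite /p; lra.
have p1 : p < 1 by rewrite /p; lra.
have [|K K0 hK] := taylor_bounded fa (_ : 0 <= p < 1); first by rewrite p1 ltW.
pose t := r / p; have t01 : 0 <= t < 1.
  apply/andP; split; first by rewrite /t divr_ge0 // ltW.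
  by rewrite /t ltr_pdivrMr// mul1r /p; lra.
exists (fun N => K * (1 - t)^-1 * t ^+ N); first by apply: cvg0Z; exact: cvg0_geo.
move=> N z hz; rewrite -opprB normc_opp.
apply: csum_le (csum_shift N ((taylorP f a).1 fa z)) => n.
apply: le_trans (normc_sum _ (fun i => a (N + i)%N * val z ^+ (N + i))) _.
apply: (@le_trans _ _ (\sum_(i < n) K * t ^+ N * t ^+ i)).
  apply: ler_sum => i _; rewrite -mulrA -exprD Normc.normcM normcX.
  apply: (@le_trans _ _ (Normc.normc (a (N + i)%N) * r ^+ (N + i))).
    by rewrite ler_wpM2l ?normc_ge0// lerXn2r ?nnegrE ?normc_ge0.
  have -> : r = p * t by rewrite /t mulrC divfK// gt_eqF.
  by rewrite exprMn mulrA ler_wpM2r ?exprn_ge0//; case/andP: t01.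
rewrite -mulr_sumr mulrAC ler_wpM2r ?exprn_ge0//; first by case/andP: t01.
by rewrite ler_wpM2l// geo_sum.
Qed.

(** The weight h keeps the factor of the main term x arbitrarily close to 1, at the price of a large
    factor on the error y. *)
Lemma normc_sqrD (x y : R[i]) (h : R) : 0 < h -> Normc.normc (x + y) ^+ 2 <=
  (1 + h) * Normc.normc x ^+ 2 + (1 + h^-1) * Normc.normc y ^+ 2.
Proof.
move=> h0; apply: (@le_trans _ _ ((Normc.normc x + Normc.normc y) ^+ 2)).
  by rewrite ler_pXn2r ?nnegrE ?addr_ge0 ?normc_ge0// le_normcD.
set p : R := Normc.normc x; set q : R := Normc.normc y.
have : 0 <= h^-1 * (h * p - q) ^+ 2 by rewrite mulr_ge0 ?sqr_ge0// invr_ge0 ltW.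
have -> : h^-1 * (h * p - q) ^+ 2 = h * p ^+ 2 - 2 * p * q + h^-1 * q ^+ 2.
  by field; rewrite gt_eqF.
lra.
Qed.

(* Average [|f|^2] over the [N]-th roots of unity on a circle of radius [r < 1],
   and let [N] tend to infinity. *)
Lemma parseval_le f a (p : nat -> R[i]) d : taylor_expansion f a ->
  (forall z, Normc.normc (f z) <= Normc.normc (\sum_(i < d) p i * val z ^+ i)) ->
  forall K, \sum_(i < K) Normc.normc (a i) ^+ 2 <=
            \sum_(i < d) Normc.normc (p i) ^+ 2.
Proof.
move=> fa fp K; set S := \sum_(i < d) _.
pose G (r : R) n (u : nat -> R[i]) := \sum_(i < n) Normc.normc (u i) ^+ 2 * (r ^+ 2) ^+ i.
have step1 (r h : R) : 0 <= r < 1 -> 0 < h -> G r K a <= (1 + h) * S.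
  move=> r01 h0; have [e e0 he] := taylor_tail fa r01.
  have /andP[r0 r1] := r01.
  pose c := 1 + h^-1.
  have ee : (fun n => c * (e n * e n)) @ \oo --> (0 : R).
    by apply: cvg0Z; rewrite -(mulr0 (0 : R)); exact: cvgM.
  have {}ee : (fun n => c * (e (K + d + n).+1 * e (K + d + n).+1)) @ \oo --> (0 : R).
    have c0 : 0 < c by rewrite /c addr_gt0// invr_gt0.
    have c2 n : 0 <= c * (e n * e n).
      by apply: mulr_ge0; [exact: ltW | rewrite -expr2 sqr_ge0].
    apply/(cvg0P (fun n => c2 _)) => x x0.
    have [N hN] := iffRL (cvg0P c2) ee _ x0.
    by exists N => n hn; apply: hN; apply: leqW; exact: leq_trans hn (leq_addl _ _).
  (* N is positive and at least K and d, so neither the first K coefficients nor those of the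
     polynomial p are affected by aliasing modulo N. *)
  apply: le_cvg0 ee => n; set N := (K + d + n).+1.
  have [w hw] := @prim_root_exists R N isT.
  have wn := prim_root_norm hw.
  have KN : (K <= N)%N by rewrite /N ltnW// ltnS -addnA leq_addr.
  have dN : (d <= N)%N by rewrite /N ltnW// ltnS addnAC leq_addl.
  have par (u : nat -> R[i]) : N%:R * G r N u =
      \sum_(k < N) Normc.normc (\sum_(i < N) u i * (r%:C%C * w ^+ k) ^+ i) ^+ 2.
    have := parseval_root (fun i => u i * r%:C%C ^+ i) hw => /esym.
    rewrite (eq_bigr (fun i : 'I_N => Normc.normc (u i) ^+ 2 * (r ^+ 2) ^+ i)) => [->|i _].
      apply: eq_bigr => k _; congr (Normc.normc _ ^+ 2); apply: eq_bigr => i _.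
      by rewrite exprMn mulrA.
    by rewrite Normc.normcM normcX normc_real ger0_norm// exprMn -!exprM mulnC.
  have Gmono : G r K a <= G r N a.
    rewrite /G -(subnKC KN) big_split_ord /= lerDl sumr_ge0// => i _.
    by apply: mulr_ge0; [exact: sqr_ge0 | apply: exprn_ge0; exact: sqr_ge0].
  apply: (le_trans Gmono).
  have N0 : 0 < (N%:R : R) by rewrite ltr0n.
  rewrite -(ler_pM2l N0) par.
  pose q i : R[i] := if (i < d)%N then p i else 0.
  have q0 i : q (d + i)%N = 0 by rewrite /q ltnNge leq_addr.
  have qE (x : R[i]) : \sum_(i < N) q i * x ^+ i = \sum_(i < d) p i * x ^+ i.
    rewrite -(subnKC dN) big_split_ord /= [X in _ + X]big1 ?addr0.
      by apply: eq_bigr => i _; rewrite /q ltn_ord.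
    by move=> i _; rewrite q0 mul0r.
  have Gq : G r N q <= S.
    rewrite /G -(subnKC dN) big_split_ord /= [X in _ + X]big1 ?addr0 /S.
      apply: ler_sum => i _; rewrite /q ltn_ord ler_piMr ?sqr_ge0//.
      by rewrite exprn_ile1// ?sqr_ge0// exprn_ile1// ltW.
    by move=> i _; rewrite q0 Normc.normc0 expr0n mul0r.
  apply: (@le_trans _ _ (\sum_(k < N) ((1 + h) *
      Normc.normc (\sum_(i < N) q i * (r%:C%C * w ^+ k) ^+ i) ^+ 2 + c * (e N * e N)))).
    apply: ler_sum => k _.
    have zr : Normc.normc (r%:C%C * w ^+ k) = r.
      by rewrite Normc.normcM normcX wn expr1n mulr1 normc_real ger0_norm.
    have [|z hz] := in_disc (_ : Normc.normc (r%:C%C * w ^+ k) < 1); first by rewrite zr.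
    rewrite -hz qE; set s := \sum_(i < N) _.
    have -> : s = f z + (s - f z) by ring.
    apply: le_trans (normc_sqrD _ _ h0) _; rewrite lerD//.
      rewrite ler_wpM2l ?ler_pXn2r ?nnegrE ?normc_ge0//.
      by rewrite addr_ge0// ltW.
    rewrite -expr2 ler_wpM2l ?addr_ge0 ?invr_ge0 ?(ltW h0)//.
    have hes : Normc.normc (s - f z) <= e N by apply: he; rewrite hz zr.
    by rewrite ler_pXn2r ?nnegrE ?normc_ge0//; exact: le_trans (normc_ge0 _) hes.
  rewrite big_split /= -mulr_sumr -par sumr_const card_ord -(mulr_natl (c * _) N) mulrDr.
  rewrite lerD2r mulrCA ler_pM2l// ler_wpM2l//.
  by rewrite addr_ge0// ltW.
have S0 : 0 <= S by rewrite sumr_ge0// => i _; exact: sqr_ge0.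
have step2 (r : R) : 0 <= r < 1 -> G r K a <= S.
  move=> r01; apply/ler_addgt0Pr => x x0.
  have h0 : 0 < x / (S + 1) by rewrite divr_gt0// ltr_wpDl.
  have := step1 r _ r01 h0; rewrite mulrDl mul1r => hx; apply: le_trans hx _.
  by rewrite lerD2l mulrAC ler_pdivrMr ?ler_pM2l ?lerDl// ltr_wpDl.
pose T := \sum_(i < K) Normc.normc (a i) ^+ 2; rewrite -/T.
have T0 : 0 <= T by rewrite sumr_ge0// => i _; exact: sqr_ge0.
pose r (n : nat) : R := 1 - harmonic n.
have r01 n : 0 <= r n < 1.
  rewrite /r subr_ge0 gtrBl harmonic_gt0 andbT /harmonic /=.
  by rewrite invf_le1// ler1n.
have rK n : T * (r n ^+ 2) ^+ K <= S.
  apply: le_trans (step2 _ (r01 n)); rewrite /G mulr_suml.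
  apply: ler_sum => i _; rewrite ler_wpM2l ?sqr_ge0//.
  case/andP: (r01 n) => h1 h2; apply: ler_wiXn2l.
  - exact: sqr_ge0.
  - by apply: exprn_ile1 => //; exact: ltW.
  - exact: ltnW (ltn_ord i).
have cr : (fun n => T * (r n ^+ 2) ^+ K) @ \oo --> T * (1 ^+ 2) ^+ K.
  have r1 : r @ \oo --> (1 : R).
    rewrite -[X in _ --> X](subr0 1); apply: cvgB; first exact: cvg_cst.
    exact: cvg_harmonic.
  apply: cvgMr.
  rewrite (_ : (fun n => _) = (fun n => r n ^+ (2 * K))); last first.
    by apply/funext => j; rewrite exprM.
  rewrite -exprM; elim: (2 * K)%N => [|m ih].
    by rewrite expr0; under eq_fun do rewrite expr0; exact: cvg_cst.
  by rewrite exprS; under eq_fun do rewrite exprS; exact: cvgM.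
rewrite !expr1n mulr1 in cr.
apply: (@le_cvg0 _ _ _ (fun n => T - T * (r n ^+ 2) ^+ K)) => [n|].
  by have := rK n; lra.
by rewrite -[X in _ --> X](subrr T); apply: cvgB => //; exact: cvg_cst.
Qed.

(** The difference of the two expansions represents the zero function, which [parseval_le] compares
    with the empty polynomial. *)
Lemma taylor_unique f a b : taylor_expansion f a -> taylor_expansion f b -> a = b.
Proof.
move=> ha hb; apply/funext => n.
have h := taylor_lin (c := -1) hb ha.
have f0 z : Normc.normc ((-1 *: f + f) z) <=
    Normc.normc (\sum_(i < 0) (0 : R[i]) * val z ^+ i).
  have -> : -1 *: f + f = 0 by rewrite scaleN1r addNr.
  by rewrite big_ord0.
have := @parseval_le _ _ (fun=> 0) 0 h f0 n.+1; rewrite big_ord0 big_ord_recr/= => hn.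
have : Normc.normc (-1 * b n + a n) ^+ 2 = 0.
  apply/eqP; rewrite eq_le sqr_ge0 andbT; apply: le_trans hn.
  by rewrite lerDr sumr_ge0// => i _; exact: sqr_ge0.
move/eqP; rewrite sqrf_eq0 => /eqP/Normc.eq0_normc/eqP.
by rewrite mulN1r addrC subr_eq0 => /eqP.
Qed.

Lemma taylorE f a : taylor_expansion f a -> taylor f = a.
Proof.
move=> fa; apply: (@taylor_unique f) => //.
exact: (@xgetPex _ (fun=> 0) [set a | taylor_expansion f a] (ex_intro _ a fa)).
Qed.

Lemma taylor_analytic f : analytic_on_disc f -> taylor_expansion f (taylor f).
Proof. by move=> [a fa]; rewrite (taylorE fa). Qed.

End Taylor.

(** * The Hardy space *)

Section Hardy2.
Context {R : realType}.
Implicit Types (f g : disc R -> R[i]) (a b : nat -> R[i]) (z : disc R).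
Local Notation H2 := (@hardy2 R).

Definition l2_le a (M : R) := forall n, \sum_(i < n) Normc.normc (a i) ^+ 2 <= M.

Lemma l2_cvgP a :
  (exists M, l2_le a M) <-> cvgn (series (fun n => Normc.normc (a n) ^+ 2 : R)).
Proof.
split=> [[M hM]|h].
  by apply: bounded_series_cvg hM => n; exact: sqr_ge0.
exists (limn (series (fun n => Normc.normc (a n) ^+ 2 : R))) => n.
have h0 i : 0 <= Normc.normc (a i) ^+ 2 by exact: sqr_ge0.
exact: (@partial_sum_le_lim R (fun n => Normc.normc (a n) ^+ 2) h0 h n).
Qed.

(** The error term is linear in |y - t|, so y may tend to t while x stays fixed; this is the limit
    passage in the completeness proof. *)
Lemma normc_sqr_sub (x y t : R[i]) : Normc.normc (x - t) ^+ 2 <=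
  Normc.normc (x - y) ^+ 2 + 2 * (Normc.normc (x - t) * Normc.normc (y - t)).
Proof.
have -> : x - y = (x - t) - (y - t) by rewrite opprB subrKA.
move: (x - t) (y - t) => {}x {}y.
have := le_normcD (x - y) y; rewrite subrK.
have := normc_ge0 (x - y); have := normc_ge0 x; have := normc_ge0 y.
move: (Normc.normc x : R) (Normc.normc y : R) (Normc.normc (x - y) : R).
move=> p q r q0 p0 r0 h; have [pq|qp] := lerP p q; first by nra.
have : (p - q) * (p - q) <= r * r by apply: ler_pM; lra.
by nra.
Qed.

Lemma hardyP f : carrier H2 f <->
  analytic_on_disc f /\ exists M, l2_le (taylor f) M.
Proof. by split=> -[fa h]; split=> //; apply/l2_cvgP. Qed.

Lemma l2_lin a b (c : R[i]) M N : l2_le a M -> l2_le b N ->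
  exists M', l2_le (fun n => c * a n + b n) M'.
Proof.
move=> ha hb; exists (2 * Normc.normc c ^+ 2 * M + 2 * N) => n.
apply: (@le_trans _ _ (\sum_(i < n) (2 * Normc.normc c ^+ 2 * Normc.normc (a i) ^+ 2 +
   2 * Normc.normc (b i) ^+ 2))).
  apply: ler_sum => i _; have := @normc_sqrD R (c * a i) (b i) 1 ltr01.
  by rewrite invr1 Normc.normcM exprMn -[1 + 1]/(2 : R); lra.
rewrite big_split /= -!mulr_sumr lerD// ler_wpM2l ?ha ?hb//.
by rewrite mulr_ge0 ?sqr_ge0.
Qed.

Lemma l2_ip a b M N : l2_le a M -> l2_le b N ->
  exists s, csum (fun n => a n * (b n)^*) s.
Proof.
move=> ha hb; apply: (@csum_exists _ _ (M + N)) => n.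
apply: le_trans (lerD (ha n) (hb n)); rewrite -big_split /=.
apply: ler_sum => i _; rewrite Normc.normcM normcJr.
by have := normc_ge0 (a i); have := normc_ge0 (b i); nra.
Qed.

Lemma l2_pow z : exists M, l2_le (fun n => (val z ^+ n)^*) M.
Proof.
exists (1 - Normc.normc (val z) ^+ 2)^-1 => n.
have h : 0 <= Normc.normc (val z) ^+ 2 < 1.
  by rewrite sqr_ge0 exprn_ilt1 ?normc_ge0 ?disc_norm.
apply: le_trans (geo_sum n h); apply: ler_sum => i _.
by rewrite normcJr normcX -!exprM mulnC.
Qed.

Lemma l2_function a M : l2_le a M -> exists f, taylor_expansion f a.
Proof.
move=> ha; have /choice[f hf] : forall z, exists s, csum (fun n => a n * val z ^+ n) s.
  move=> z; have [N hN] := l2_pow z; have [s hs] := l2_ip ha hN; exists s.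
  by apply: csum_ext hs => n; rewrite conjCK.
by exists f; apply/taylorP.
Qed.

Lemma l2_hardy a M : l2_le a M -> exists2 f, carrier H2 f & taylor f = a.
Proof.
move=> ha; have [f hf] := l2_function ha; have e := taylorE hf.
exists f => //; apply/hardyP; split; first by exists a.
by rewrite e; exists M.
Qed.

Lemma hardy_taylor f : carrier H2 f -> taylor_expansion f (taylor f).
Proof. by case=> fa _; exact: taylor_analytic. Qed.

Lemma taylor_linE f g (c : R[i]) : carrier H2 f -> carrier H2 g ->
  taylor (c *: f + g) = (fun n => c * taylor f n + taylor g n).
Proof.
by move=> /hardy_taylor hf /hardy_taylor hg; apply: taylorE; exact: taylor_lin.
Qed.

Lemma taylorB f g : carrier H2 f -> carrier H2 g ->
  taylor (f - g) = (fun n => taylor f n - taylor g n).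
Proof.
move=> hf hg; rewrite (_ : f - g = -1 *: g + f); last by rewrite scaleN1r addrC.
by rewrite taylor_linE//; apply/funext => i; rewrite mulN1r addrC.
Qed.

Lemma hardy_ipP f g : carrier H2 f -> carrier H2 g ->
  csum (fun n => taylor f n * (taylor g n)^*) (ip H2 f g).
Proof.
move=> /hardyP[_ [M hM]] /hardyP[_ [N hN]]; have [s hs] := l2_ip hM hN.
suff -> : ip H2 f g = s by [].
by apply: (cvg_lim _ ((csumP _ _).2 hs)); exact: norm_hausdorff.
Qed.

Lemma hardy_ip_unique f g s : carrier H2 f -> carrier H2 g ->
  csum (fun n => taylor f n * (taylor g n)^*) s -> ip H2 f g = s.
Proof. by move=> hf hg; exact: csum_unique (hardy_ipP hf hg). Qed.

Lemma csum_conj a s : csum a s -> csum (fun n => (a n)^*) s^*.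
Proof.
move=> h; apply: cvg0_le h => n; rewrite normc_ge0/=.
by rewrite -(conj_sum _ a) -conjN -conjD normcJr.
Qed.

Lemma csum_normc2 a s : csum (fun n => a n * (a n)^*) s ->
  (forall n, \sum_(i < n) Normc.normc (a i) ^+ 2 <= complex.Re s) /\
  0 <= s.
Proof.
move=> hs; pose S n := \sum_(i < n) Normc.normc (a i) ^+ 2.
have SE n : \sum_(i < n) a i * (a i)^* = (S n)%:C%C.
  rewrite /S (rmorph_sum (real_complex R)); apply: eq_bigr => i _.
  exact: mulcJ.
have Smono n m : S n <= S (n + m)%N.
  by rewrite /S big_split_ord /= lerDl sumr_ge0// => i _; exact: sqr_ge0.
have h0 := iffRL (cvg0P (fun n => normc_ge0 _)) hs.
have hRe n : S n <= complex.Re s.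
  apply/ler_addgt0Pr => e e0; have [N hN] := h0 e e0.
  have := hN (n + N)%N (leq_addl _ _); rewrite SE => h1.
  have := normcRe ((S (n + N)%N)%:C%C - s); rewrite cReB /= => h2.
  have := Smono n N; lra.
split=> //; rewrite lecE; apply/andP; split; last first.
  by have := hRe 0%N; rewrite /S big_ord0.
rewrite -normr_eq0 eq_le normr_ge0 andbT; apply/ler_addgt0Pr => e e0.
have [N hN] := h0 e e0; rewrite add0r ltW//; apply: le_lt_trans (hN N (leqnn _)).
rewrite SE; apply: le_trans (normr_Im _); rewrite -normrN.
by case: (s) => x y /=; rewrite add0r.
Qed.

Lemma hardy_nsq_le f n : carrier H2 f ->
  \sum_(i < n) Normc.normc (taylor f i) ^+ 2 <= nsq H2 f.
Proof. by move=> hf; case: (csum_normc2 (hardy_ipP hf hf)) => h _; exact: h. Qed.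

Lemma hardy_nsq_ub f M : carrier H2 f -> l2_le (taylor f) M -> nsq H2 f <= M.
Proof.
move=> hf hM; apply: le_trans (normcRe _) _.
apply: csum_le (hardy_ipP hf hf) => n.
apply: le_trans (normc_sum n (fun i => taylor f i * (taylor f i)^*)) _.
apply: le_trans (hM n); apply: ler_sum => i _.
by rewrite Normc.normcM normcJr expr2.
Qed.

Lemma taylor_eq0 f : carrier H2 f -> (forall n, taylor f n = 0) -> f = 0.
Proof.
move=> hf h; have /taylorP ht := hardy_taylor hf.
apply/funext => z; apply: (csum_unique (ht z)).
have := @csum_finite R (fun n => taylor f n * val z ^+ n) 0; rewrite big_ord0.
by apply=> n _; rewrite h mul0r.
Qed.

Lemma taylor_inj f g : carrier H2 f -> carrier H2 g ->
  taylor f = taylor g -> f = g.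
Proof.
move=> /hardy_taylor/taylorP hf /hardy_taylor/taylorP hg e.
by apply/funext => z; apply: (csum_unique (hf z)); rewrite e; exact: hg.
Qed.

Lemma hardy_prehilbert : prehilbert H2.
Proof.
have lin (c : R[i]) f g : carrier H2 f -> carrier H2 g -> carrier H2 (c *: f + g).
  move=> hf hg; apply/hardyP; rewrite taylor_linE//.
  case/hardyP: (hf) => fa [M hM]; case/hardyP: (hg) => ga [N hN]; split.
    by eexists; apply: taylor_lin; exact: taylor_analytic.
  exact: (l2_lin c hM hN).
split=> //.
- have [|f hf h] := @l2_hardy (fun=> 0) 0.
    move=> n; rewrite big1// => i _.
    by rewrite Normc.normc0 expr0n.
  suff <- : f = 0 by [].
  by apply: taylor_eq0 => // n; rewrite h.
- move=> c f g h hf hg hh; apply: (hardy_ip_unique (lin c _ _ hf hg) hh).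
  rewrite taylor_linE//.
  apply: csum_ext (csum_lin c (hardy_ipP hf hh) (hardy_ipP hg hh)) => n.
  by rewrite mulrDl mulrA.
- move=> f g hf hg; apply: (hardy_ip_unique hf hg).
  by apply: csum_ext (csum_conj (hardy_ipP hg hf)) => n; rewrite conjM conjCK mulrC.
- by move=> f hf; case: (csum_normc2 (hardy_ipP hf hf)).
- move=> f hf h; apply: taylor_eq0 => // n.
  have := hardy_nsq_le n.+1 hf; rewrite /nsq h big_ord_recr /= => h1.
  apply: Normc.eq0_normc; apply/eqP; rewrite -sqrf_eq0 eq_le sqr_ge0 andbT.
  apply: le_trans h1; rewrite lerDr sumr_ge0// => i _; exact: sqr_ge0.
Qed.

(** Completeness of l^2: the coefficients converge one by one, and the Cauchy estimate on finitely
    many coefficients survives the limit in one of its two indices, uniformly in their number. *)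
Lemma hardy_hilbert : hilbert H2.
Proof.
have hH := hardy_prehilbert; split=> // u hu cu.
have uB m n : taylor (u m - u n) = (fun i => taylor (u m) i - taylor (u n) i).
  exact: taylorB.
have /choice[a ha] : forall i, exists s,
    (fun n => Normc.normc (taylor (u n) i - s)) @ \oo --> (0 : R).
  move=> i; apply: ccauchy_cvg => e e0.
  have [|N hN] := cu (e ^+ 2); first by rewrite exprn_gt0.
  exists N => m n hm hn; have := hN m n hm hn.
  have h1 := hardy_nsq_le i.+1 (carrierB hH (hu m) (hu n)).
  move=> h2; have {h1 h2} := le_lt_trans h1 h2; rewrite big_ord_recr uB /= => h.
  rewrite -(@ltr_pXn2r _ 2) ?nnegrE ?normc_ge0 ?ltW//; apply: le_lt_trans h.
  by rewrite lerDr sumr_ge0// => j _; exact: sqr_ge0.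
have key e : 0 < e -> exists N, forall n, (N <= n)%N ->
    l2_le (fun i => taylor (u n) i - a i) e.
  move=> e0; have [N hN] := cu e e0; exists N => n hn K.
  have lim : (fun m => \sum_(i < K) 2 * (Normc.normc (taylor (u n) i - a i) *
      Normc.normc (taylor (u m) i - a i))) @ \oo --> (0 : R).
    elim: K => [|K ih]; first by under eq_fun do rewrite big_ord0; exact: cvg_cst.
    by under eq_fun do rewrite big_ord_recr /=; apply: cvg0D => //; do 2!apply: cvg0Z.
  have {}lim : (fun m => \sum_(i < K) 2 * (Normc.normc (taylor (u n) i - a i) *
      Normc.normc (taylor (u (N + m)%N) i - a i))) @ \oo --> (0 : R).
    have t0 m : 0 <= \sum_(i < K) 2 * (Normc.normc (taylor (u n) i - a i) *
        Normc.normc (taylor (u m) i - a i)).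
      by rewrite sumr_ge0// => i _; rewrite !mulr_ge0 ?normc_ge0.
    apply/(cvg0P (fun m => t0 _)) => x x0.
    have [M hM] := iffRL (cvg0P t0) lim x x0.
    by exists M => m hm; apply: hM; exact: leq_trans hm (leq_addl _ _).
  apply: le_cvg0 lim => m.
  have h1 := hardy_nsq_le K (carrierB hH (hu n) (hu (N + m)%N)).
  have := le_trans h1 (ltW (hN n (N + m)%N hn (leq_addr _ _))).
  rewrite uB => h2.
  apply: (@le_trans _ _ (\sum_(i < K) (Normc.normc (taylor (u n) i -
     taylor (u (N + m)%N) i) ^+ 2 + 2 * (Normc.normc (taylor (u n) i - a i) *
     Normc.normc (taylor (u (N + m)%N) i - a i))))); last first.
    by rewrite big_split /= lerD2r.
  apply: ler_sum => i _.
  exact: normc_sqr_sub.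
have l2a : exists M, l2_le a M.
  have [N hN] := key 1 ltr01; have /hardyP[_ [M hM]] := hu N.
  have [M' hM'] := l2_lin (-1) (hN N (leqnn _)) hM.
  exists M' => K; apply: le_trans (hM' K); apply: ler_sum => i _.
  by rewrite mulN1r opprB subrK.
have [M hM] := l2a; have [f hf fa] := l2_hardy hM.
exists f => //; apply/(vcvgP hH hu hf)/(cvg0P (fun n => nsq_ge0 hH (carrierB hH (hu n) hf))).
move=> e e0; have e2 : 0 < e / 2 by rewrite divr_gt0.
have [N hN] := key _ e2; exists N => n hn.
apply: (@le_lt_trans _ _ (e / 2)); last by rewrite ltr_pdivrMr// ltr_pMr// ltr1n.
apply: (hardy_nsq_ub (carrierB hH (hu n) hf)).
rewrite (taylorB (hu n) hf) fa; exact: (hN n hn).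
Qed.

End Hardy2.

(** * Multipliers *)

#[local] Opaque hardy2 taylor.

Section Multipliers.
Context {R : realType}.
Implicit Types (f g : disc R -> R[i]) (a b : nat -> R[i]) (z : disc R).
Local Notation H2 := (@hardy2 R).
Let hH := @hardy_hilbert R.

Lemma hardy_intro f a M : taylor_expansion f a -> l2_le a M ->
  carrier H2 f /\ nsq H2 f <= M.
Proof.
move=> fa aM; have e := taylorE fa.
have hf : carrier H2 f.
  by apply/hardyP; split; [exists a | exists M; rewrite e].
by split=> //; apply: hardy_nsq_ub => //; rewrite e.
Qed.

(** The function with coefficients conj (z^n); through it, convergence in norm implies convergence
    at every point. *)
Lemma hardy_kernel z : exists2 k, carrier H2 k &
  forall f, carrier H2 f -> ip H2 f k = f z.
Proof.
have [M hM] := l2_pow z; have [k hk ek] := l2_hardy hM.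
exists k => // f hf; apply: (hardy_ip_unique hf hk).
have /taylorP h := hardy_taylor hf.
by apply: csum_ext (h z) => n; rewrite ek conjCK.
Qed.

Definition taylor_poly a n : disc R -> R[i] :=
  fun z => \sum_(i < n) a i * val z ^+ i.

Lemma taylor_cst (c : R[i]) : taylor_expansion (fun=> c) (fun n => c *+ (n == 0%N)).
Proof.
apply/taylorP => z.
have := @csum_finite _ (fun n => c *+ (n == 0%N) * val z ^+ n) 1.
rewrite big_ord1 expr0 mulr1; apply=> -[//|n] _.
by rewrite mulr0n mul0r.
Qed.

(** The product with a polynomial is a linear combination of iterated shifts of f, whose expansions
    are known. *)
Lemma taylor_ex_sum f a n : analytic_on_disc f ->
  analytic_on_disc (toeplitz f (taylor_poly a n)).
Proof.
move=> [b fb]; elim: n => [|n [c hc]].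
  have -> : toeplitz f (taylor_poly a 0) = (fun=> 0).
    by apply/funext => z; rewrite /toeplitz /taylor_poly big_ord0 mulr0.
  by eexists; exact: taylor_cst.
have [d hd] : analytic_on_disc (iter n (@mulz R) f).
  elim: n {c hc} => [|n [d hd]]; first by exists b.
  by exists (coef_shift d); exact: taylor_mulz.
suff -> : toeplitz f (taylor_poly a n.+1) =
    a n *: iter n (@mulz R) f + toeplitz f (taylor_poly a n).
  by eexists; exact: (taylor_lin (c := a n) hd hc).
apply/funext => z.
have e : iter n (@mulz R) f z = val z ^+ n * f z.
  elim: n {c hc d hd} => [|n ih]; first by rewrite expr0 mul1r.
  by rewrite iterS /mulz ih exprS mulrA.
rewrite /toeplitz /taylor_poly big_ord_recr /= mulrDr addrC.
by rewrite -[RHS]/(a n * iter n (@mulz R) f z + f z * \sum_(i < n) a i * val z ^+ i) e; ring.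
Qed.

Section Bounded.
Variables (phi : disc R -> R[i]) (M : R).
Hypothesis phia : analytic_on_disc phi.
Hypothesis phiM : forall z, Normc.normc (phi z) <= M.

Lemma multiplier_bound_ge0 : 0 <= M.
Proof.
have [|z _] := @in_disc R 0; first by rewrite Normc.normc0.
exact: le_trans (normc_ge0 _) (phiM z).
Qed.

Lemma mult_taylor_poly a n : carrier H2 (toeplitz phi (taylor_poly a n)) /\
  nsq H2 (toeplitz phi (taylor_poly a n)) <=
  M ^+ 2 * \sum_(i < n) Normc.normc (a i) ^+ 2.
Proof.
have M0 := multiplier_bound_ge0.
have [b hb] := taylor_ex_sum a n phia.
apply: (hardy_intro hb) => K.
have h z : Normc.normc (toeplitz phi (taylor_poly a n) z) <=
    Normc.normc (\sum_(i < n) (M%:C%C * a i) * val z ^+ i).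
  rewrite (eq_bigr (fun i : 'I_n => M%:C%C * (a i * val z ^+ i))); last first.
    by move=> i _; rewrite mulrA.
  rewrite -mulr_sumr !Normc.normcM normc_real ger0_norm//.
  by rewrite ler_wpM2r ?normc_ge0.
apply: le_trans (@parseval_le _ _ _ (fun i => M%:C%C * a i) n hb h K) _.
rewrite mulr_sumr; apply: ler_sum => i _.
by rewrite Normc.normcM normc_real ger0_norm// exprMn.
Qed.

Lemma taylor_poly_sub a n m : (n <= m)%N ->
  taylor_poly a m - taylor_poly a n =
  taylor_poly (fun i => if (i < n)%N then 0 else a i) m.
Proof.
move=> nm; apply/funext => z.
rewrite -[LHS]/(taylor_poly a m z - taylor_poly a n z) /taylor_poly.
rewrite -(subnKC nm) !big_split_ord /= addrAC subrr add0r.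
rewrite [X in _ = X + _]big1 ?add0r => [|i _]; last by rewrite ltn_ord mul0r.
by apply: eq_bigr => i _; rewrite ltnNge leq_addr.
Qed.

(* Truncate the Taylor series: on polynomials this is [parseval_le]. *)
Lemma multiplier f : carrier H2 f ->
  carrier H2 (toeplitz phi f) /\ nsq H2 (toeplitz phi f) <= M ^+ 2 * nsq H2 f.
Proof.
move=> hf; have M0 := multiplier_bound_ge0.
pose a := taylor f; pose u n := toeplitz phi (taylor_poly a n).
pose S n := \sum_(i < n) Normc.normc (a i) ^+ 2.
have hu n : carrier H2 (u n) := (mult_taylor_poly a n).1.
have Sf n : S n <= nsq H2 f by exact: hardy_nsq_le.
have [l [Sl hl]] : exists l : R, (forall n, S n <= l) /\
    (fun n => M ^+ 2 * (l - S n)) @ \oo --> (0 : R).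
  have h : cvgn (series (fun n => Normc.normc (a n) ^+ 2 : R)).
    by apply/l2_cvgP; exists (nsq H2 f).
  exists (limn (series (fun n => Normc.normc (a n) ^+ 2 : R))); split.
    by move=> n; apply: (partial_sum_le_lim _ h) => i; exact: sqr_ge0.
  apply: cvg0Z; apply: cvg0B.
  have -> : S = series (fun n => Normc.normc (a n) ^+ 2 : R).
    by apply/funext => n; rewrite /series /= big_mkord.
  exact: h.
have [y hy uy] : exists2 y, carrier H2 y & vcvg H2 u y.
  apply: (hilbert_complete hH) => // e e0.
  have l0 n : 0 <= M ^+ 2 * (l - S n) by rewrite mulr_ge0 ?sqr_ge0// subr_ge0.
  have [N hN] := iffRL (cvg0P l0) hl e e0.
  have key m n : (N <= n)%N -> (n <= m)%N -> nsq H2 (u m - u n) < e.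
    move=> hn hm; apply: le_lt_trans (hN n hn).
    have -> : u m - u n = toeplitz phi (taylor_poly (fun i => if (i < n)%N then 0 else a i) m).
      rewrite -taylor_poly_sub//; apply/funext => z.
      by rewrite -[LHS]/(phi z * taylor_poly a m z - phi z * taylor_poly a n z) -mulrBr.
    apply: le_trans (mult_taylor_poly _ _).2 _.
    rewrite ler_wpM2l ?sqr_ge0// lerBrDr; apply: le_trans (Sl m).
    rewrite /S -(subnKC hm) !big_split_ord /= [X in X + _ + _ <= _]big1 ?add0r; last first.
      by move=> i _; rewrite ltn_ord Normc.normc0 expr0n.
    rewrite addrC lerD2r; apply: ler_sum => i _.
    by rewrite ltnNge leq_addr.
  exists N => m n hm hn; case/orP: (leq_total n m); first exact: key.
  by rewrite (nsqBC hardy_prehilbert (hu m) (hu n)); exact: key.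
(* At each point z, [u n z] tends to [y z] by the reproducing kernel and to [phi z * f z] by the
   Taylor series of f. *)
have ey : y = toeplitz phi f.
  apply/funext => z; have [k hk ek] := hardy_kernel z.
  have h1 := vcvg_ip hardy_prehilbert hu hy hk uy.
  have /taylorP h2 := hardy_taylor hf.
  apply/eqP; rewrite -subr_eq0; apply/eqP/Normc.eq0_normc/eqP.
  rewrite eq_le normc_ge0 andbT.
  apply: le_cvg0 (cvg0D h1 (cvg0Z (Normc.normc (phi z)) (h2 z))) => n.
  rewrite add0r (ek _ (hu n)) (ek _ hy) -Normc.normcM.
  rewrite -(normc_opp (u n z - y z)) opprB.
  apply: le_trans (le_normcD _ _).
  by rewrite mulrBr -[u n z]/(phi z * taylor_poly a n z) subrKA.
rewrite -ey; split => //.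
have K0 : 0 <= M ^+ 2 * nsq H2 f.
  by rewrite mulr_ge0 ?sqr_ge0// (nsq_ge0 hardy_prehilbert hf).
have := @vcvg_nsq_le _ _ _ hardy_prehilbert u y (Num.sqrt (M ^+ 2 * nsq H2 f)) hu hy uy.
have Ey := ipnorm_le hardy_prehilbert hy (sqrtr_ge0 (M ^+ 2 * nsq H2 f)).
rewrite (sqr_sqrtr K0) in Ey.
move=> h; rewrite -Ey; apply: h => n.
rewrite (ipnorm_le hardy_prehilbert (hu n) (sqrtr_ge0 _)) (sqr_sqrtr K0).
apply: le_trans (mult_taylor_poly _ _).2 _; rewrite ler_wpM2l ?sqr_ge0//.
exact: Sf.
Qed.

End Bounded.
End Multipliers.

(** * The shift and the backward shift *)

Section Shift.
Context {R : realType}.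
Implicit Types (f g : disc R -> R[i]) (a b : nat -> R[i]) (z : disc R).
Local Notation H2 := (@hardy2 R).
Let hH := @hardy_hilbert R.
Let pH := @hardy_prehilbert R.

Lemma mulz_lin (c : R[i]) f g : mulz (c *: f + g) = c *: mulz f + mulz g.
Proof.
apply/funext => z.
by rewrite -[LHS]/(val z * (c * f z + g z)) -[RHS]/(c * (val z * f z) + val z * g z); ring.
Qed.

Lemma mulz_hardy f : carrier H2 f ->
  [/\ carrier H2 (mulz f), nsq H2 (mulz f) <= nsq H2 f &
      taylor (mulz f) = coef_shift (taylor f)].
Proof.
move=> hf; have h := taylor_mulz (hardy_taylor hf).
have hM : l2_le (coef_shift (taylor f)) (nsq H2 f).
  case=> [|n]; first by rewrite big_ord0 (nsq_ge0 pH hf).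
  rewrite big_ord_recl [coef_shift _ _]/= Normc.normc0 expr0n add0r.
  exact: (hardy_nsq_le n hf).
by have [h1 h2] := hardy_intro h hM; split=> //; exact: taylorE.
Qed.

Lemma mulz_carrier f : carrier H2 f -> carrier H2 (mulz f).
Proof. by case/mulz_hardy. Qed.

Lemma mulz_bounded : bounded_operator H2 (@mulz R).
Proof.
apply: (bounded_nsq pH) => [|c f g _ _|]; first exact: mulz_carrier.
  exact: mulz_lin.
by exists 1 => // f /mulz_hardy[_ h _]; rewrite mul1r.
Qed.

(** The function (f - f(0)) / z, specified by its coefficients so that the point z = 0 is not
    exceptional. *)
Definition bshift f : disc R -> R[i] :=
  xget 0 [set g | carrier H2 g /\ taylor g = (fun n => taylor f n.+1)].

Lemma bshift_tail f : carrier H2 f ->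
  l2_le (fun n => taylor f n.+1) (nsq H2 f).
Proof.
move=> hf n; apply: le_trans (hardy_nsq_le n.+1 hf).
by rewrite [leRHS]big_ord_recl lerDr sqr_ge0.
Qed.

Lemma bshiftP f : carrier H2 f ->
  carrier H2 (bshift f) /\ taylor (bshift f) = (fun n => taylor f n.+1).
Proof.
move=> hf; have [g hg eg] := l2_hardy (bshift_tail hf).
have h : exists g, carrier H2 g /\ taylor g = (fun n => taylor f n.+1) by exists g.
exact: (@xgetPex _ 0 [set g | carrier H2 g /\ taylor g = (fun n => taylor f n.+1)] h).
Qed.

#[local] Opaque bshift.

Lemma bshift_carrier f : carrier H2 f -> carrier H2 (bshift f).
Proof. by case/bshiftP. Qed.

Lemma taylor_bshift f n : carrier H2 f -> taylor (bshift f) n = taylor f n.+1.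
Proof. by case/bshiftP => _ ->. Qed.

Lemma bshift_bounded : bounded_operator H2 bshift.
Proof.
apply: (bounded_nsq pH) => [|c f g hf hg|]; first exact: bshift_carrier.
  have h1 := bshift_carrier hf; have h2 := bshift_carrier hg.
  apply: taylor_inj.
  - exact: bshift_carrier (carrier_lin pH c hf hg).
  - exact: (carrier_lin pH c h1 h2).
  apply: etrans (bshiftP (carrier_lin pH c hf hg)).2 _.
  apply: etrans _ (esym (taylor_linE c h1 h2)).
  apply/funext => n.
  have E1 := congr1 (fun u : nat -> R[i] => u n.+1) (taylor_linE c hf hg).
  apply: (etrans E1); congr (c * _ + _); apply: esym; exact: taylor_bshift.
exists 1 => // f hf; rewrite mul1r; apply: (hardy_nsq_ub (bshift_carrier hf)).
rewrite (bshiftP hf).2; exact: bshift_tail.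
Qed.

Lemma bshift_mulz f : carrier H2 f -> bshift (mulz f) = f.
Proof.
move=> hf; have [h1 _ h2] := mulz_hardy hf.
apply: (taylor_inj (bshift_carrier h1) hf); apply/funext => n.
by rewrite taylor_bshift// h2.
Qed.

Lemma mulz_adj f g : carrier H2 f -> carrier H2 g ->
  ip H2 (mulz f) g = ip H2 f (bshift g).
Proof.
move=> hf hg; have [h1 _ h2] := mulz_hardy hf; have [h3 h4] := bshiftP hg.
apply: (hardy_ip_unique h1 hg); rewrite h2.
have := hardy_ipP hf h3; rewrite h4 => h.
have := @csum_unshift _ (fun n => coef_shift (taylor f) n * (taylor g n)^*) _ h.
by rewrite [coef_shift _ 0]/= mul0r add0r.
Qed.

Definition cst1 : disc R -> R[i] := fun=> 1.

Lemma cst1_hardy : carrier H2 cst1 /\ taylor cst1 = (fun n => 1 *+ (n == 0%N)).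
Proof.
have h := @taylor_cst R 1.
split; last exact: taylorE.
have hM : l2_le (fun n => 1 *+ (n == 0%N) : R[i]) 1.
  case=> [|n]; first by rewrite big_ord0.
  rewrite big_ord_recl big1 ?addr0 => [|i _].
    by rewrite mulr1n Normc.normc1 expr1n.
  by rewrite mulr0n Normc.normc0 expr0n.
by case: (hardy_intro h hM).
Qed.

Lemma cst1_carrier : carrier H2 cst1.
Proof. by case: cst1_hardy. Qed.

Lemma ip_cst1 f : carrier H2 f -> ip H2 f cst1 = taylor f 0%N.
Proof.
move=> hf; have [h1 h2] := cst1_hardy; apply: (hardy_ip_unique hf h1); rewrite h2.
have := @csum_finite _ (fun n => taylor f n * (1 *+ (n == 0%N))^*) 1.
rewrite big_ord1 mulr1n conjC1 mulr1; apply=> -[//|n] _.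
by rewrite mulr0n conjC0 mulr0.
Qed.

Lemma ip_cst1_cst1 : ip H2 cst1 cst1 = 1.
Proof. by rewrite (ip_cst1 cst1_carrier) (cst1_hardy).2. Qed.

Lemma bshiftK f : carrier H2 f -> ip H2 f cst1 *: cst1 + mulz (bshift f) = f.
Proof.
move=> hf; have h1 := bshift_carrier hf; have h2 := mulz_carrier h1.
apply: (taylor_inj (carrier_lin pH _ cst1_carrier h2) hf).
rewrite (taylor_linE _ cst1_carrier h2) (ip_cst1 hf) (cst1_hardy).2.
have [_ _ ->] := mulz_hardy h1; apply/funext => -[|n].
  by rewrite mulr1n mulr1 addr0.
by rewrite mulr0n mulr0 add0r [LHS]/= taylor_bshift.
Qed.

Lemma toeplitz_bounded (phi : disc R -> R[i]) (M : R) : analytic_on_disc phi ->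
  (forall z, Normc.normc (phi z) <= M) -> bounded_operator H2 (toeplitz phi).
Proof.
move=> ha hM; apply: (bounded_nsq pH) => [f hf|c f g _ _|].
- by case: (multiplier ha hM hf).
- apply/funext => z.
  rewrite -[LHS]/(phi z * (c * f z + g z)).
  by rewrite -[RHS]/(c * (phi z * f z) + phi z * g z); ring.
exists (M ^+ 2) => [|f hf]; first exact: sqr_ge0.
by case: (multiplier ha hM hf).
Qed.

Lemma toeplitz_mulz (phi : disc R -> R[i]) f :
  toeplitz phi (mulz f) = mulz (toeplitz phi f).
Proof. by apply/funext => z; rewrite /toeplitz /mulz mulrCA. Qed.

Lemma toeplitz_cst1 (phi : disc R -> R[i]) : toeplitz phi cst1 = phi.
Proof. by apply/funext => z; rewrite /toeplitz mulr1. Qed.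

Lemma taylor0_toeplitz (phi : disc R -> R[i]) f : analytic_on_disc phi ->
  carrier H2 f -> carrier H2 (toeplitz phi f) ->
  taylor (toeplitz phi f) 0%N = taylor phi 0%N * taylor f 0%N.
Proof.
move=> ha hf h; have [|z z0] := @in_disc R 0; first by rewrite Normc.normc0.
rewrite -(taylor_at0 (hardy_taylor h) z0) -(taylor_at0 (hardy_taylor hf) z0).
by rewrite -(taylor_at0 (taylor_analytic ha) z0).
Qed.

(** Writing g = g(0) + z (B g) expresses the coefficient of order i + 1 of phi g through that of
    order i of phi (B g). Up to the order m of phi at 0 only the leading coefficient of phi
    contributes. *)
Lemma taylor_toeplitz_low (phi : disc R -> R[i]) (M : R) m f :
  analytic_on_disc phi -> (forall z, Normc.normc (phi z) <= M) ->
  (forall i, (i < m)%N -> taylor phi i = 0) -> carrier H2 f ->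
  (forall i, (i < m)%N -> taylor (toeplitz phi f) i = 0) /\
  taylor (toeplitz phi f) m = taylor phi m * taylor f 0%N.
Proof.
move=> ha hM hm; have hT := toeplitz_bounded ha hM.
have rec g i : carrier H2 g -> taylor (toeplitz phi g) i.+1 =
    taylor g 0%N * taylor phi i.+1 + taylor (toeplitz phi (bshift g)) i.
  move=> hg; have hg' := bshift_carrier hg; have hz := mulz_carrier hg'.
  have h1 := bounded_carrier hT hg'; have [h2 _ h3] := mulz_hardy h1.
  have Hphi : carrier H2 phi.
    by rewrite -(toeplitz_cst1 phi); exact: bounded_carrier hT cst1_carrier.
  have e : toeplitz phi g = taylor g 0%N *: phi + mulz (toeplitz phi (bshift g)).
    rewrite -{1}(bshiftK hg) (ip_cst1 hg) (bounded_lin hT _ cst1_carrier hz).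
    by rewrite toeplitz_cst1 toeplitz_mulz.
  by rewrite e (taylor_linE _ Hphi h2) h3.
have low g i : carrier H2 g -> (i < m)%N -> taylor (toeplitz phi g) i = 0.
  elim: i g => [|i ih] g hg im.
    by rewrite (taylor0_toeplitz ha hg (bounded_carrier hT hg)) (hm _ im) mul0r.
  rewrite (rec _ _ hg) (hm _ im) mulr0 add0r; apply: ih; [exact: bshift_carrier | exact: ltnW].
move=> hf; split=> [i im|]; first exact: low.
case: m hm low => [|m] hm low.
  exact: (taylor0_toeplitz ha hf (bounded_carrier hT hf)).
by rewrite (rec _ _ hf) (low _ _ (bshift_carrier hf) (ltnSn m)) addr0 mulrC.
Qed.

Lemma taylor_neq0 (phi : disc R -> R[i]) : analytic_on_disc phi -> phi <> 0 ->
  exists m, taylor phi m <> 0 /\ forall i, (i < m)%N -> taylor phi i = 0.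
Proof.
move=> ha h.
have ex : exists m, taylor phi m != 0.
  apply: contrapT => h0; apply: h.
  have /taylorP h1 := taylor_analytic ha; apply/funext => z.
  apply: (csum_unique (h1 z)).
  have := @csum_finite R (fun n => taylor phi n * val z ^+ n) 0; rewrite big_ord0.
  apply=> n _; have [->|n0] := eqVneq (taylor phi n) 0; first by rewrite mul0r.
  by exfalso; apply: h0; exists n.
case: (ex_minnP ex) => m hm min.
exists m; split; [exact/eqP | move=> i im].
 apply/eqP; apply: contraLR im => h2.
by rewrite -leqNgt min.
Qed.

End Shift.

(** * Hyperexpansivity *)

Section Hyperexpansive.
#[local] Hint Extern 0 (carrier _ _) => in_carrier : core.
#[local] Hint Extern 0 (prehilbert _) => is_prehilbert : core.
Context {R : realType} {X : lmodType R[i]} (K : innerSpace X).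
Hypothesis hK : hilbert K.
Variables (S : X -> X).
Hypothesis hS : bounded_operator K S.
Implicit Types (x y : X) (q : nat -> R).

(** The difference (1 - E)^n q at 0, where E shifts sequences. For q i = |S^i x|^2 it is the
    quadratic form of the defect of order n. *)
Definition alt_diff n q : R := \sum_(i < n.+1) (-1) ^+ i * 'C(n, i)%:R * q i.

(** Pascal's rule, that is (1 - E)^(n+1) = (1 - E)^n - (1 - E)^n E. *)
Lemma alt_diffS n q :
  alt_diff n.+1 q = alt_diff n q - alt_diff n (fun i => q i.+1).
Proof.
have -> : alt_diff n q = \sum_(i < n.+2) (-1) ^+ i * 'C(n, i)%:R * q i.
  by rewrite [RHS]big_ord_recr /= bin_small// mulr0 mul0r addr0.
rewrite /alt_diff big_ord_recl [in RHS]big_ord_recl !bin0 -!addrA; congr (_ + _).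
rewrite -sumrB; apply: eq_bigr => i _.
by rewrite /bump /= ?add1n binS natrD exprS; ring.
Qed.

Lemma iter_carrier n x : carrier K x -> carrier K (iter n S x).
Proof. by move=> hx; elim: n => [|n ih] //=; exact: (bounded_carrier hS). Qed.

Lemma iter_adjoint n x y : carrier K x -> carrier K y ->
  ip K (iter n (adjoint K S) x) y = ip K x (iter n S y).
Proof.
move=> hx hy; have hSa := adjoint_bounded hK hS.
have hi m : carrier K (iter m (adjoint K S) x).
  by elim: m => [|m ih] //=; exact: (bounded_carrier hSa).
elim: n y hy => [//|n ih] y hy.
rewrite [iter n.+1 _ x]/= (adjointEr hK hS (hi n) hy) ih; last exact: (bounded_carrier hS).
by rewrite -iterSr.
Qed.

Lemma hyperexpansivity_defectE n x : carrier K x ->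
  ip K (hyperexpansivity_defect K S n x) x =
  (alt_diff n (fun i => nsq K (iter i S x)))%:C%C.
Proof.
move=> hx; have hSa := adjoint_bounded hK hS.
pose u i := ((-1) ^+ i * 'C(n, i)%:R : R[i]) *:
   iter i (adjoint K S) (iter i S x).
have hi m y : carrier K y -> carrier K (iter m (adjoint K S) y).
  by move=> hy; elim: m => [|m ih] //=; exact: (bounded_carrier hSa).
have hu i : carrier K (u i).
  by apply: (carrierZ hK); apply: hi; exact: iter_carrier.
rewrite -[hyperexpansivity_defect _ _ _ _]/(\sum_(i < n.+1) u i).
rewrite (ip_suml hK)// /alt_diff (rmorph_sum (real_complex R)) /=.
apply: eq_bigr => i _; have hix := iter_carrier i hx.
rewrite (ipZl hK _ (hi _ _ hix) hx) iter_adjoint// (ipxx hK)//.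
by rewrite !rmorphM /= rmorphXn /= rmorphN1 rmorph_nat.
Qed.

(** All that is retained of the shift on H(b): it expands squared norms by C times the rank-one form
    of w, and y is the image of w under its adjoint. *)
Variables (w y : X) (C : R).
Hypothesis Hw : carrier K w.
Hypothesis Hy : carrier K y.
Hypothesis C0 : 0 < C.
Hypothesis S_nsq : forall x, carrier K x ->
  nsq K (S x) = nsq K x + C * Normc.normc (ip K x w) ^+ 2.
Hypothesis S_w : forall x, carrier K x -> ip K (S x) w = ip K x y.

(* Only the defects of order two are used: they give [|<x, y>| <= |<x, w>|]. *)
Lemma hyperexpansive_eigen : completely_hyperexpansive K S ->
  exists kap, y = kap *: w.
Proof.
move=> [_ /(_ 2%N isT) h2].
have key x : carrier K x ->
    Normc.normc (ip K x y) ^+ 2 <= Normc.normc (ip K x w) ^+ 2.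
  move=> hx; have hSx : carrier K (S x) by [].
  have := h2 x hx; rewrite hyperexpansivity_defectE// lecE /= => /andP[_].
  rewrite /alt_diff !big_ord_recl big_ord0 /= /bump /= ?add1n /=.
  rewrite (S_nsq hSx) (S_nsq hx) (S_w hx).
  rewrite bin0 bin1 binn !expr0 expr1.
  set p := Normc.normc _ ^+ 2; set p' := Normc.normc _ ^+ 2 => h.
  have : C * (p' - p) <= 0 by lra.
  by rewrite pmulr_rle0// subr_le0.
have [w0|w0] := pselect (w = 0).
  exists 0; rewrite scale0r; apply: (ip_eq0 hK Hy).
  have := key y Hy; rewrite w0 (ip0r hK Hy) Normc.normc0 expr0n => h.
  apply: Normc.eq0_normc; apply/eqP; rewrite -sqrf_eq0 eq_le h.
  exact: sqr_ge0.
have nw := nsq_gt0 hK Hw w0.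
(* The coefficient of the projection of y onto w. The remainder y - kap w is orthogonal to w, hence
   by [key] to y, hence to itself. *)
pose kap := ip K y w / (nsq K w)%:C%C; exists kap.
have hx : carrier K (y - kap *: w) by [].
have xw : ip K (y - kap *: w) w = 0.
  rewrite (ipBl hK)// (ipZl hK)// (ipxx hK Hw) /kap divfK ?subrr//.
  by rewrite (fmorph_eq0 (real_complex R)) gt_eqF.
have xy : ip K (y - kap *: w) y = 0.
  have := key _ hx; rewrite xw Normc.normc0 expr0n => h.
  apply: Normc.eq0_normc; apply/eqP; rewrite -sqrf_eq0 eq_le h.
  exact: sqr_ge0.
apply/eqP; rewrite -subr_eq0; apply/eqP; apply: (ip_eq0 hK hx).
by rewrite (ipBr hK)// (ipZr hK)// xw xy mulr0 subrr.
Qed.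

(** Now <S x, w> = conj(kap) <x, w>, so each further difference multiplies the form |<x, w>|^2 by 1
    - |kap|^2. The first difference is -C |<x, w>|^2, whence the exponent n at order n + 1. *)
Lemma eigen_hyperexpansive kap : y = kap *: w -> Normc.normc kap <= 1 ->
  completely_hyperexpansive K S.
Proof.
move=> ey k1; split=> // n n0 x hx; rewrite hyperexpansivity_defectE// lecE /=.
rewrite eqxx /=; case: n n0 => // n _.
pose p := Normc.normc kap ^+ 2.
have p1 : p <= 1 by rewrite exprn_ile1 ?normc_ge0.
suff -> : alt_diff n.+1 (fun i => nsq K (iter i S x)) =
    - (C * (1 - p) ^+ n * Normc.normc (ip K x w) ^+ 2).
  rewrite oppr_le0; apply: mulr_ge0; last exact: sqr_ge0.
  by apply: mulr_ge0; [exact: ltW | rewrite exprn_ge0// subr_ge0].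
elim: n x hx => [|n ih] x hx.
  rewrite /alt_diff !big_ord_recl big_ord0 /= /bump /= S_nsq//.
  by rewrite bin0 bin1 !expr0 expr1; ring.
have hSx : carrier K (S x) by [].
rewrite alt_diffS ih//.
have -> : (fun i => nsq K (iter i.+1 S x)) = (fun i => nsq K (iter i S (S x))).
  by apply/funext => i; rewrite iterSr.
rewrite ih// S_w// ey (ipZr hK)// Normc.normcM exprMn normcJr -/p (exprS (1 - p)); ring.
Qed.

End Hyperexpansive.

(** * De Branges-Rovnyak spaces *)

(* [S], [B], [e] and [T] stand for the shift, the backward shift, the constant
   function 1 and the multiplication by [b = T e] on [H^2]. *)
Section DeBrangesRovnyak.
#[local] Hint Extern 0 (carrier _ _) => in_carrier : core.
#[local] Hint Extern 0 (prehilbert _) => is_prehilbert : core.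
Context {R : realType} {X : lmodType R[i]} (H : innerSpace X).
Hypothesis hH : hilbert H.
Variables (S B T : X -> X) (e : X).
Hypothesis hS : bounded_operator H S.
Hypothesis hB : bounded_operator H B.
Hypothesis hT : bounded_operator H T.
Hypothesis He : carrier H e.
Hypothesis BS : forall x, carrier H x -> B (S x) = x.
Hypothesis SB : forall x, carrier H x -> ip H x e *: e + S (B x) = x.
Hypothesis S_adj :
  forall x y, carrier H x -> carrier H y -> ip H (S x) y = ip H x (B y).
Hypothesis ee : ip H e e = 1.
Hypothesis TS : forall x, carrier H x -> T (S x) = S (T x).
Hypothesis T_contr : forall x, carrier H x -> nsq H (T x) <= nsq H x.

Let Tlin := bounded_lin hT.
Let Slin := bounded_lin hS.
Let Blin := bounded_lin hB.
Let hTa : bounded_operator H (adjoint H T) := adjoint_bounded hH hT.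

Local Notation Ta := (adjoint H T).
Local Notation Q := (psqrt H (fun f => f - T (Ta f))).
Local Notation K := (range_space H Q).

Lemma adjoint_contr g : carrier H g -> ipnorm H (Ta g) <= ipnorm H g.
Proof.
move=> hg; have h0 := ipnorm_ge0 H (Ta g).
have h1 : ipnorm H (T (Ta g)) <= ipnorm H (Ta g).
  by rewrite (ipnorm_le hH) ?ipnorm_ge0// (sqr_ipnorm hH)// T_contr.
have h2 : nsq H (Ta g) <= ipnorm H (Ta g) * ipnorm H g.
  rewrite /nsq -(adjointE hH hT)//; apply: le_trans (Re_ip hH _ _) _ => //.
  by rewrite ler_wpM2r ?ipnorm_ge0.
have [->|n0] := eqVneq (ipnorm H (Ta g)) 0; first exact: ipnorm_ge0.
by rewrite -(@ler_pM2l _ (ipnorm H (Ta g))) ?lt_def ?n0// -expr2 (sqr_ipnorm hH).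
Qed.

Lemma dbr_psqrt : is_psqrt H (fun f => f - T (Ta f)) Q.
Proof.
apply: (@psqrtP _ _ H hH (fun f => T (Ta f))) => [x hx|a x y hx hy|x hx|x y hx hy].
- by [].
- by rewrite (bounded_lin hTa)// Tlin.
- apply: le_trans (adjoint_contr hx).
  by rewrite (ipnorm_le hH) ?ipnorm_ge0// (sqr_ipnorm hH)// T_contr.
- by rewrite (adjointE hH hT)// -(adjointEr hH hT).
Qed.

Let hQ : bounded_operator H Q.
Proof. by case: dbr_psqrt. Qed.

Lemma dbr_QQ x : carrier H x -> Q (Q x) = x - T (Ta x).
Proof. by case: dbr_psqrt => _ _; exact. Qed.

Lemma dbr_sa x y : carrier H x -> carrier H y -> ip H (Q x) y = ip H x (Q y).
Proof. by case: dbr_psqrt => _ h _; exact: positive_selfadj. Qed.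

Lemma dbr_hilbert : hilbert K.
Proof. exact: (range_hilbert hH hQ dbr_sa). Qed.

Lemma dbr_nsqQ g : carrier H g -> nsq H (Q g) = nsq H g - nsq H (Ta g).
Proof.
move=> hg; rewrite /nsq -dbr_sa// dbr_QQ// (ipBl hH)// cReB.
by rewrite (adjointE hH hT).
Qed.

Lemma ip_SS x y : carrier H x -> carrier H y -> ip H (S x) (S y) = ip H x y.
Proof. by move=> hx hy; rewrite S_adj// BS. Qed.

Lemma B_e : B e = 0.
Proof.
have h := SB He; rewrite ee scale1r in h.
have /eqP : e + S (B e) - e = 0 by rewrite h subrr.
rewrite addrAC subrr add0r => /eqP h1.
by rewrite -(BS (_ : carrier H (B e)))// h1 (op0 hH Blin).
Qed.

Lemma ip_eS x : carrier H x -> ip H e (S x) = 0.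
Proof.
by move=> hx; rewrite (ipC hH)// S_adj// B_e (ip0r hH)// conj0.
Qed.

Definition dbr_b := T e.
Definition dbr_w := B (T e).
Local Notation b := dbr_b.
Local Notation w := dbr_w.

Let Hb : carrier H b.
Proof. by rewrite /b. Qed.

Let Hw : carrier H w.
Proof. by rewrite /w. Qed.

(** T commutes with S, so B [Ta] S = [Ta]: the two sides can only differ by a constant, and that
    constant is <S g, T e> = <g, w>. *)
Lemma adjT_S g : carrier H g -> Ta (S g) = ip H g w *: e + S (Ta g).
Proof.
move=> hg; rewrite -[LHS]SB//; congr (_ *: _ + S _).
  by rewrite (adjointEr hH hT)// S_adj.
apply: (eq_ip hH) => // z hz.
rewrite -S_adj// -(adjointE hH hT)// TS// ip_SS//; exact: adjointE.
Qed.

(** S is isometric, and the two terms of [adjT_S] are orthogonal, so only |[Ta] (S g)|^2 changes. By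
    duality this monotonicity makes H(b) invariant under the backward shift. *)
Lemma nsqQ_S g : carrier H g ->
  nsq H (Q (S g)) = nsq H (Q g) - Normc.normc (ip H g w) ^+ 2.
Proof.
move=> hg; rewrite !dbr_nsqQ// adjT_S// (nsqD hH)// (nsqZ hH)// (ipZl hH)//.
by rewrite ip_eS// mulr0 /= /nsq ip_SS// ip_SS// ee /=; ring.
Qed.

Lemma B_T f : carrier H f -> B (T f) = ip H f e *: w + T (B f).
Proof.
move=> hf; have h := SB hf; rewrite -{1}h.
by rewrite (opD Tlin)// (opZ hH Tlin)// TS// (opD Blin)// (opZ hH Blin)// BS.
Qed.

Lemma adjT_B g : carrier H g -> Ta (B g) = B (Ta g).
Proof.
move=> hg; apply: (eq_ip hH) => // z hz.
by rewrite -(adjointE hH hT)// -S_adj// -TS// (adjointE hH hT)// S_adj.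
Qed.

(** The commutator of B with 1 - T [Ta] has rank one. It is the source of the rank-one term in the
    adjoint of B in K. *)
Lemma B_QQ g : carrier H g -> B (Q (Q g)) = Q (Q (B g)) - ip H g b *: w.
Proof.
move=> hg; rewrite !dbr_QQ// (opB hH Blin)// B_T// adjT_B// opprD addrA addrAC.
by congr (_ - _ *: _); rewrite (adjointEr hH hT).
Qed.

Let KH x : carrier K x -> carrier H x.
Proof. exact: (range_carrier hQ). Qed.

(** Duality: <B x, g> = <x, S g>, and |Q (S g)| <= |Q g| by [nsqQ_S]. *)
Lemma dbr_B x : carrier K x -> carrier K (B x) /\ nsq K (B x) <= nsq K x.
Proof.
move=> hx; have hx' := KH hx; have h0 := nsq_ge0 dbr_hilbert hx.
apply: (range_mem hH hQ dbr_sa) => // g hg.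
have -> : ip H (B x) g = ip H x (S g).
  by rewrite (ipC hH)// -S_adj// -(ipC hH).
have hSg : carrier H (S g) by [].
apply: le_trans (range_le hH hQ dbr_sa hx hSg) _.
by rewrite ler_wpM2l// nsqQ_S// gerBl sqr_ge0.
Qed.

Lemma dbr_B_bounded : bounded_operator K B.
Proof.
apply: (bounded_nsq dbr_hilbert) => [x /dbr_B[]//|a x y hx hy|].
  by have := KH hx; have := KH hy => *; rewrite Blin.
by exists 1 => // x /dbr_B[]; rewrite mul1r.
Qed.

(** Put v = [Ta] g. Then |<b, g>| = |<v, e>|, and |g - T v|^2 >= 0 gives |Q g|^2 = |g|^2 - |v|^2 >=
    |v|^2 - |T v|^2 >= c |<v, e>|^2. So [range_mem] applies with M = 1 / c. *)
Lemma dbr_gap (c : R) : 0 < c ->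
  (forall v, carrier H v ->
     nsq H (T v) + c * Normc.normc (ip H v e) ^+ 2 <= nsq H v) ->
  carrier K b.
Proof.
move=> c0 gap; apply: proj1; apply: (range_mem hH hQ dbr_sa (M := c^-1)) => // [|g hg].
  by rewrite invr_ge0 ltW.
have hv : carrier H (Ta g) by [].
have -> : Normc.normc (ip H b g) = Normc.normc (ip H (Ta g) e).
  by rewrite /b (adjointE hH hT)// (ipC hH)// normcJr.
rewrite mulrC ler_pdivlMr// mulrC dbr_nsqQ//.
have := nsq_ge0 hH (_ : carrier H (g - T (Ta g))) => /(_ ltac:(in_carrier)).
rewrite (nsqB hH)//.
have -> : ip H g (T (Ta g)) = ip H (Ta g) (Ta g) by rewrite -(adjointEr hH hT).
rewrite -/(nsq H (Ta g)); have := gap _ hv; lra.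
Qed.

(** * The shift on H(b), once b belongs to H(b) *)

Hypothesis Kb : carrier K b.

Let Kw : carrier K w.
Proof. exact: (dbr_B Kb).1. Qed.

Let hK := dbr_hilbert.
Let hBa := adjoint_bounded hK dbr_B_bounded.

(** Both sides are tested against g in H, that is, against Q (Q g) in K, where [range_ipQQ] returns
    to products of H and [B_QQ] carries B across. *)
Lemma dbr_B_adj f : carrier K f -> adjoint K B f = S f - ip K f w *: b.
Proof.
move=> hf; have hf' := KH hf.
have hBf : carrier K (adjoint K B f) := bounded_carrier hBa hf.
have hBf' := KH hBf.
apply: (eq_ip hH) => // g hg.
have hQg : carrier K (Q (Q g)).
  by apply: carrier_range; apply: (bounded_carrier hQ).
have hQBg : carrier K (Q (Q (B g))).
  by apply: carrier_range; do ?apply: (bounded_carrier hQ).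
rewrite -(range_ipQQ hH hQ dbr_sa hg hBf).
rewrite -(adjointE hK dbr_B_bounded hQg hf) (B_QQ hg).
rewrite (ipBl hK hQBg (carrierZ hK _ Kw) hf) (ipZl hK _ Kw hf).
have hBg : carrier H (B g) by [].
rewrite (range_ipQQ hH hQ dbr_sa hBg hf) (ipBr hH)// (ipZr hH)//.
rewrite -(ipC hK Kw hf) [RHS]addrC mulrC [RHS]addrC; congr (_ - _).
by rewrite (ipC hH)// -S_adj// -(ipC hH).
Qed.

(** With A the adjoint of B in K and t = <f, w>, [dbr_B_adj] reads S f = A f + t b. Since B b = w,
    <A f, b> = t; since B S = 1, |A f|^2 = <f, B (A f)> = |f|^2 - |t|^2. *)
Lemma dbr_S f : carrier K f ->
  carrier K (S f) /\ nsq K (S f) =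
    nsq K f + (1 + nsq K b) * Normc.normc (ip K f w) ^+ 2.
Proof.
move=> hf; have hBf : carrier K (adjoint K B f) := bounded_carrier hBa hf.
set t := ip K f w.
have eS : S f = adjoint K B f + t *: b by rewrite (dbr_B_adj hf) subrK.
split; first by rewrite eS; apply: (carrierD hK) => //; exact: (carrierZ hK).
rewrite eS (nsqD hK hBf (carrierZ hK _ Kb)) (nsqZ hK _ Kb) (ipZr hK _ Kb hBf).
have -> : ip K (adjoint K B f) b = t.
  exact: (adjointEr hK dbr_B_bounded hf Kb).
have -> : nsq K (adjoint K B f) = nsq K f - Normc.normc t ^+ 2.
  rewrite /nsq (adjointEr hK dbr_B_bounded hf hBf) (dbr_B_adj hf).
  have hf' := KH hf.
  rewrite (opB hH Blin)// (opZ hH Blin)// BS//.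
  rewrite (ipBr hK hf (carrierZ hK _ Kw) hf) (ipZr hK _ Kw hf) cReB.
  by rewrite [_^* * _]mulrC mulcJ.
by rewrite [t^* * t]mulrC mulcJ /=; ring.
Qed.

Lemma dbr_S_w f : carrier K f ->
  ip K (S f) w = ip K f (B w + ip K w b *: w).
Proof.
move=> hf; have hBf : carrier K (adjoint K B f) := bounded_carrier hBa hf.
have eS : S f = adjoint K B f + ip K f w *: b by rewrite (dbr_B_adj hf) subrK.
have KBw : carrier K (B w) := (dbr_B Kw).1.
rewrite eS (ipDl hK hBf (carrierZ hK _ Kb) Kw) (ipZl hK _ Kb Kw).
rewrite (adjointEr hK dbr_B_bounded hf Kw).
rewrite (ipDr hK KBw (carrierZ hK _ Kw) hf) (ipZr hK _ Kw hf).
by rewrite -(ipC hK Kb Kw) mulrC.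
Qed.

Lemma dbr_S_bounded : bounded_operator K S.
Proof.
apply: (bounded_nsq hK) => [x /dbr_S[]//|a x y hx hy|].
  by have := KH hx; have := KH hy => *; rewrite Slin.
have C0 : 0 <= 1 + nsq K b by rewrite addr_ge0// (nsq_ge0 hK Kb).
exists (1 + (1 + nsq K b) * nsq K w) => [|x hx].
  by rewrite addr_ge0// mulr_ge0// (nsq_ge0 hK Kw).
have := ler_wpM2l C0 (cauchy_schwarz hK hx Kw).
rewrite (dbr_S hx).2; lra.
Qed.

Lemma dbr_hyperexpansive_eigen :
  completely_hyperexpansive K S -> exists mu, B w = mu *: w.
Proof.
move=> hyp; have C0 : 0 < 1 + nsq K b by rewrite ltr_wpDr// (nsq_ge0 hK Kb).
have Ky : carrier K (B w + ip K w b *: w).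
  exact: (carrierD hK (dbr_B Kw).1 (carrierZ hK _ Kw)).
have [kap ekap] := hyperexpansive_eigen hK dbr_S_bounded Kw Ky C0
  (fun x hx => (dbr_S hx).2) dbr_S_w hyp.
by exists (kap - ip K w b); rewrite scalerBl -ekap addrK.
Qed.

(* [P] stands for the multiplication by [1 / (1 - bet z)], so that
   [r *: P g + s *: S (P g)] is [a g] for the function [a] paired with [b]. *)
Section EigenvalueBound.
Variables (P : X -> X) (c gam bet r s : R[i]) (k : X).
Hypothesis HP : forall g, carrier H g -> carrier H (P g).
Hypothesis TP : forall g, carrier H g -> T g = c *: P g + gam *: S (P g).
Hypothesis T_mate : forall g, carrier H g ->
  nsq H (T g) + nsq H (r *: P g + s *: S (P g)) <= nsq H g.
Hypothesis r0 : r != 0.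
Hypothesis sr : Normc.normc s <= Normc.normc r.
Hypothesis bet1 : Normc.normc bet < 1.
Hypothesis Hk : carrier H k.
Hypothesis Bk : B k = bet *: k.

(* This is [T_b^* f = T_a^* u] after the cancellation of [P^*]. *)
Let mate_pair f u := [/\ carrier H f, carrier H u &
  c^* *: f + gam^* *: B f = r^* *: u + s^* *: B u].

(** Pairing the defining identity with [P g] restores the factor that was cancelled. *)
Lemma mate_pair_ip f u g : mate_pair f u -> carrier H g ->
  ip H f (T g) = ip H u (r *: P g + s *: S (P g)).
Proof.
move=> [hf hu e1] hg; have hPg := HP hg; rewrite (TP hg).
have adj x (hx : carrier H x) : ip H x (S (P g)) = ip H (B x) (P g).
  by rewrite (ipC hH)// S_adj// -(ipC hH).
have := congr1 (fun x => ip H x (P g)) e1.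
by rewrite !(ipDl hH)// !(ipZl hH)// !(ipDr hH)// !(ipZr hH)// !adj.
Qed.

(* With [v = T* g], [<f, g> = <f, g - T v> + <u, (r + s S) P v>], while
   [|Q g|^2 >= |g - T v|^2 + |(r + s S) P v|^2]. *)
Lemma mate_pair_dbr f u : mate_pair f u ->
  carrier K f /\ nsq K f <= nsq H f + nsq H u.
Proof.
move=> hfu; have [hf hu _] := hfu.
have f0 := nsq_ge0 hH hf; have u0 := nsq_ge0 hH hu.
apply: (range_mem hH hQ dbr_sa hf) => [|g hg]; first exact: addr_ge0.
have hv : carrier H (Ta g) by [].
have hPv := HP hv.
set v := Ta g in hv hPv *; pose x := g - T v; pose y := r *: P v + s *: S (P v).
have hx : carrier H x by rewrite /x.
have hy : carrier H y by rewrite /y.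
have hQg : nsq H x + nsq H y <= nsq H (Q g).
  rewrite (dbr_nsqQ hg) -/v.
  have := T_mate hv; rewrite -/y.
  have -> : nsq H x = nsq H g + nsq H (T v) - 2 * nsq H v.
    rewrite /x (nsqB hH)//; congr (_ - 2 * complex.Re _).
    by rewrite -(adjointEr hH hT).
  lra.
have -> : ip H f g = ip H f x + ip H u y.
  rewrite -(mate_pair_ip hfu hv) /x -(ipDr hH)//.
  by rewrite subrK.
apply: (@le_trans _ _ ((nsq H f + nsq H u) * (nsq H x + nsq H y))); last first.
  by rewrite ler_wpM2l// addr_ge0.
have h1 : Normc.normc (ip H f x + ip H u y) <=
    ipnorm H f * ipnorm H x + ipnorm H u * ipnorm H y.
  by apply: le_trans (le_normcD _ _) _; apply: lerD; exact: normc_ip.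
rewrite -!(sqr_ipnorm hH)//.
have := ipnorm_ge0 H f; have := ipnorm_ge0 H x.
have := ipnorm_ge0 H u; have := ipnorm_ge0 H y; have := normc_ge0 (ip H f x + ip H u y).
move: h1; set N : R := Normc.normc _.
set F : R := ipnorm H f; set G : R := ipnorm H x; set U : R := ipnorm H u.
set V : R := ipnorm H y => h1 N0 V0 U0 G0 F0.
apply: (@le_trans _ _ ((F * G + U * V) ^+ 2)).
  by rewrite !expr2; apply: ler_pM.
have := sqr_ge0 (F * V - U * G); lra.
Qed.

Let rbar0 : r^* != 0.
Proof. by rewrite fmorph_eq0. Qed.

(** Applying S to the relation between f and u gives the relation wanted for S f and S u except for
    its constant term; this constant, divided by conj r, restores the balance. *)
Definition mate_delta f u := (gam^* * ip H f e - s^* * ip H u e) / r^*.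

Lemma mate_pairS f u : mate_pair f u ->
  mate_pair (S f) (S u + mate_delta f u *: e).
Proof.
move=> [hf hu e1]; split=> //.
have hBf : carrier H (B f) by [].
have hBu : carrier H (B u) by [].
have hSu : carrier H (S u) by [].
have hde a : carrier H (a *: e) by [].
rewrite (opD Blin hSu (hde _)) (opZ hH Blin _ He) B_e scaler0 addr0 !BS//.
have e2 := congr1 S e1; move: e2.
rewrite !(opD Slin)// !(opZ hH Slin)// => e2.
have ef : f = ip H f e *: e + S (B f) by rewrite SB.
have eu : u = ip H u e *: e + S (B u) by rewrite SB.
have ea : gam^* * ip H f e = r^* * mate_delta f u + s^* * ip H u e.
  by rewrite /mate_delta [r^* * _]mulrC divfK// subrK.
have -> : gam^* *: f = (gam^* * ip H f e) *: e + gam^* *: S (B f).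
  by rewrite {1}ef scalerDr scalerA.
have -> : s^* *: u = (s^* * ip H u e) *: e + s^* *: S (B u).
  by rewrite {1}eu scalerDr scalerA.
rewrite addrCA e2 ea scalerDl scalerDr scalerA addrACA.
by rewrite [_ *: e + r^* *: S u]addrC.
Qed.

(** The partner of [iter n S k]. At n = 0 the relation is scalar because B k = bet k, and it
    determines the multiple of k. *)
Fixpoint mate_seq n : X := if n is m.+1
  then S (mate_seq m) + mate_delta (iter m S k) (mate_seq m) *: e
  else ((c^* + gam^* * bet) / (r^* + s^* * bet)) *: k.

Lemma mate_seqP n : mate_pair (iter n S k) (mate_seq n).
Proof.
elim: n => [|n ih]; last exact: mate_pairS.
(* Otherwise |r| = |s| |bet| <= |r| |bet| < |r|. *)
have h0 : r^* + s^* * bet != 0.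
  apply/eqP => /eqP; rewrite addr_eq0 => /eqP h.
  have : Normc.normc r <= Normc.normc r * Normc.normc bet.
    rewrite -[leLHS]normcJr h normc_opp Normc.normcM normcJr.
    by rewrite ler_wpM2r// normc_ge0.
  have : 0 < Normc.normc r.
    rewrite lt_def normc_ge0 andbT; apply: contra r0 => /eqP/Normc.eq0_normc ->//.
  by move=> rn; rewrite -[leLHS]mulr1 ler_pM2l// leNgt bet1.
split=> //=.
rewrite (opZ hH Blin _ Hk) Bk !scalerA -!scalerDl; congr (_ *: _).
by field.
Qed.

(** The correction d n e is orthogonal to the range of S, so a step adds exactly |d n|^2. As S^(n+1)
    k has no constant term, d (n+1) = -(conj s / conj r) d n, and the increments never exceed |d
    0|^2. *)
Lemma mate_seq_growth : exists E D, [/\ 0 <= E, 0 <= D &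
  forall n, nsq H (iter n S k) + nsq H (mate_seq n) <= E + n%:R * D].
Proof.
pose d n := mate_delta (iter n S k) (mate_seq n).
have Hm n : carrier H (mate_seq n) by case: (mate_seqP n).
have Hi n : carrier H (iter n S k) by case: (mate_seqP n).
have ui n : ip H (mate_seq n.+1) e = d n.
  rewrite [mate_seq _]/= (ipDl hH)// (ipZl hH)// ee mulr1.
  by rewrite (ipC hH)// ip_eS// conj0 add0r.
have dS n : Normc.normc (d n.+1) <= Normc.normc (d n).
  rewrite {1}/d /mate_delta ui iterS (ipC hH (_ : carrier H (S (iter n S k))) He)//.
  rewrite ip_eS// conj0 mulr0 sub0r; move: (d n) => x.
  rewrite Normc.normcM normc_opp Normc.normcM Normc.normcV.
  have rn : 0 < Normc.normc r.
    by rewrite lt_def normc_ge0 andbT; apply: contra r0 => /eqP/Normc.eq0_normc ->.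
  rewrite !normcJr mulrAC -[leRHS]mul1r; apply: ler_wpM2r; first exact: normc_ge0.
  by rewrite ler_pdivrMr// mul1r.
have d0 n : Normc.normc (d n) <= Normc.normc (d 0%N).
  by elim: n => [//|n ih]; exact: le_trans (dS n) ih.
exists (nsq H k + nsq H (mate_seq 0)), (Normc.normc (d 0%N) ^+ 2); split.
- by rewrite addr_ge0// (nsq_ge0 hH)//; exact: (Hm 0%N).
- exact: sqr_ge0.
elim=> [|n ih]; first by rewrite mul0r addr0.
have -> : nsq H (iter n.+1 S k) = nsq H (iter n S k) by rewrite iterS /nsq ip_SS.
have -> : nsq H (mate_seq n.+1) = nsq H (mate_seq n) + Normc.normc (d n) ^+ 2.
  rewrite [mate_seq _]/= (nsqD hH)// (nsqZ hH)// (ipZr hH)//.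
  rewrite (ipC hH (_ : carrier H (S (mate_seq n))) He)// ip_eS// conj0 mulr0.
  by rewrite /nsq ip_SS// ee /= mulr0 addr0 mulr1.
have : Normc.normc (d n) ^+ 2 <= Normc.normc (d 0%N) ^+ 2.
  by rewrite ler_pXn2r ?nnegrE ?normc_ge0.
rewrite mulrSr mulrDl mul1r; lra.
Qed.

(** Bernoulli's inequality alone gives linear growth; at the exponent 2 n its square gives (n t)^2
    with t = x - 1, against the bound E + 2 n D. *)
Lemma exp_linear_le1 (x E D : R) : 0 <= x -> 0 <= E -> 0 <= D ->
  (forall n, x ^+ n <= E + n%:R * D) -> x <= 1.
Proof.
move=> x0 E0 D0 h; rewrite leNgt; apply/negP => x1.
pose t := x - 1; have t0 : 0 < t by rewrite subr_gt0.
have bern n : 1 + n%:R * t <= x ^+ n.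
  elim: n => [|n ih]; first by rewrite mul0r addr0 expr0.
  rewrite exprS mulrSr; have n0 : 0 <= (n%:R : R) by [].
  have xE : x = 1 + t by rewrite /t; lra.
  have := ler_wpM2l x0 ih; rewrite {2}xE.
  have : 0 <= n%:R * t * t by rewrite -mulrA mulr_ge0// mulr_ge0// ltW.
  nra.
(* Chosen so that n t^2 > 2 D + E, and n >= 1 so that E <= n E. *)
pose n := (Num.bound ((2 * D + E) / t ^+ 2)).+1.
have n1 : 1 <= (n%:R : R) by rewrite ler1n.
have hn : 2 * D + E < n%:R * t ^+ 2.
  rewrite -ltr_pdivrMr ?exprn_gt0//; apply: (@lt_trans _ _ (Num.bound ((2 * D + E) / t ^+ 2))%:R).
    apply: archi_boundP; apply: divr_ge0; last exact: sqr_ge0.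
    by rewrite addr_ge0// mulr_ge0.
  by rewrite ltr_nat.
have h1 := bern n; have := h (n * 2)%N; rewrite exprM natrM => h2.
have h3 : (n%:R * t) ^+ 2 <= (x ^+ n) ^+ 2.
  rewrite ler_pXn2r ?nnegrE ?exprn_ge0 ?mulr_ge0 ?(ltW t0)//.
  by apply: le_trans h1; rewrite lerDr.
have : n%:R * (2 * D + E) < n%:R * (n%:R * t ^+ 2) by rewrite ltr_pM2l// (lt_le_trans ltr01).
have : E <= n%:R * E by rewrite ler_peMl.
have e1 : (n%:R * t) ^+ 2 = n%:R * (n%:R * t ^+ 2) by ring.
rewrite e1 in h3; lra.
Qed.

(** Cauchy-Schwarz in K bounds |kap|^(2 n) |<k, w>|^2 by |S^n k|^2 |w|^2, which is at most linear in
    n by [mate_pair_dbr] and [mate_seq_growth]. Since w is a nonzero multiple of k, <k, w> does not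
    vanish. *)
Lemma eigenvalue_le1 kap : w <> 0 -> (exists a, w = a *: k) ->
  B w + ip K w b *: w = kap *: w -> Normc.normc kap <= 1.
Proof.
move=> w0 [a wk] ekap.
have hKn n : carrier K (iter n S k) := (mate_pair_dbr (mate_seqP n)).1.
have Kk := hKn 0%N; rewrite /= in Kk.
have a0 : a != 0 by apply/eqP => a0; apply: w0; rewrite wk a0 scale0r.
have kw : ip K k w != 0.
  rewrite wk (ipZr hK _ Kk Kk) mulf_neq0 ?fmorph_eq0//.
  apply/eqP => /(ip_eq0 hK Kk) k0; apply: w0; rewrite wk k0 scaler0 //.
have ipn n : ip K (iter n S k) w = kap^* ^+ n * ip K k w.
  elim: n => [|n ih]; first by rewrite expr0 mul1r.
  rewrite iterS (dbr_S_w (hKn n)) ekap (ipZr hK _ Kw (hKn n)) ih exprS mulrA //.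
have [E [D [E0 D0 hED]]] := mate_seq_growth.
pose p := Normc.normc (ip K k w) ^+ 2.
have p0 : 0 < p.
  rewrite exprn_gt0// lt_def normc_ge0 andbT.
  by apply: contra kw => /eqP/Normc.eq0_normc ->.
have q0 : 0 <= nsq K w by exact: (nsq_ge0 hK Kw).
have h n : (Normc.normc kap ^+ 2) ^+ n <= E * nsq K w / p + n%:R * (D * nsq K w / p).
  have := cauchy_schwarz hK (hKn n) Kw.
  rewrite ipn Normc.normcM exprMn normcX normcJr -/p => h1.
  have h2 := le_trans h1 (ler_wpM2r q0 (mate_pair_dbr (mate_seqP n)).2).
  have h3 := le_trans h2 (ler_wpM2r q0 (hED n)).
  have -> : E * nsq K w / p + n%:R * (D * nsq K w / p) =
            (E + n%:R * D) * nsq K w / p by field; rewrite gt_eqF.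
  by rewrite ler_pdivlMr// exprAC.
have hq x : 0 <= x -> 0 <= x * nsq K w / p.
  by move=> x0; apply: divr_ge0; [exact: mulr_ge0 | exact: ltW].
have := exp_linear_le1 (sqr_ge0 _) (hq _ E0) (hq _ D0) h.
by rewrite expr_le1 ?normc_ge0.
Qed.

Lemma dbr_eigen_hyperexpansive :
  (exists a, w = a *: k) -> completely_hyperexpansive K S.
Proof.
move=> wk; have Bw : B w = bet *: w.
  have [a ->] := wk.
  by rewrite (opZ hH Blin _ Hk) Bk !scalerA mulrC.
have C0 : 0 < 1 + nsq K b by rewrite ltr_wpDr// (nsq_ge0 hK Kb).
have Ky : carrier K (B w + ip K w b *: w).
  exact: (carrierD hK (dbr_B Kw).1 (carrierZ hK _ Kw)).
have ey : B w + ip K w b *: w = (bet + ip K w b) *: w by rewrite Bw -scalerDl.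
(* When w = 0, that is for constant b, every number is an eigenvalue and 0 is chosen. *)
have [w0|w0] := pselect (w = 0).
  have ey0 : B w + ip K w b *: w = 0 *: w by rewrite ey w0 !scaler0.
  apply: (eigen_hyperexpansive hK dbr_S_bounded Kw C0 (fun x hx => (dbr_S hx).2)
    dbr_S_w ey0); by rewrite Normc.normc0.
apply: (eigen_hyperexpansive hK dbr_S_bounded Kw C0 (fun x hx => (dbr_S hx).2)
    dbr_S_w ey).
exact: eigenvalue_le1.
Qed.

End EigenvalueBound.

End DeBrangesRovnyak.

(** * Fejer-Riesz factorisation and nonextreme functions *)

Section FejerRiesz.
Context {R : realType}.
Implicit Types (z c gam bet : R[i]).

(** On the circle |r + s z|^2 = r^2 + |s|^2 + 2 Re (r s z). So r^2 and |s|^2 are the roots (A + q) /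
    2 and (A - q) / 2 of X^2 - A X + |D|^2; giving the larger one to r puts the zero of r + s z
    outside the open disc. *)
Lemma fejer_riesz (A : R) (D : R[i]) : 0 < A -> 2 * Normc.normc D <= A ->
  exists (r : R) (s : R[i]), [/\ 0 < r, r ^+ 2 + Normc.normc s ^+ 2 = A,
    r%:C%C * s = D & Normc.normc s <= r].
Proof.
move=> A0 DA; set d : R := Normc.normc D in DA *; have d0 : 0 <= d by exact: normc_ge0.
have disc0 : 0 <= A ^+ 2 - 4 * d ^+ 2 by nra.
pose q := Num.sqrt (A ^+ 2 - 4 * d ^+ 2).
have q0 : 0 <= q by exact: sqrtr_ge0.
have q2 : q ^+ 2 = A ^+ 2 - 4 * d ^+ 2 by exact: sqr_sqrtr.
pose r := Num.sqrt ((A + q) / 2).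
have Aq : 0 < (A + q) / 2 by lra.
have r0 : 0 < r by rewrite sqrtr_gt0.
have r2 : r ^+ 2 = (A + q) / 2 by rewrite sqr_sqrtr// ltW.
have rC : r%:C%C != 0 :> R[i] by rewrite (fmorph_eq0 (real_complex R)) gt_eqF.
exists r, (D / r%:C%C).
have ns : Normc.normc (D / r%:C%C) = d / r.
  by rewrite Normc.normcM Normc.normcV normc_real gtr0_norm.
have ds : d ^+ 2 = (A + q) / 2 * ((A - q) / 2).
  have -> : (A + q) / 2 * ((A - q) / 2) = (A ^+ 2 - q ^+ 2) / 4 by field.
  by rewrite q2; field.
have s2 : (d / r) ^+ 2 = (A - q) / 2.
  by rewrite expr_div_n r2 ds mulrAC divff ?mul1r// gt_eqF.
split=> //; first by rewrite ns s2 r2; field.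
  by rewrite mulrC divfK.
rewrite ns -(@ler_pXn2r _ 2) ?nnegrE ?divr_ge0 ?(ltW r0)// s2 r2.
lra.
Qed.

Lemma normc_sqrDE (x y : R[i]) : Normc.normc (x + y) ^+ 2 =
  Normc.normc x ^+ 2 + Normc.normc y ^+ 2 + 2 * complex.Re (x^* * y).
Proof.
rewrite !sqr_normcE; case: x => x1 x2; case: y => y1 y2 /=; ring.
Qed.

(* The inequality [|c + gam z| <= |1 - bet z|], pushed to the point of the unit
   circle where the trigonometric polynomial [|1 - bet z|^2 - |c + gam z|^2]
   is smallest. *)
Lemma unit_circle_bound c gam bet :
  (forall z, Normc.normc z < 1 ->
     Normc.normc (c + gam * z) <= Normc.normc (1 - bet * z)) ->
  2 * Normc.normc (bet + c^* * gam) <=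
  1 + Normc.normc bet ^+ 2 - Normc.normc c ^+ 2 - Normc.normc gam ^+ 2.
Proof.
move=> h; set D := bet + c^* * gam; set d : R := Normc.normc D.
(* u turns D onto the positive real axis; the hypothesis is then read along the radius t u, with t
   tending to 1. *)
have [u [u1 Du]] : exists u : R[i], Normc.normc u = 1 /\ complex.Re (D * u) = d.
  have [d0|d0] := eqVneq d 0.
    exists 1; rewrite Normc.normc1 mulr1; split=> //; rewrite d0.
    by rewrite (Normc.eq0_normc d0).
  exists (D^* / d%:C%C); rewrite Normc.normcM normcJr Normc.normcV normc_real.
  rewrite ger0_norm ?normc_ge0// divff//; split=> //.
  rewrite mulrA mulcJ -/d expr2 (rmorphM (real_complex R)) mulfK//.
  by rewrite (fmorph_eq0 (real_complex R)).
have key (t : R) : 0 <= t < 1 ->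
    0 <= 1 - Normc.normc c ^+ 2 +
      t ^+ 2 * (Normc.normc bet ^+ 2 - Normc.normc gam ^+ 2) - 2 * t * d.
  move=> /andP[t0 t1]; have tu : Normc.normc (t%:C%C * u) = t.
    by rewrite Normc.normcM u1 mulr1 normc_real ger0_norm.
  have := h (t%:C%C * u); rewrite tu => /(_ t1).
  rewrite -(@ler_pXn2r _ 2) ?nnegrE ?normc_ge0// !normc_sqrDE.
  rewrite normc_opp !Normc.normcM u1 Normc.normc1 normc_real (ger0_norm t0).
  have -> : c^* * (gam * (t%:C%C * u)) = t%:C%C * (c^* * gam * u) by ring.
  have -> : 1^* * - (bet * (t%:C%C * u)) = - (t%:C%C * (bet * u)).
    by rewrite conjC1; ring.
  rewrite cReN !cReM; move: Du; rewrite /D mulrDl cReD => Du.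
  rewrite !mulr1 !exprMn expr1n => h1.
  have : complex.Re (c^* * gam * u) = d - complex.Re (bet * u) by lra.
  move=> e; rewrite e in h1; lra.
set p := Normc.normc bet ^+ 2 - Normc.normc gam ^+ 2 in key *.
have h0 : (harmonic : nat -> R) @ \oo --> (0 : R) by exact: cvg_harmonic.
(* At t = 1 - [harmonic n] the expression in [key] exceeds its value at t = 1 by at most this
   multiple of [harmonic n]. *)
rewrite -subr_ge0; apply: le_cvg0 (cvg0Z (3 * `|p| + 2 * d) h0) => n.
have hn0 : 0 < (harmonic n : R) by exact: harmonic_gt0.
have hn1 : (harmonic n : R) <= 1 by rewrite /harmonic /= invf_le1// ler1n.
have := key (1 - harmonic n); rewrite subr_ge0 hn1 gtrBl hn0 => /(_ isT).
have h1 := ler_norm p; have h2 := ler_norm (- p); rewrite normrN in h2.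
move: (harmonic n : R) hn0 hn1 => x x0 x1 h3.
have h4 : x * (- p) <= x * `|p| by rewrite ler_pM2l.
have h5 : x ^+ 2 * p <= x * `|p|.
  have : x ^+ 2 * p <= x ^+ 2 * `|p| by rewrite ler_wpM2l ?sqr_ge0.
  have : x ^+ 2 * `|p| <= x * `|p|.
    by rewrite ler_wpM2r ?normr_ge0// expr2 ler_piMl// ltW.
  lra.
have -> : 1 + Normc.normc bet ^+ 2 - Normc.normc c ^+ 2 - Normc.normc gam ^+ 2 -
   2 * d = 1 - Normc.normc c ^+ 2 + p - 2 * d by rewrite /p; ring.
have e3 : 1 - Normc.normc c ^+ 2 + (1 - x) ^+ 2 * p - 2 * (1 - x) * d =
   1 - Normc.normc c ^+ 2 + p - 2 * d + 2 * (x * (- p)) + x ^+ 2 * p + 2 * x * d.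
  by ring.
rewrite e3 in h3; lra.
Qed.

End FejerRiesz.

Section Nonextreme.
Context {R : realType}.
Implicit Types (f g b : disc R -> R[i]).
Local Notation H2 := (@hardy2 R).
Let pH := @hardy_prehilbert R.

Lemma ball_bound b : hardy_inf_ball b -> forall z, Normc.normc (b z) <= 1.
Proof.
move=> [[_ [M hM]] h] z; apply: le_trans h; apply: ub_le_sup; last by exists z.
by exists M => _ [x _ <-]; exact: hM.
Qed.

Lemma nsq_convex {X : lmodType R[i]} (H : innerSpace X) (hH : prehilbert H)
  (t : R) x y : carrier H x -> carrier H y ->
  nsq H (t%:C%C *: x + (1 - t)%:C%C *: y) =
  t * nsq H x + (1 - t) * nsq H y - t * (1 - t) * nsq H (x - y).
Proof.
move=> hx hy.
rewrite (nsqD hH (carrierZ hH _ hx) (carrierZ hH _ hy)) !(nsqZ hH)//.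
rewrite (ipZl hH _ hx (carrierZ hH _ hy)) (ipZr hH _ hy hx) conj_real !cReM.
by rewrite (nsqB hH hx hy) !normc_real !real_normK ?num_real//; ring.
Qed.

Lemma convex_ineq (t A B D m n N : R) :
  t * A <= t * N -> (1 - t) * B <= (1 - t) * N ->
  t * (1 - t) * (m * n) <= t * (1 - t) * D ->
  t * A + (1 - t) * B - t * (1 - t) * D + t * (1 - t) * m * n <= N.
Proof. lra. Qed.

(** For b = t y + (1 - t) z, [nsq_convex] gives |b v|^2 <= |v|^2 - t (1 - t) |h v|^2 with h = y - z.
    If m is the order of the zero of h at 0, the coefficient of order m of h v is that of h times
    v(0), which bounds |h v| from below. *)
Lemma nonextreme_gap b : hardy_inf_ball b -> nonextreme b ->
  exists2 c : R, 0 < c & forall v, carrier H2 v ->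
    nsq H2 (toeplitz b v) + c * Normc.normc (ip H2 v cst1) ^+ 2 <= nsq H2 v.
Proof.
move=> hb hne.
have [y [z [t [hy hz t01 e yz]]]] : exists y z (t : R), [/\ hardy_inf_ball y,
    hardy_inf_ball z, 0 < t < 1, b = t%:C%C *: y + (1 - t)%:C%C *: z & y <> z].
  apply: contrapT => h; apply: hne; split=> // y z t hy hz t01 e.
  have yz : y = z.
    by apply: contrapT => yz; apply: h; exists y, z, t.
  suff -> : b = z by rewrite yz.
  rewrite e yz -scalerDl -(rmorphD (real_complex R)) addrC subrK.
  by rewrite (rmorph1 (real_complex R)) scale1r.
have [[ya _] _] := hy; have [[za _] _] := hz.
have y1 := ball_bound hy; have z1 := ball_bound hz.
have yb := toeplitz_bounded ya y1; have zb := toeplitz_bounded za z1.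
pose h := -1 *: z + y.
have ha : analytic_on_disc h.
  by eexists; exact: taylor_lin (taylor_analytic za) (taylor_analytic ya).
have h2 x : Normc.normc (h x) <= 2.
  rewrite -[h x]/(-1 * z x + y x) mulN1r; apply: le_trans (le_normcD _ _) _.
  by rewrite normc_opp; have := y1 x; have := z1 x; lra.
have h0 : h <> 0.
  by rewrite /h scaleN1r addrC => /eqP; rewrite subr_eq0 => /eqP.
have [m [hm low]] := taylor_neq0 ha h0.
have hT := toeplitz_bounded ha h2.
have /andP[t0 t1] := t01.
exists (t * (1 - t) * Normc.normc (taylor h m) ^+ 2).
  apply: mulr_gt0; first by apply: mulr_gt0; rewrite ?subr_gt0.
  apply: exprn_gt0; rewrite lt_def normc_ge0 andbT.
  by apply/eqP => /Normc.eq0_normc.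
move=> v hv; have hyv := bounded_carrier yb hv; have hzv := bounded_carrier zb hv.
have hhv := bounded_carrier hT hv.
have -> : toeplitz b v = t%:C%C *: toeplitz y v + (1 - t)%:C%C *: toeplitz z v.
  apply/funext => x; rewrite e.
  rewrite -[LHS]/((t%:C%C * y x + (1 - t)%:C%C * z x) * v x).
  by rewrite -[RHS]/(t%:C%C * (y x * v x) + (1 - t)%:C%C * (z x * v x)); ring.
rewrite (nsq_convex pH _ hyv hzv).
have -> : toeplitz y v - toeplitz z v = toeplitz h v.
  apply/funext => x; rewrite -[LHS]/(y x * v x - z x * v x).
  by rewrite -[RHS]/((-1 * z x + y x) * v x); ring.
have lb : Normc.normc (taylor h m) ^+ 2 * Normc.normc (ip H2 v cst1) ^+ 2 <=
    nsq H2 (toeplitz h v).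
  have [_ em] := taylor_toeplitz_low ha h2 low hv.
  rewrite (ip_cst1 hv) -exprMn -Normc.normcM -em.
  apply: le_trans (hardy_nsq_le m.+1 hhv).
  by rewrite big_ord_recr /= lerDr sumr_ge0// => i _; exact: sqr_ge0.
have [_ ub1] := multiplier ya y1 hv; have [_ ub2] := multiplier za z1 hv.
rewrite expr1n mul1r in ub1; rewrite expr1n mul1r in ub2.
have s0 : 0 < 1 - t by rewrite subr_gt0.
have ts0 : 0 <= t * (1 - t) by rewrite mulr_ge0// ltW.
exact: (convex_ineq (ler_wpM2l (ltW t0) ub1) (ler_wpM2l (ltW s0) ub2)
  (ler_wpM2l ts0 lb)).
Qed.

End Nonextreme.

(** * Linear fractional functions *)

Section LinearFractional.
Context {R : realType}.
Implicit Types (f g : disc R -> R[i]) (c gam bet : R[i]).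
Local Notation H2 := (@hardy2 R).
Let pH := @hardy_prehilbert R.

Lemma taylorZ (c : R[i]) f : carrier H2 f -> taylor (c *: f) = (fun n => c * taylor f n).
Proof.
move=> hf; apply: taylorE.
have h := taylor_lin (c := c - 1) (hardy_taylor hf) (hardy_taylor hf).
have e1 : (c - 1) *: f + f = c *: f by rewrite scalerBl scale1r subrK.
have e2 : (fun n => (c - 1) * taylor f n + taylor f n) = (fun n => c * taylor f n).
  by apply/funext => n; rewrite mulrBl mul1r subrK.
by rewrite e1 e2 in h.
Qed.

(** Multiplication by 1 - bet z turns the recurrence into the vanishing of all coefficients from
    order two on. *)
Lemma taylor_linear_fraction f bet z : analytic_on_disc f ->
  (forall n, taylor f n.+2 = bet * taylor f n.+1) ->
  (1 - bet * val z) * f z =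
  taylor f 0%N + (taylor f 1%N - bet * taylor f 0%N) * val z.
Proof.
move=> fa h; have ft := taylor_analytic fa.
have /taylorP h1 := taylor_lin (c := - bet) (taylor_mulz ft) ft.
have -> : (1 - bet * val z) * f z = - bet * (val z * f z) + f z by ring.
apply: (csum_unique (h1 z)).
have := @csum_finite _ (fun n => (- bet * coef_shift (taylor f) n + taylor f n) * val z ^+ n) 2.
rewrite !big_ord_recl big_ord0 /=.
have -> : (- bet * 0 + taylor f 0) * val z ^+ 0 +
   ((- bet * taylor f 0 + taylor f (bump 0 0)) * val z ^+ bump 0 0 + 0) =
   taylor f 0 + (taylor f 1 - bet * taylor f 0) * val z.
  by rewrite /bump /=; ring.
apply=> -[//|[//|n]] _; rewrite /= h; ring.
Qed.

Lemma linear_fraction_taylor f c gam bet : analytic_on_disc f ->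
  (forall z, (1 - bet * val z) * f z = c + gam * val z) ->
  forall n, taylor f n.+2 = bet * taylor f n.+1.
Proof.
move=> fa h n; have ft := taylor_analytic fa.
have h1 := taylor_lin (c := - bet) (taylor_mulz ft) ft.
have h2 := taylor_lin (c := 1) (taylor_mulz (@taylor_cst R gam)) (@taylor_cst R c).
have e : - bet *: mulz f + f = 1 *: mulz (fun=> gam) + (fun=> c).
  apply/funext => z.
  rewrite -[LHS]/(- bet * (val z * f z) + f z).
  rewrite -[RHS]/(1 * (val z * gam) + c).
  by rewrite mul1r addrC [val z * gam]mulrC [RHS]addrC -h; ring.
rewrite e in h1; have := congr1 (fun u : nat -> R[i] => u n.+2) (taylor_unique h1 h2).
rewrite /= mulr0n mulr0 addr0 mulNr => /eqP; rewrite addrC subr_eq0 => /eqP.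
exact.
Qed.

Lemma geometric_taylor f bet : (forall n, taylor f n.+2 = bet * taylor f n.+1) ->
  forall n, taylor f n.+1 = bet ^+ n * taylor f 1%N.
Proof.
move=> h; elim=> [|n ih]; first by rewrite expr0 mul1r.
by rewrite h ih mulrA exprS.
Qed.

(** If |bet| >= 1, every coefficient from order one on has modulus at least that of the first, so
    the sum of squares grows beyond |f|^2. *)
Lemma geometric_ratio_lt1 f bet : carrier H2 f ->
  (forall n, taylor f n.+2 = bet * taylor f n.+1) -> taylor f 1%N <> 0 ->
  Normc.normc bet < 1.
Proof.
move=> hf /geometric_taylor h f1; rewrite ltNge; apply/negP => b1.
pose q : R := Normc.normc (taylor f 1%N) ^+ 2.
have q0 : 0 < q.
  by apply: exprn_gt0; rewrite lt_def normc_ge0 andbT; apply/eqP => /Normc.eq0_normc.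
have M0 := nsq_ge0 pH hf.
have key n : n%:R * q <= nsq H2 f.
  apply: le_trans (bshift_tail hf n).
  rewrite mulr_natl -[n in leLHS]card_ord -sumr_const; apply: ler_sum => i _.
  rewrite h Normc.normcM exprMn ler_peMl ?sqr_ge0// exprn_ege1// normcX.
  by rewrite exprn_ege1.
have := archi_boundP (divr_ge0 M0 (ltW q0)); rewrite ltr_pdivrMr// => h1.
have := lt_le_trans h1 (key (Num.bound (nsq H2 f / q))).
by rewrite ltxx.
Qed.

(** The function 1 / (1 - bet z) serves twice: as the eigenvector k of the backward shift, and as
    the symbol of the multiplication P, for which the uniform bound is required. *)
Lemma szego_kernel bet : Normc.normc bet < 1 -> exists k : disc R -> R[i],
  [/\ carrier H2 k, forall n, taylor k n = bet ^+ n,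
   forall z, (1 - bet * val z) * k z = 1 &
   forall z, Normc.normc (k z) <= (1 - Normc.normc bet)^-1].
Proof.
move=> b1; have p0 := normc_ge0 bet.
have hM : l2_le (fun n => bet ^+ n) (1 - Normc.normc bet ^+ 2)^-1.
  move=> n; have h : 0 <= Normc.normc bet ^+ 2 < 1 by rewrite sqr_ge0 exprn_ilt1.
  apply: le_trans (geo_sum n h); apply: ler_sum => i _.
  by rewrite normcX -!exprM mulnC.
have [k hk ek] := l2_hardy hM.
have kz z : (1 - bet * val z) * k z = 1.
  have ka : analytic_on_disc k by exists (taylor k); exact: hardy_taylor.
  rewrite (taylor_linear_fraction z ka (bet := bet)) ek => [|n]; last by rewrite exprS.
  by rewrite expr0 expr1 mulr1 subrr mul0r addr0.
exists k; split=> // [n|z]; first by rewrite ek.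
have d0 : 0 < 1 - Normc.normc bet by rewrite subr_gt0.
have h1 : Normc.normc (1 - bet * val z) * Normc.normc (k z) = 1.
  by rewrite -Normc.normcM kz Normc.normc1.
have h2 : 1 - Normc.normc bet <= Normc.normc (1 - bet * val z).
  have := le_normcD (1 - bet * val z) (bet * val z).
  rewrite subrK Normc.normc1 Normc.normcM.
  have := ler_piMr p0 (ltW (disc_norm z)); lra.
have h3 := ler_wpM2r (normc_ge0 (k z)) h2; rewrite h1 in h3.
by rewrite -[leRHS]mul1r ler_pdivlMr// mulrC.
Qed.

(** The integral of |x + y z|^2 |p|^2 over the circle. It depends on x and y only through |x|^2 +
    |y|^2 and x conj(y), the Fourier coefficients of |x + y z|^2; hence identities between
    trigonometric polynomials become identities between norms. *)
Lemma nsq_add_mulz (x y : R[i]) p : carrier H2 p ->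
  nsq H2 (x *: p + y *: mulz p) = (Normc.normc x ^+ 2 + Normc.normc y ^+ 2) * nsq H2 p +
  2 * complex.Re (x * y^* * ip H2 p (mulz p)).
Proof.
move=> hp; have hz := mulz_carrier hp.
rewrite (nsqD pH (carrierZ pH _ hp) (carrierZ pH _ hz)) (nsqZ pH _ hp) (nsqZ pH _ hz).
rewrite (ipZl pH _ hp (carrierZ pH _ hz)) (ipZr pH _ hz hp) mulrA.
have -> : nsq H2 (mulz p) = nsq H2 p.
  by rewrite /nsq (mulz_adj hp hz) (bshift_mulz hp).
by rewrite (mulrDl (Normc.normc x ^+ 2)).
Qed.

Lemma ip_mulz_cst1 : ip H2 (@cst1 R) (mulz (@cst1 R)) = 0.
Proof.
have h1 := @cst1_carrier R; have h2 := mulz_carrier h1.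
rewrite (ipC pH h1 h2) (ip_cst1 h2); have [_ _ ->] := mulz_hardy h1.
exact: conj0.
Qed.

End LinearFractional.

(** * The two implications on the Hardy space *)

Section Main.
Context {R : realType}.
Variable b : disc R -> R[i].
Hypothesis b_ball : hardy_inf_ball b.
Hypothesis b_nonextreme : nonextreme b.
Local Notation H2 := (@hardy2 R).
Local Notation e := (@cst1 R).
Let hH := @hardy_hilbert R.
Let pH := @hardy_prehilbert R.
Let He := @cst1_carrier R.

Let ba : analytic_on_disc b.
Proof. by case: b_ball => [[]]. Qed.

Let b1 : forall z, Normc.normc (b z) <= 1 := ball_bound b_ball.

Let hT : bounded_operator H2 (toeplitz b) := toeplitz_bounded ba b1.

Let Tcontr v : carrier H2 v -> nsq H2 (toeplitz b v) <= nsq H2 v.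
Proof. by move=> hv; case: (multiplier ba b1 hv); rewrite expr1n mul1r. Qed.

Let Kb : carrier (de_branges_rovnyak b) (dbr_b (toeplitz b) e).
Proof.
have [c c0 hc] := nonextreme_gap b_ball b_nonextreme.
exact: (dbr_gap hH hT He Tcontr c0 hc).
Qed.

Let TS x : carrier H2 x -> toeplitz b (mulz x) = mulz (toeplitz b x).
Proof. by move=> _; exact: toeplitz_mulz. Qed.

Let Hb : carrier H2 b.
Proof. by rewrite -(toeplitz_cst1 b); exact: bounded_carrier hT He. Qed.

Lemma hyperexpansive_linear_fraction :
  completely_hyperexpansive (de_branges_rovnyak b) (@mulz R) ->
  exists c gamma beta : R[i], Normc.normc beta < 1 /\
    forall z, (1 - beta * val z) * b z = c + gamma * val z.
Proof.
move=> hyp.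
have [mu] := dbr_hyperexpansive_eigen hH (@mulz_bounded R) (@bshift_bounded R)
  hT He (@bshift_mulz R) (@bshiftK R) (@mulz_adj R) (@ip_cst1_cst1 R) TS Tcontr Kb hyp.
rewrite /dbr_w toeplitz_cst1 => emu.
have Hw := bshift_carrier Hb.
have rec n : taylor b n.+2 = mu * taylor b n.+1.
  rewrite -(taylor_bshift n.+1 Hb) -(taylor_bshift n Hw) emu (taylorZ mu Hw).
  by rewrite (taylor_bshift n Hb).
(* In this case b is constant and mu is unconstrained, so beta = 0 is taken instead of mu. *)
have [b10|b10] := pselect (taylor b 1%N = 0).
  exists (taylor b 0%N), 0, 0; rewrite Normc.normc0 ltr01; split=> // z.
  rewrite (taylor_linear_fraction z ba) => [|n]; first by rewrite b10 mul0r subr0.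
  by rewrite mul0r (geometric_taylor rec) b10 mulr0.
exists (taylor b 0%N), (taylor b 1%N - mu * taylor b 0%N), mu; split.
  exact: (geometric_ratio_lt1 Hb rec b10).
by move=> z; exact: taylor_linear_fraction.
Qed.

Lemma linear_fraction_hyperexpansive c gamma beta : Normc.normc beta < 1 ->
  (forall z, (1 - beta * val z) * b z = c + gamma * val z) ->
  completely_hyperexpansive (de_branges_rovnyak b) (@mulz R).
Proof.
move=> beta1 hb; have [k [Hk ek kz kM]] := szego_kernel beta1.
have ka : analytic_on_disc k by exists (taylor k); exact: hardy_taylor.
have hP := toeplitz_bounded ka kM.
have bk z : b z = (c + gamma * val z) * k z.
  by rewrite -hb mulrAC kz mul1r.
have TP g : carrier H2 g ->
    toeplitz b g = c *: toeplitz k g + gamma *: mulz (toeplitz k g).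
  move=> _; apply/funext => z; rewrite -[LHS]/(b z * g z) bk.
  by rewrite -[RHS]/(c * (k z * g z) + gamma * (val z * (k z * g z))); ring.
have gP g : g = 1 *: toeplitz k g + (- beta) *: mulz (toeplitz k g).
  apply/funext => z.
  rewrite -[RHS]/(1 * (k z * g z) + - beta * (val z * (k z * g z))).
  have -> : 1 * (k z * g z) + - beta * (val z * (k z * g z)) =
     (1 - beta * val z) * k z * g z by ring.
  by rewrite kz mul1r.
(* On the circle |1 - beta z|^2 - |c + gamma z|^2 = A - 2 Re (D z), and this is to be factored as |r
   + s z|^2; hence the sign of D below. *)
pose D := beta + c^* * gamma.
pose A := 1 + Normc.normc beta ^+ 2 - Normc.normc c ^+ 2 - Normc.normc gamma ^+ 2.
have DA : 2 * Normc.normc (- D) <= A.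
  rewrite normc_opp; apply: unit_circle_bound => x x1.
  have [z <-] := in_disc x1; rewrite -hb Normc.normcM.
  by rewrite ler_piMr ?normc_ge0.
(* The gap inequality at v = 1 - beta z, where b v = c + gamma z and v(0) = 1, reads |c|^2 +
   |gamma|^2 + d <= 1 + |beta|^2. *)
have A0 : 0 < A.
  have [d d0 hd] := nonextreme_gap b_ball b_nonextreme.
  have hze := mulz_carrier He.
  pose v := 1 *: e + (- beta) *: mulz e.
  have hv : carrier H2 v := carrierD pH (carrierZ pH 1 He) (carrierZ pH (- beta) hze).
  have nee : nsq H2 e = 1 by rewrite /nsq ip_cst1_cst1.
  have := hd v hv.
  have -> : toeplitz b v = c *: e + gamma *: mulz e.
    apply/funext => z.
    rewrite -[LHS]/(b z * (1 * 1 + - beta * (val z * 1))).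
    rewrite -[RHS]/(c * 1 + gamma * (val z * 1)).
    have -> : b z * (1 * 1 + - beta * (val z * 1)) = (1 - beta * val z) * b z by ring.
    by rewrite hb; ring.
  have -> : ip H2 v e = 1.
    rewrite (ipDl pH (carrierZ pH 1 He) (carrierZ pH (- beta) hze) He).
    rewrite (ipZl pH _ He He) (ipZl pH _ hze He) ip_cst1_cst1.
    by rewrite (ipC pH hze He) ip_mulz_cst1 conj0 mulr0 addr0 mul1r.
  rewrite !(nsq_add_mulz _ _ He) nee ip_mulz_cst1 !mulr0 Normc.normc1 normc_opp /A /=.
  lra.
have [r [s [r0 rsA rsD sr]]] := fejer_riesz A0 DA.
(* With p = k g one has g = (1 - beta z) p, b g = (c + gamma z) p and a g = (r + s z) p, so
   [nsq_add_mulz] reduces the claim to the factorisation; equality in fact holds. *)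
have Tmate g : carrier H2 g -> nsq H2 (toeplitz b g) +
    nsq H2 (r%:C%C *: toeplitz k g + s *: mulz (toeplitz k g)) <= nsq H2 g.
  move=> hg; have hp := bounded_carrier hP hg.
  rewrite [X in _ <= nsq H2 X]gP (TP g hg) !(nsq_add_mulz _ _ hp).
  set I := ip H2 _ _; set N : R := nsq H2 _.
  have -> : 1 * (- beta)^* * I = (c * gamma^* + r%:C%C * s^*) * I.
    congr (_ * _); have := congr1 Num.conj rsD; rewrite /= conjM conj_real => ->.
    by rewrite /D !conjN conjD conjM conjCK; ring.
  rewrite (mulrDl (c * gamma^*)) cReD Normc.normc1 normc_opp normc_real (gtr0_norm r0).
  have -> : (1 ^+ 2 + Normc.normc beta ^+ 2) * N =
      (Normc.normc c ^+ 2 + Normc.normc gamma ^+ 2) * N +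
      (r ^+ 2 + Normc.normc s ^+ 2) * N by rewrite rsA /A expr1n; ring.
  by rewrite mulrDr addrACA.
have r0C : r%:C%C != 0 :> R[i] by rewrite (fmorph_eq0 (real_complex R)) gt_eqF.
have sr' : Normc.normc s <= Normc.normc (r%:C%C : R[i]) by rewrite normc_real gtr0_norm.
have Bk : bshift k = beta *: k.
  apply: (taylor_inj (bshift_carrier Hk) (carrierZ pH _ Hk)).
  by rewrite (taylorZ _ Hk); apply/funext => n; rewrite (taylor_bshift n Hk) !ek exprS.
apply: (dbr_eigen_hyperexpansive hH (@mulz_bounded R) (@bshift_bounded R)
  hT He (@bshift_mulz R) (@bshiftK R) (@mulz_adj R) (@ip_cst1_cst1 R) TS Tcontr Kb
  (fun g hg => bounded_carrier hP hg) TP Tmate r0C sr' beta1 Hk Bk).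
(* The coefficients of b from order one on are [taylor b 1] times powers of beta, which are the
   coefficients of k. *)
exists (taylor b 1%N); rewrite /dbr_w toeplitz_cst1.
have rec := linear_fraction_taylor ba hb.
apply: (taylor_inj (bshift_carrier Hb) (carrierZ pH _ Hk)).
rewrite (taylorZ _ Hk); apply/funext => n.
by rewrite (taylor_bshift n Hb) (geometric_taylor rec) ek mulrC.
Qed.

End Main.

Theorem proposition3p1 (R : realType) (b : disc R -> R[i])
    (b_ball : hardy_inf_ball b) (b_nonextreme : nonextreme b) :
  completely_hyperexpansive (de_branges_rovnyak b) mulz <->
  exists c gamma beta : R[i],
    `|beta| < 1 /\
    forall z : disc R, b z = (c + gamma * val z) / (1 - beta * val z).
Proof.
have nz (beta : R[i]) z : Normc.normc beta < 1 -> 1 - beta * val (z : disc R) != 0.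
  move=> h; rewrite subr_eq0; apply/eqP => e.
  have := Normc.normc1 R; rewrite [in LHS]e Normc.normcM => h1.
  have := ler_piMr (normc_ge0 beta) (ltW (disc_norm z)); rewrite h1 => h2.
  by have := le_lt_trans h2 h; rewrite ltxx.
have lt1 (beta : R[i]) : (`|beta| < 1) = (Normc.normc beta < 1).
  by rewrite norm_normc ltcE /= eqxx.
split=> [/(hyperexpansive_linear_fraction b_ball b_nonextreme)|].
  move=> [c [gamma [beta [h hb]]]]; exists c, gamma, beta; rewrite lt1; split=> // z.
  by rewrite -hb mulrAC mulfV ?mul1r ?nz.
move=> [c [gamma [beta [h hb]]]]; rewrite lt1 in h.
apply: (linear_fraction_hyperexpansive b_ball b_nonextreme h) => z.
by rewrite hb mulrC divfK// nz.
Qed.
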